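(* Let the graph limit $\Gamma\in\mathcal U_\infty$ have the decomposition $\Gamma=\bigoplus_{i=1}^M\alpha_i\Gamma_i$ into components, where $0\le M\le\infty$, every $\Gamma_i\in\mathcal U_\infty$ is connected, every $\alpha_i>0$ and $\sum_{i=1}^M\alpha_i\le1$. Then the sequence $(p_i)_{i=1}^\infty$ of asymptotic densities of the exchangeable random partition $\Pi_\Gamma$ equals almost surely $(\alpha_i)_{i=1}^M$ arranged in decreasing order, and extended by $0$'s if $M<\infty$.
   Context: Graphs are finite, simple, undirected, with at least one vertex, unless explicitly infinite; $v(G)=|V(G)|$, $e(G)=|E(G)|$. Graph limits. For graphs $F,G$, $t(F,G)$ is the probability that a uniformly random map $V(F)\to V(G)$ is a graph homomorphism (maps edges to edges). The set $\mathcal U$ of unlabelled graphs (isomorphism classes) is embedded as a dense subset of a compact metric space $\overline{\mathcal U}$; the elements of $\mathcal U_\infty=\overline{\mathcal U}\setminus\mathcal U$ are called graph limits, and $v(\Gamma)=\infty$ for $\Gamma\in\mathcal U_\infty$. Each $t(F,\cdot)$ extends continuously to $\overline{\mathcal U}$; a graph limit $\Gamma$ is determined by the numbers $t(F,\Gamma)$, $F$ ranging over all graphs; and a sequence $G_n$ in $\overline{\mathcal U}$ converges to $\Gamma\in\mathcal U_\infty$ iff $v(G_n)\to\infty$ and $t(F,G_n)\to t(F,\Gamma)$ for every graph $F$. (Concretely, graph limits can be identified with the families $(t_F)_F$ arising as $t_F=\lim_n t(F,G_n)$ for sequences of graphs with $v(G_n)\to\infty$ for which all these limits exist.) Direct sums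 and connectedness. For $0\le m\le\infty$, graph limits $(\Gamma_i)_{i=1}^m$ and weights $\alpha_i\ge0$ with $\sum_{i=1}^m\alpha_i\le1$, $\bigoplus_{i=1}^m\alpha_i\Gamma_i$ is the unique graph limit $\Gamma$ with $t(F,\Gamma)=\sum_{i=1}^m\alpha_i^{v(F)}t(F,\Gamma_i)$ for every connected graph $F$ with at least one edge (for $m=0$ it is the trivial graph limit $\mathbf 0$, with $t(F,\mathbf 0)=0$ if $e(F)\ge1$ and $1$ if $e(F)=0$); for $m=2$ and weights $\alpha,1-\alpha$ it is written $\alpha\Gamma_1\oplus(1-\alpha)\Gamma_2$. A graph limit $\Gamma$ is disconnected if there exist $\Gamma_1,\Gamma_2\in\mathcal U_\infty$ and $\alpha\in(0,1)$ with $\Gamma=\alpha\Gamma_1\oplus(1-\alpha)\Gamma_2$; otherwise it is connected. Every graph limit has a decomposition into components of the form stated in the claim, unique up to simultaneous permutation of the $\Gamma_i$ and $\alpha_i$. Random graphs. A kernel on a probability space $(\mathcal S,\mu)$ is a symmetric measurable $W:\mathcal S\times\mathcal S\to[0,1]$; it represents the unique graph limit $\Gamma_W$ with $t(F,\Gamma_W)=\int_{\mathcal S^{v(F)}}\prod_{ij\in E(F)}W(x_i,x_j)\,d\mu(x_1)\cdots d\mu(x_{v(F)})$ for every graph $F$. Every graph limit is represented by some kernel. $G(\infty,\Gamma)$ is the infinite random graph with vertex set $\mathbb N=\{1,2,\dots\}$ obtained, for any kernel $W$ representing $\Gamma$, by taking i.i.d. $X_1,X_2,\dots$ with distribution $\mu$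 and, conditionally given these, including each edge $ij$ ($i<j$) independently with probability $W(X_i,X_j)$. Its distribution depends only on $\Gamma$ and is characterized by $\mathbb P(G(\infty,\Gamma)\supseteq F)=t(F,\Gamma)$ for every graph $F$ with $V(F)=\{1,\dots,k\}$, $k\ge1$. The partition. $\Pi_\Gamma$ is the random partition of $\mathbb N$ into the vertex sets of the connected components of $G(\infty,\Gamma)$; it is exchangeable (its distribution is invariant under permutations of $\mathbb N$). By a theorem of Kingman, almost surely every block $B$ of an exchangeable random partition of $\mathbb N$ has an asymptotic density $\lim_{n\to\infty}|B\cap\{1,\dots,n\}|/n$. The sequence $(p_i)_{i=1}^\infty$ consists of these densities of the blocks in decreasing order, ignoring or adding $0$'s as needed (i.e., the positive densities, with multiplicity, in decreasing order, followed by $0$'s if there are only finitely many positive ones). *)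

(* Defs.v *)
From HB Require Import structures.
From mathcomp Require Import all_boot all_order all_algebra.
From mathcomp Require Import all_classical all_reals all_analysis.

Set Implicit Arguments.
Unset Strict Implicit.
Unset Printing Implicit Defensive.

Import Order.TTheory GRing.Theory Num.Theory.
Import numFieldNormedType.Exports.

Local Open Scope classical_set_scope.
Local Open Scope ring_scope.

(* Finite simple graphs with at least one vertex.  Every isomorphism class has
   a representative whose vertex set is some 'I_n. *)
Record sgraph := SGraph {
  nverts : nat;
  edge : rel 'I_nverts;
  nverts_gt0 : (0 < nverts)%N;
  edge_sym : symmetric edge;
  edge_irr : irreflexive edge }.

Definition connected_graph (F : sgraph) : Prop :=
  forall x y : 'I_(nverts F), connect (@edge F) x y.

Definition has_edge (F : sgraph) : Prop :=
  exists x y : 'I_(nverts F), edge x y.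

Definition is_hom (F G : sgraph) (h : {ffun 'I_(nverts F) -> 'I_(nverts G)}) :=
  [forall x, forall y, edge x y ==> edge (h x) (h y)].

Definition hom_density (R : realType) (F G : sgraph) : R :=
  #|@is_hom F G|%:R / #|{ffun 'I_(nverts F) -> 'I_(nverts G)}|%:R.

(* A graph limit is determined by the numbers t(F, Gamma), so it is identified
   with the family of these numbers. *)
Record graph_limit (R : realType) := GraphLimit {
  lim_density : sgraph -> R;
  lim_densityP : exists G : nat -> sgraph,
    nverts (G n) @[n --> \oo] --> \oo /\
    forall F, hom_density R F (G n) @[n --> \oo] --> lim_density F }.

(* The index set {i | i < M} for M in {0, 1, ..., oo}; None stands for oo, and
   indices start at 0. *)
Definition below (M : option nat) (i : nat) : bool :=
  if M is Some m then (i < m)%N else true.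

(* Gamma is the direct sum of the a_i Gamma_i over i < M; the values of a and
   Gam outside the index set are irrelevant. *)
Definition is_direct_sum (R : realType) (M : option nat) (a : nat -> R)
    (Gam : nat -> graph_limit R) (Gamma : graph_limit R) : Prop :=
  [/\ forall i, below M i -> 0 <= a i,
      (\sum_(0 <= i <oo | below M i) (a i)%:E <= 1)%E &
      forall F, connected_graph F -> has_edge F ->
        (lim_density Gamma F)%:E =
        (\sum_(0 <= i <oo | below M i)
           (a i ^+ nverts F * lim_density (Gam i) F)%:E)%E].

Definition disconnected_limit (R : realType) (Gamma : graph_limit R) : Prop :=
  exists (Gamma1 Gamma2 : graph_limit R) (a : R),
    0 < a < 1 /\
    is_direct_sum (Some 2%N) (fun i => if i == 0%N then a else 1 - a)
      (fun i => if i == 0%N then Gamma1 else Gamma2) Gamma.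

Definition connected_limit (R : realType) (Gamma : graph_limit R) : Prop :=
  ~ disconnected_limit Gamma.

Section Kernels.
Context d (S : measurableType d) (R : realType).
Variable mu : probability S R.

Definition is_kernel (W : S -> S -> R) : Prop :=
  [/\ forall x y, W x y = W y x,
      forall x y, 0 <= W x y <= 1 &
      measurable_fun setT (fun xy : S * S => W xy.1 xy.2)].

(* The integral over S^n with respect to the n-th power of mu, written as an
   iterated integral; by Tonelli's theorem the two agree for the nonnegative
   measurable integrands used below. *)
Fixpoint integral_pow (n : nat) : (n.-tuple S -> \bar R) -> \bar R :=
  match n with
  | 0%N => fun f => f [tuple]
  | m.+1 => fun f =>
      (\int[mu]_x integral_pow (fun t : m.-tuple S => f [tuple of x :: t]))%E
  end.

Definition kernel_density (W : S -> S -> R) (F : sgraph) : \bar R :=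
  integral_pow (fun x : (nverts F).-tuple S =>
    (\prod_(ij : 'I_(nverts F) * 'I_(nverts F) | (ij.1 < ij.2)%N && edge ij.1 ij.2)
       W (tnth x ij.1) (tnth x ij.2))%:E).

Definition represents (W : S -> S -> R) (Gamma : graph_limit R) : Prop :=
  is_kernel W /\ forall F, (lim_density Gamma F)%:E = kernel_density W F.

Context d' (Omega : measurableType d') (P : probability Omega R).

Definition iid (X : nat -> {RV P >-> S}) : Prop :=
  (forall i B, measurable B -> distribution P (X i) B = mu B) /\
  (forall (J : seq nat) (B : nat -> set S), uniq J ->
     (forall i, measurable (B i)) ->
     P (\bigcap_(i in [set` J]) (X i @^-1` B i)) =
     (\prod_(i <- J) P (X i @^-1` B i))%E).

Definition sigma_seq (X : nat -> {RV P >-> S}) : set (set Omega) :=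
  <<s \bigcup_i preimage_set_system setT (X i) measurable >>.

(* Conditionally given sigma(X_0, X_1, ...), the indicators of the pairs i < j
   are independent, the pair i < j being an edge with probability W(X_i, X_j):
   the conditional probability that the subgraph of A induced by {0, ..., n-1}
   is e is the displayed product. *)
Definition edges_cond_indep (W : S -> S -> R) (X : nat -> {RV P >-> S})
    (A : Omega -> rel nat) : Prop :=
  forall (n : nat) (e : rel nat) (E : set Omega), sigma_seq X E ->
    P (E `&` [set w | forall i j, (i < j < n)%N -> A w i j = e i j]) =
    (\int[P]_(w in E)
       (\prod_(j < n) \prod_(i < j)
          (if e i j then W (X i w) (X j w) else 1 - W (X i w) (X j w)))%:E)%E.

End Kernels.

(* A is a realization on (Omega, P) of the infinite random graph
   G(oo, Gamma), with vertex set nat instead of {1, 2, ...}. *)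
Definition is_G_infty (R : realType) d (Omega : measurableType d)
    (P : probability Omega R) (Gamma : graph_limit R)
    (A : Omega -> rel nat) : Prop :=
  [/\ forall w, symmetric (A w),
      forall w, irreflexive (A w),
      forall i j, measurable [set w | A w i j] &
      exists dS (S : measurableType dS) (mu : probability S R)
        (W : S -> S -> R) (X : nat -> {RV P >-> S}),
        [/\ represents mu W Gamma, iid mu X & edges_cond_indep W X A]].

Definition component (e : rel nat) (i : nat) : set nat :=
  [set j | exists2 s : seq nat, path e i s & last i s = j].

Definition blocks (e : rel nat) : set (set nat) := range (component e).

Definition frequency (R : realType) (B : set nat) (n : nat) : R :=
  #|[pred k : 'I_n | (k : nat) \in B]|%:R / n%:R.

Definition density (R : realType) (B : set nat) : R :=
  limn (frequency R B).

(* p lists the positive values among (x i), i in D, with multiplicity and in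
   decreasing order, and continues with 0's if there are finitely many. *)
Definition decreasing_arrangement (R : realType) (T : Type) (D : set T)
    (x : T -> R) (p : nat -> R) : Prop :=
  [/\ forall n, 0 <= p n,
      forall m n, (m <= n)%N -> p n <= p m &
      exists f : nat -> T,
        set_bij [set n | 0 < p n] [set i | D i /\ 0 < x i] f /\
        forall n, 0 < p n -> p n = x (f n)].

(* p is the sequence of asymptotic densities of the partition of nat into the
   components of e; every block is required to have a density. *)
Definition block_densities (R : realType) (e : rel nat) (p : nat -> R) : Prop :=
  (forall B, blocks e B -> cvgn (frequency R B)) /\
  decreasing_arrangement (blocks e) (@density R) p.

(* Main.v *)
Require Import Defs.
From HB Require Import structures.
From mathcomp Require Import all_boot all_order all_algebra.
From mathcomp Require Import all_classical all_reals all_analysis.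
From mathcomp Require Import measurable_realfun.
From mathcomp Require Import ring lra zify.

(** The probability that [k] given vertices lie in one component of the random
    graph is [S k], the sum of the [k]-th powers of the weights, for every
    [k > 1]. These probabilities determine the densities of the components, since
    a decreasing sequence of nonnegative numbers is determined by its power sums.

    To compute them, consider first the probability that [k] vertices are joined
    within a finite sample, in the limit of a sequence of graphs converging to
    [Gamma]. Inclusion-exclusion writes it in terms of the densities of patterns
    in which every edge is connected to the [k] vertices ([joins_mobius]). These
    patterns are connected, so by the formula that defines direct sums the
    probability is the sum over [i] of the probabilities of being joined in the
    [i]-th component, with every vertex kept with probability [alpha i] and
    otherwise isolated ([cvg_direct_sum_joins]). The [i]-th term is at most
    [alpha i ^+ k], because all [k] vertices have to be kept. It tends to this
    value for growing samples, because the component is connected: a sequence of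
    sparse cuts in graphs converging to it would split it in two along an
    ultrafilter, so these graphs expand ([connected_expands]), and an exploration
    through the sampled vertices reaches almost everything ([miss_geometric]).
    This gives [join_limit]. Enlarging the sample to the infinite graph yields
    [S k] ([tied_prob]), and two disjoint groups of [k] vertices are tied with
    probability at most [S k ^+ 2] ([tied_prob2]), being joined through disjoint
    supplies of further vertices.

    Second moments now give almost sure statements. The frequencies of the
    component of each vertex converge, by exchangeability up to order three. The
    averages over the first [n] vertices of the powers of the frequencies
    converge to the numbers [S k] along fourth powers, by the bound on pairs of
    groups. Fatou's lemma allows the frequencies to be replaced by their limits
    in these averages ([ae_tie_freq_cvg], [ae_power_mean], [ae_spread]).

    The rest is deterministic. A uniform vertex falls into a block with
    probability the density of the block, so the power sums of the decreasing
    arrangement of the densities are [S k] up to an error controlled by the first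
    omitted term, and the same holds for the weights
    ([power_sum_sandwich]). Letting the exponent grow shows that there is only
    one such sequence ([trapped_unique]). *)

Set Implicit Arguments.
Unset Strict Implicit.
Unset Printing Implicit Defensive.

Import Order.TTheory GRing.Theory Num.Theory.
Import numFieldNormedType.Exports.

Local Open Scope classical_set_scope.
Local Open Scope ring_scope.


(** * Means over independent samples *)

Section Mean.
Context (R : realType) (T : finType) (wt : T -> R).

Definition prob_weight := (forall t, 0 <= wt t) /\ \sum_t wt t = 1.

(** The expectation of [f] over a map whose values are independent with
    distribution [wt]. *)
Definition mean (I : finType) (f : {ffun I -> T} -> R) : R :=
  \sum_(h : {ffun I -> T}) (\prod_i wt (h i)) * f h.

Lemma eq_mean (I : finType) (f g : {ffun I -> T} -> R) :
  f =1 g -> mean f = mean g.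
Proof. by move=> fg; apply: eq_bigr => h _; rewrite fg. Qed.

Lemma meanD (I : finType) (f g : {ffun I -> T} -> R) :
  mean (fun h => f h + g h) = mean f + mean g.
Proof. by rewrite -big_split; apply: eq_bigr => h _; rewrite mulrDr. Qed.

Lemma meanZ (I : finType) c (f : {ffun I -> T} -> R) :
  mean (fun h => c * f h) = c * mean f.
Proof. by rewrite big_distrr; apply: eq_bigr => h _; rewrite mulrCA. Qed.

Lemma meanN (I : finType) (f : {ffun I -> T} -> R) :
  mean (fun h => - f h) = - mean f.
Proof. by rewrite -sumrN; apply: eq_bigr => h _; rewrite mulrN. Qed.

Lemma mean_sum (I J : finType) (Q : pred J) (f : J -> {ffun I -> T} -> R) :
  mean (fun h => \sum_(j | Q j) f j h) = \sum_(j | Q j) mean (f j).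
Proof.
by rewrite /mean exchange_big; apply: eq_bigr => h _; rewrite big_distrr.
Qed.

Hypothesis wtP : prob_weight.

Lemma le_mean (I : finType) (f g : {ffun I -> T} -> R) :
  (forall h, f h <= g h) -> mean f <= mean g.
Proof.
move=> fg; apply: ler_sum => h _; apply: ler_wpM2l => //.
by apply: prodr_ge0 => i _; case: wtP.
Qed.

Lemma mean_family (I : finType) (D : I -> pred T) :
  mean (fun h : {ffun I -> T} => (h \in family D)%:R) =
  \prod_i \sum_(t | D i t) wt t.
Proof.
rewrite bigA_distr_big_dep big_mkcond; apply: eq_bigr => h _.
by case: (h \in family D); rewrite ?mulr1 ?mulr0.
Qed.

Lemma mean_cst (I : finType) c : mean (fun _ : {ffun I -> T} => c) = c.
Proof.
rewrite -[RHS]mulr1 -[X in c * X](_ : mean (fun _ : {ffun I -> T} => 1) = 1).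
  by rewrite -meanZ; apply: eq_mean => h; rewrite mulr1.
rewrite (eq_mean (g := fun h => (h \in family (fun=> xpredT))%:R)).
  by rewrite mean_family big1// => i _; case: wtP.
by move=> h; rewrite (_ : h \in _) //; apply/familyP.
Qed.

Lemma mean_ge0 (I : finType) (f : {ffun I -> T} -> R) :
  (forall h, 0 <= f h) -> 0 <= mean f.
Proof. by move=> f0; rewrite -(mean_cst I 0) le_mean. Qed.

(** Coordinates outside the image of [iota] have total weight one and integrate
    out. *)
Lemma mean_marginal (J I : finType) (iota : J -> I) (f : {ffun J -> T} -> R) :
  injective iota ->
  mean (fun h : {ffun I -> T} => f [ffun j => h (iota j)]) = mean f.
Proof.
move=> iotaI; rewrite /mean.
rewrite (partition_big (fun h : {ffun I -> T} => [ffun j => h (iota j)])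
  xpredT)//=; apply: eq_bigr => g _.
pose D i := [pred t | if [pick j | iota j == i] is Some j then t == g j else true].
rewrite (eq_bigr (fun h : {ffun I -> T} => (\prod_i wt (h i)) * f g)); last first.
  by move=> h /eqP ->.
rewrite -big_distrl/=; congr (_ * f g).
have eD (h : {ffun I -> T}) : ([ffun j => h (iota j)] == g) = (h \in family D).
  apply/eqP/familyP => [hg i|hD].
    rewrite inE; case: pickP => // j /eqP <-.
    by rewrite -hg ffunE.
  apply/ffunP => j; rewrite ffunE; have := hD (iota j); rewrite inE.
  by case: pickP => [j' /eqP/iotaI -> /eqP//|/(_ j)]; rewrite eqxx.
rewrite (eq_bigl _ _ eD).
transitivity (\prod_i \sum_(t | D i t) wt t).
  by rewrite bigA_distr_big_dep.
rewrite (bigID (fun i => i \in iota @: predT))/= mulrC big1 ?mul1r; last first.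
  move=> i ni; case: wtP => _ <-; apply: eq_bigl => t.
  rewrite /D /=; case: pickP => // j /eqP ji.
  by rewrite -ji imset_f in ni.
rewrite big_imset/=; last by move=> ? ? _ _; exact: iotaI.
apply: eq_big => [j|j _]; first by [].
rewrite (big_pred1 (g j))// => t; rewrite /D /=.
by case: pickP => [j' /eqP/iotaI -> //|/(_ j)]; rewrite eqxx.
Qed.

(** Disjoint sets of coordinates are sampled independently. *)
Lemma mean_indep (J1 J2 I : finType) (i1 : J1 -> I) (i2 : J2 -> I)
    (f1 : {ffun J1 -> T} -> R) (f2 : {ffun J2 -> T} -> R) :
  injective i1 -> injective i2 -> (forall j1 j2, i1 j1 != i2 j2) ->
  mean (fun h : {ffun I -> T} =>
    f1 [ffun j => h (i1 j)] * f2 [ffun j => h (i2 j)]) = mean f1 * mean f2.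
Proof.
move=> i1I i2I i12.
pose iota (j : J1 + J2) := match j with inl j1 => i1 j1 | inr j2 => i2 j2 end.
have iotaI : injective iota.
  case=> [a|a] [b|b] /= ab; [by rewrite (i1I _ _ ab)| | |by rewrite (i2I _ _ ab)].
    by have := i12 a b; rewrite ab eqxx.
  by have := i12 b a; rewrite ab eqxx.
transitivity (mean (fun h : {ffun J1 + J2 -> T} =>
    f1 [ffun j => h (inl j)] * f2 [ffun j => h (inr j)])).
  rewrite -(mean_marginal _ iotaI); apply: eq_mean => h.
  by congr (f1 _ * f2 _); apply/ffunP => j; rewrite !ffunE.
pose glue (p : {ffun J1 -> T} * {ffun J2 -> T}) : {ffun J1 + J2 -> T} :=
  [ffun j => match j with inl j1 => p.1 j1 | inr j2 => p.2 j2 end].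
pose cut (h : {ffun J1 + J2 -> T}) : {ffun J1 -> T} * {ffun J2 -> T} :=
  ([ffun j => h (inl j)], [ffun j => h (inr j)]).
rewrite /mean (reindex glue)/=; last first.
  exists cut => [[g1 g2]|h] _.
    by congr pair; apply/ffunP => j; rewrite !ffunE.
  by apply/ffunP => -[j|j]; rewrite !ffunE.
rewrite big_distrlr pair_big; apply: eq_bigr => -[g1 g2] _ /=.
have -> : [ffun j => glue (g1, g2) (inl j)] = g1 by apply/ffunP => j; rewrite !ffunE.
have -> : [ffun j => glue (g1, g2) (inr j)] = g2 by apply/ffunP => j; rewrite !ffunE.
rewrite mulrACA; congr (_ * _).
rewrite big_sumType/=.
by congr (_ * _); apply: eq_bigr => j _; rewrite ffunE.
Qed.

(** Exchanging the value at [i] with a fresh independent value preserves the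
    product weight, so [F] may be averaged with the value at [i] frozen. *)
Lemma mean_coord (I : finType) (i : I) (F : T -> {ffun I -> T} -> R) :
  (forall s (h h' : {ffun I -> T}), (forall j, j != i -> h j = h' j) -> F s h = F s h') ->
  mean (fun h => F (h i) h) = \sum_t wt t * mean (F t).
Proof.
move=> Fi; pose upd (h : {ffun I -> T}) t := [ffun j => if j == i then t else h j].
rewrite /mean; under [RHS]eq_bigr do rewrite big_distrr.
pose sw (p : T * {ffun I -> T}) := (p.2 i, upd p.2 p.1).
rewrite [RHS]pair_big/= [RHS](reindex sw)/=; last first.
  apply: onW_bij; exists sw => -[t h]; rewrite /sw/=;
    by rewrite ffunE eqxx; congr pair; apply/ffunP => j; rewrite !ffunE; case: eqP => // ->.
rewrite -[RHS](pair_big xpredT xpredT (fun t (h : {ffun I -> T}) => wt (h i) *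
  (\prod_j wt (upd h t j) * F (h i) (upd h t))))/= exchange_big/=.
apply: eq_bigr => h _; rewrite -[LHS]mul1r; case: wtP => _ <-.
rewrite big_distrl/=; apply: eq_bigr => t _; rewrite !mulrA; congr (_ * _); last first.
  by apply: Fi => j /negPf ji; rewrite ffunE ji.
rewrite (bigD1 i)//= [in RHS](bigD1 i)//= ffunE eqxx mulrCA; congr (_ * (_ * _)).
by apply: eq_bigr => j /negPf ji; rewrite ffunE ji.
Qed.

(** The sampled values are revealed one at a time, for recursion on the sample. *)
Fixpoint itavg (n : nat) (f : seq T -> R) : R :=
  if n is m.+1 then \sum_t wt t * itavg m (fun s => f (t :: s)) else f [::].

Lemma mean_itavg (I : finType) (l : seq I) (f : seq T -> R) : uniq l ->
  mean (fun h : {ffun I -> T} => f (map h l)) = itavg (size l) f.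
Proof.
elim: l f => [|i l IHl] f /=; first by rewrite mean_cst.
move=> /andP[il ul].
rewrite (mean_coord (i := i) (F := fun t (h : {ffun I -> T}) => f (t :: map h l))).
  by apply: eq_bigr => t _; rewrite -(IHl (fun s => f (t :: s))).
move=> s h h' hh'; congr (f (_ :: _)); apply/eq_in_map => j jl; apply: hh'.
by apply: contraNneq il => <-.
Qed.

End Mean.

(** Only the samples drawn inside the image of [iota] count, and each of the
    [#|I|] draws contributes a factor [c]. *)
Lemma mean_restrict (R : realType) (T T' I : finType) (wt : T -> R)
    (wt' : T' -> R) (iota : T' -> T) (c : R) (f : {ffun I -> T} -> R) :
  injective iota -> (forall t, wt (iota t) = c * wt' t) ->
  (forall (h : {ffun I -> T}) i, (forall t, h i != iota t) -> f h = 0) ->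
  mean wt f = c ^+ #|I| * mean wt' (fun g => f [ffun i => iota (g i)]).
Proof.
move=> iotaI wtE f0; rewrite /mean.
pose ext (g : {ffun I -> T'}) : {ffun I -> T} := [ffun i => iota (g i)].
rewrite (bigID (fun h => h \in ext @: predT))/= [X in _ + X]big1 ?addr0.
  rewrite big_imset/=; last first.
    move=> g g' _ _ /ffunP gg'; apply/ffunP => i; apply: iotaI.
    by have := gg' i; rewrite !ffunE.
  rewrite big_distrr/=; apply: eq_big => [g|g _]; first by [].
  rewrite mulrA; congr (_ * _); rewrite -prodr_const -big_split/=.
  by apply: eq_bigr => i _; rewrite ffunE wtE.
move=> h hn; have [i hi] : exists i, forall t, h i != iota t.
  apply/not_existsP => hex; move/negP: hn; apply.
  have hex' i : exists t, h i == iota t.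
    by have /existsNP[t /negP/negPn ht] := hex i; exists t.
  apply/imsetP; exists [ffun i => xchoose (hex' i)] => //.
  by apply/ffunP => i; rewrite !ffunE; apply/eqP; exact: (xchooseP (hex' i)).
by rewrite (f0 h i hi) mulr0.
Qed.

(** * Joined vertex sets and inclusion-exclusion *)

(** Reduces expectations of arbitrary functions of a random set to the
    probabilities that it contains a given set. *)
Lemma mobius (R : realType) (X : finType) (phi : {set X} -> R) :
  exists c : {set X} -> R, forall H, phi H = \sum_(F : {set X} | F \subset H) c F.
Proof.
suff /(_ #|X|.+1) [c cP] : forall n, exists c : {set X} -> R,
    forall H : {set X}, (#|H| < n)%N -> phi H = \sum_(F : {set X} | F \subset H) c F.
  by exists c => H; apply: cP; rewrite ltnS max_card.
elim=> [|n [c cP]]; first by exists (fun=> 0).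
exists (fun F : {set X} => if (#|F| < n)%N then c F else
  phi F - \sum_(G : {set X} | (G \subset F) && (G != F)) c G) => H.
rewrite ltnS leq_eqVlt => /predU1P[Hn|Hn]; last first.
  rewrite (cP _ Hn); apply: eq_bigr => F FH.
  by rewrite (leq_ltn_trans (subset_leq_card FH) Hn).
rewrite (bigD1 H)//= Hn ltnn [X in _ = _ + X](eq_bigr c) ?subrK// => F /andP[FH FneH].
by rewrite -Hn proper_card// finset.properEneq FneH.
Qed.

Section Pattern.
Context (I : finType).
Implicit Types (F G H : {set I * I}) (K : {set I}).

(** [F] is a set of ordered pairs that are read as undirected edges; sampled
    patterns are then plain sets. *)
Definition linked F : rel I :=
  connect [rel x y | ((x, y) \in F) || ((y, x) \in F)].

Definition joins K F : bool := [forall x in K, forall y in K, linked F x y].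

(** Only these sets survive the inclusion-exclusion for [joins K]. *)
Definition spans K F : bool :=
  joins K F && [forall p in F, forall k in K, linked F k p.1].

Lemma linked_sym F x y : linked F x y = linked F y x.
Proof. by apply: sym_connect_sym => a b /=; rewrite orbC. Qed.

Lemma linked_sub F G x y : F \subset G -> linked F x y -> linked G x y.
Proof.
move=> /fintype.subsetP FG; apply: connect_sub => a b /= ab; apply: connect1 => /=.
by case/orP: ab => /FG ->; rewrite ?orbT.
Qed.

Lemma joinsP K F : reflect {in K &, forall x y, linked F x y} (joins K F).
Proof.
apply: (iffP 'forall_in_forall_inP) => h x y; first by move=> xK; apply: h.
by move=> yK; apply: h.
Qed.

Lemma joins_sub K F G : F \subset G -> joins K F -> joins K G.
Proof.
move=> FG /joinsP KF; apply/joinsP => x y xK yK.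
by apply: linked_sub FG _; apply: KF.
Qed.

Lemma spansP K F : reflect (joins K F /\
  forall p k, p \in F -> k \in K -> linked F k p.1) (spans K F).
Proof.
apply: (iffP andP) => -[KF h]; split=> //.
  by move=> p k pF; move/'forall_in_forall_inP: h; apply.
by apply/'forall_in_forall_inP => p pF k kK; apply: h.
Qed.

(** Edges outside the component of [K] do not influence whether [K] is joined,
    so their inclusion-exclusion coefficients cancel. *)
Lemma joins_mobius (R : realType) K : (0 < #|K|)%N ->
  exists c : {set I * I} -> R, forall H,
    (joins K H)%:R = \sum_(F : {set I * I} | (F \subset H) && spans K F) c F.
Proof.
move=> /card_gt0P[k0 k0K].
have [c cP] := mobius (fun H => (joins K H)%:R : R).
suff c0 F : ~~ spans K F -> c F = 0.
  exists c => H; rewrite cP [LHS](bigID (spans K))/= [X in _ + X]big1 ?addr0//.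
  by move=> F /andP[_ /c0].
have [n] := ubnP #|F|; elim: n F => // n IHn F; rewrite ltnS => Fn nF.
have IH G : G \proper F -> ~~ spans K G -> c G = 0.
  by move=> GF; apply: IHn; apply: leq_trans (proper_card GF) Fn.
have cF : c F = (joins K F)%:R -
    \sum_(G : {set I * I} | (G \proper F) && spans K G) c G.
  rewrite (cP F) (bigD1 F)//= (bigID (spans K))/= [X in _ + (_ + X)]big1 ?addr0.
    rewrite (eq_bigl (fun G : {set I * I} => (G \proper F) && spans K G)) ?addrK//.
    by move=> G; rewrite finset.properEneq (andbC (G != F)).
  by move=> G /andP[/andP[GF GneF] nG]; rewrite IH// finset.properEneq GneF.
rewrite cF; have [KF|nKF] := boolP (joins K F); last first.
  rewrite big1 ?subr0// => G /andP[/proper_sub GF /spansP[KG _]].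
  by rewrite (joins_sub GF KG) in nKF.
(* The component [F1] of [K] in [F] contains the same spanning sets. *)
pose F1 := [set p in F | linked F k0 p.1].
have F1F : F1 \subset F by apply/fintype.subsetP => p; rewrite inE => /andP[].
have link1 x : linked F k0 x -> linked F1 k0 x.
  case/connectP => s; elim/last_ind: s x => [|s y IHs] x.
    by move=> _ ->; apply: connect0.
  rewrite rcons_path last_rcons => /andP[ps /= sy] ->.
  have ls : linked F k0 (last k0 s) by apply/connectP; exists s.
  have ly : linked F k0 y by apply: connect_trans ls (connect1 _).
  apply: connect_trans (IHs _ ps erefl) (connect1 _) => /=.
  by rewrite !inE /=; case/orP: sy => ->; rewrite ?ls ?ly ?orbT.
have KF1 : joins K F1.
  apply/joinsP => x y xK yK; move/joinsP: KF => KF.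
  apply: (connect_trans (y := k0)); last by apply: link1; apply: KF.
  by rewrite -/(linked F1 x k0) linked_sym; apply: link1; apply: KF.
have F1n : F1 \proper F.
  rewrite properE F1F /=; apply: contra nF => /fintype.subsetP FF1.
  apply/spansP; split=> // p k /FF1; rewrite inE => /andP[_ kp] kK.
  by apply: connect_trans kp; move/joinsP: KF; apply.
have := cP F1; rewrite KF1 => ->; apply/eqP; rewrite subr_eq0; apply/eqP.
rewrite (bigID (spans K))/= [X in _ + X]big1 ?addr0; last first.
  by move=> G /andP[GF1 nG]; apply: IH => //; apply: sub_proper_trans GF1 F1n.
apply: eq_bigl => G; have [sG|] := boolP (spans K G); last by rewrite !andbF.
rewrite !andbT; apply/idP/idP => [GF1|/proper_sub/fintype.subsetP GF].
  exact: sub_proper_trans GF1 F1n.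
apply/fintype.subsetP => p pG; rewrite inE GF//=.
case/spansP: sG => _ /(_ p k0 pG k0K); apply: linked_sub.
exact/fintype.subsetP.
Qed.

End Pattern.

(** * Densities of patterns in graphs and graph limits *)

Lemma sum_option (R : realType) (T : finType) (f : option T -> R) :
  \sum_t f t = f None + \sum_t f (Some t).
Proof.
rewrite (bigD1 None)//= (reindex_omap Some id) => [|[t|]//].
by congr (_ + _); apply: eq_bigl => t; rewrite eqxx.
Qed.

Lemma cvg_rsum (R : realType) (T : Type) (F : set_system T) (FF : Filter F)
    (I : Type) (r : seq I) (Q : pred I) (f : I -> T -> R) (l : I -> R) :
  (forall i, Q i -> f i t @[t --> F] --> l i) ->
  \sum_(i <- r | Q i) f i t @[t --> F] --> \sum_(i <- r | Q i) l i.
Proof.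
move=> fl; elim: r => [|i r IHr].
  by under eq_fun do rewrite big_nil; rewrite big_nil; exact: cvg_cst.
under eq_fun do rewrite big_cons; rewrite big_cons.
by case: ifP => // Qi; apply: cvgD => //; apply: fl.
Qed.

Section Sampling.
Context (R : realType).

Definition pat (T I : finType) (e : rel T) (h : {ffun I -> T}) : {set I * I} :=
  [set p | e (h p.1) (h p.2)].

Definition pat_density (T I : finType) (wt : T -> R) (e : rel T) (F : {set I * I}) : R :=
  mean wt (fun h : {ffun I -> T} => (F \subset pat e h)%:R).

Lemma patP (T I : finType) (e : rel T) (h : {ffun I -> T}) (F : {set I * I}) :
  reflect (forall p, p \in F -> e (h p.1) (h p.2)) (F \subset pat e h).
Proof.
by apply: (iffP fintype.subsetP) => sF p /sF; rewrite inE.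
Qed.

Lemma mean_pat_sum (T I : finType) (wt : T -> R) (e : rel T) (Q : pred {set I * I})
    (c phi : {set I * I} -> R) :
  (forall H, phi H = \sum_(F : {set I * I} | (F \subset H) && Q F) c F) ->
  mean wt (fun h => phi (pat e h)) =
  \sum_(F : {set I * I} | Q F) c F * pat_density wt e F.
Proof.
move=> phiE; under eq_mean do rewrite phiE.
under eq_mean do rewrite (eq_bigl _ _ (fun F => andbC _ _)) big_mkcondr/=.
rewrite mean_sum; apply: eq_bigr => F _; rewrite -meanZ; apply: eq_mean => h.
by case: ifP => _; rewrite ?mulr1 ?mulr0.
Qed.

Definition unif (G : sgraph) (_ : 'I_(nverts G)) : R := (nverts G)%:R^-1.

Lemma unif_prob_weight G : prob_weight (@unif G).
Proof.
split=> [t|]; first by rewrite invr_ge0.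
rewrite sumr_const card_ord -[_ *+ _]mulr_natr mulVf//.
by rewrite pnatr_eq0 -lt0n nverts_gt0.
Qed.

Lemma mean_unif G (I : finType) (f : {ffun I -> 'I_(nverts G)} -> R) :
  mean (@unif G) f = (\sum_h f h) / (nverts G)%:R ^+ #|I|.
Proof.
rewrite mulrC big_distrr; apply: eq_bigr => h _.
by rewrite prodr_const -exprVn.
Qed.

Lemma hom_densityE F G : hom_density R F G =
  mean (@unif G) (fun h => (is_hom (F := F) h)%:R).
Proof.
rewrite mean_unif /hom_density card_ffun !card_ord natrX; congr (_ / _).
by rewrite -sum1_card natr_sum big_mkcond; apply: eq_bigr => h _; rewrite -[h \in _]/(is_hom h); case: (is_hom h).
Qed.

Section SgraphOf.
Context (J : finType) (J0 : (0 < #|J|)%N) (F : {set J * J}).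

Definition sgraph_edge : rel 'I_#|J| := fun i j =>
  (i != j) && (((enum_val i, enum_val j) \in F) || ((enum_val j, enum_val i) \in F)).

Lemma sgraph_edge_sym : symmetric sgraph_edge.
Proof. by move=> i j; rewrite /sgraph_edge eq_sym orbC. Qed.

Lemma sgraph_edge_irr : irreflexive sgraph_edge.
Proof. by move=> i; rewrite /sgraph_edge eqxx. Qed.

Definition sgraph_of := SGraph J0 sgraph_edge_sym sgraph_edge_irr.

Definition loopless := [forall x, (x, x) \notin F].

Lemma sgraph_ofE G : loopless ->
  hom_density R sgraph_of G = pat_density (@unif G) (@edge G) F.
Proof.
move=> /forallP Fl; rewrite hom_densityE /pat_density.
rewrite -(mean_marginal (unif_prob_weight G) _ (@enum_val_inj _ J))/=.
apply: eq_mean => h; congr (_%:R); congr nat_of_bool.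
rewrite /is_hom; apply/'forall_forallP/patP => /= [hom p pF|hF x y].
  have /implyP := hom (enum_rank p.1) (enum_rank p.2); rewrite !ffunE /=.
  rewrite /sgraph_edge !enum_rankK; apply.
  rewrite -surjective_pairing pF andbT; apply: contraTneq pF.
  by move=> /enum_rank_inj p12; case: p p12 => a b /= ->; apply: Fl.
apply/implyP => /andP[_ /orP[]] /hF; rewrite !ffunE//= => H.
by rewrite edge_sym.
Qed.

Lemma loop_pat_density (T : finType) (wt : T -> R) (e : rel T) : irreflexive e -> ~~ loopless ->
  pat_density wt e F = 0.
Proof.
move=> eirr /forallPn[x]; rewrite negbK => xF.
rewrite /pat_density /mean big1// => h _; suff /negPf -> : ~~ (F \subset pat e h) by rewrite mulr0.
by apply/negP => /patP/(_ _ xF); rewrite eirr.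
Qed.

(** A loop never occurs in a sample of an irreflexive relation, hence the value
    [0]. *)
Definition lim_pat_density (Gamma : graph_limit R) : R :=
  if loopless then lim_density Gamma sgraph_of else 0.

Lemma cvg_pat_density (Gamma : graph_limit R) (Gn : nat -> sgraph) :
  (forall F, hom_density R F (Gn n) @[n --> \oo] --> lim_density Gamma F) ->
  pat_density (@unif (Gn n)) (@edge (Gn n)) F @[n --> \oo] --> lim_pat_density Gamma.
Proof.
move=> GnP; rewrite /lim_pat_density; case: ifPn => Fl.
  by under eq_fun do rewrite -sgraph_ofE//; apply: GnP.
under eq_fun do rewrite (loop_pat_density _ (@edge_irr _) Fl).
exact: cvg_cst.
Qed.

End SgraphOf.

Lemma cvg_mean_pat (I : finType) (I0 : (0 < #|I|)%N) (Gamma : graph_limit R)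
    (Gn : nat -> sgraph) (Q : pred {set I * I}) (c phi : {set I * I} -> R) :
  (forall F, hom_density R F (Gn n) @[n --> \oo] --> lim_density Gamma F) ->
  (forall H, phi H = \sum_(F : {set I * I} | (F \subset H) && Q F) c F) ->
  mean (@unif (Gn n)) (fun h => phi (pat (@edge (Gn n)) h)) @[n --> \oo] -->
  \sum_(F : {set I * I} | Q F) c F * lim_pat_density I0 F Gamma.
Proof.
move=> GnP phiE; under eq_fun do rewrite (mean_pat_sum _ _ phiE).
by apply: cvg_rsum => F _; apply: cvgMl_tmp; exact: cvg_pat_density.
Qed.

Section Thinning.
Context (T : finType) (a : R) (wt : T -> R) (e : rel T).

(** With probability [1 - a] the sampled vertex is an isolated dummy. This
    models [a] times a graph limit, padded by the trivial limit. *)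
Definition thin_wt (t : option T) : R := if t is Some u then a * wt u else 1 - a.

Definition thin_edge : rel (option T) := fun t u =>
  match t, u with Some x, Some y => e x y | _, _ => false end.

Lemma thin_prob_weight : 0 <= a <= 1 -> prob_weight wt -> prob_weight thin_wt.
Proof.
move=> /andP[a0 a1] [w0 w1]; split=> [[t|]|] /=.
- by rewrite mulr_ge0.
- by rewrite subr_ge0.
- by rewrite sum_option /= -big_distrr/= w1 mulr1 subrK.
Qed.

End Thinning.

Section Support.
Context (I : finType) (K : {set I}) (F : {set I * I}) (k0 : I).
Hypotheses (k0K : k0 \in K) (K1 : (1 < #|K|)%N) (FK : spans K F).

(** On the vertices that [F] connects to [K] the pattern becomes a connected
    graph, to which the formula defining direct sums applies. *)
Definition supp := {x : I | linked F k0 x}.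
Definition supp_edges : {set supp * supp} := [set p | (val p.1, val p.2) \in F].

Lemma supp_gt0 : (0 < #|{: supp}|)%N.
Proof. by apply/card_gt0P; exists (exist _ k0 (connect0 _ k0)). Qed.

Let link_of p : p \in F -> linked F k0 p.1 /\ linked F k0 p.2.
Proof.
move=> pF; have [_ /(_ _ _ pF k0K) l1] := spansP _ _ FK; split=> //.
by apply: connect_trans l1 (connect1 _) => /=; rewrite -surjective_pairing pF.
Qed.

Lemma pat_density_supp (T : finType) (wt : T -> R) (e : rel T) : prob_weight wt ->
  pat_density wt e F = pat_density wt e supp_edges.
Proof.
move=> wtP; rewrite /pat_density -(mean_marginal wtP _ (@val_inj _ _ supp)).
apply: eq_mean => h; congr (_%:R); congr nat_of_bool.
apply/patP/patP => /= hF p.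
  by rewrite inE => /hF; rewrite !ffunE.
move=> pF; have [l1 l2] := link_of pF.
have := hF (exist _ p.1 l1, exist _ p.2 l2); rewrite !inE !ffunE /=.
by rewrite -surjective_pairing; apply.
Qed.

Lemma linked_supp (x y : supp) : linked supp_edges x y.
Proof.
suff h (z : supp) : linked supp_edges (exist _ k0 (connect0 _ k0)) z.
  by apply: connect_trans (h y); rewrite -/(linked _ _ _) linked_sym.
case: z => z lz; case/connectP: (lz) => s; elim/last_ind: s z lz => [|s u IHs] z lz.
  move=> _ zk.
  have -> := @val_inj _ _ supp (exist _ z lz) (exist _ k0 (connect0 _ k0)) zk.
  exact: connect0.
rewrite rcons_path last_rcons => /andP[ps /= su] zE.
have ls : linked F k0 (last k0 s) by apply/connectP; exists s.
by apply: connect_trans (IHs _ ls ps erefl) (connect1 _); rewrite /= !inE /= zE.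
Qed.

(** The second element of [K] forces an edge at every vertex of the support. *)
Lemma supp_nbr (x : supp) : exists2 y, y != x &
  ((x, y) \in supp_edges) || ((y, x) \in supp_edges).
Proof.
have [k kK kx] : exists2 k, k \in K & k != val x.
  apply/exists_inP; apply: contraLR K1; rewrite negb_exists_in => /forall_inP Kx.
  rewrite -leqNgt -(cards1 (val x)) subset_leq_card//.
  by apply/fintype.subsetP => y /Kx; rewrite negbK inE.
have lk : linked F k0 k by move/spansP: FK => [/joinsP KF _]; apply: KF.
have /connectP[s] := linked_supp x (exist _ k lk).
elim: s => [_ kE|y s IHs] /=; first by case/negP: kx; rewrite -(congr1 val kE).
have [->|yx] := eqVneq y x; first by move=> /andP[_]; apply: IHs.
by move=> /andP[xy _] _; exists y.
Qed.

(** In the thinned graph all the vertices of [F], none of which is isolated,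
    must be genuine. *)
Lemma pat_density_thin (T : finType) (a : R) (wt : T -> R) (e : rel T) :
  0 <= a <= 1 -> prob_weight wt ->
  pat_density (thin_wt a wt) (thin_edge e) F = a ^+ #|{: supp}| * pat_density wt e supp_edges.
Proof.
move=> a01 wtP; rewrite pat_density_supp; last exact: thin_prob_weight.
rewrite /pat_density (mean_restrict (wt' := wt) (iota := Some) (c := a))//.
  congr (_ * _); apply: eq_mean => h; congr (_%:R); congr nat_of_bool.
  by apply/patP/patP => hF p /hF; rewrite !ffunE.
move=> h i hi; suff /negPf -> : ~~ (supp_edges \subset pat (thin_edge e) h) by [].
have [y _ xy] := supp_nbr i; apply/negP => /patP hF.
by case/orP: xy => /hF /=; case: (h i) (hi) => [t /(_ t)|_]; rewrite ?eqxx//; case: (h y).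
Qed.

Lemma supp_connected : connected_graph (sgraph_of supp_gt0 supp_edges).
Proof.
move=> x y; have := linked_supp (enum_val x) (enum_val y).
move=> /connectP[s]; elim: s x => [|z s IHs] x /=.
  by move=> _ /enum_val_inj ->; apply: connect0.
move=> /andP[xz zs] yE; apply: (connect_trans (y := enum_rank z)); last first.
  by apply: IHs; rewrite enum_rankK.
have [->|xnz] := eqVneq x (enum_rank z); first exact: connect0.
by apply: connect1; rewrite /= /sgraph_edge xnz enum_rankK.
Qed.

Lemma supp_has_edge : has_edge (sgraph_of supp_gt0 supp_edges).
Proof.
have [y yx xy] := supp_nbr (exist _ k0 (connect0 _ k0)).
exists (enum_rank (exist _ k0 (connect0 _ k0))), (enum_rank y).
by rewrite /= /sgraph_edge !enum_rankK xy andbT (inj_eq enum_rank_inj) eq_sym.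
Qed.

End Support.
End Sampling.

(** * Exploration of an expanding graph *)

Section Reach.
Context (R : realType) (T : finType) (wt : T -> R) (e : rel T).
Hypothesis wtP : prob_weight wt.

Definition vol (A : {set T}) : R := \sum_(t in A) wt t.

Definition cut_weight (A : {set T}) : R :=
  \sum_(u in A) wt u * \sum_(v | (v \notin A) && e u v) wt v.

(** Edge expansion of all sets except those of volume below [kappa] and their
    complements, which convergence of densities does not control. *)
Definition expands (kappa eta : R) := forall A : {set T},
  kappa <= vol A -> kappa <= vol (~: A) -> eta <= cut_weight A.

Lemma vol_ge0 A : 0 <= vol A.
Proof. by apply: sumr_ge0 => t _; case: wtP. Qed.

Lemma vol_sub (A B : {set T}) : A \subset B -> vol A <= vol B.
Proof.
move=> /fintype.subsetP AB; rewrite /vol big_mkcond [leRHS]big_mkcond.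
apply: ler_sum => t _; have := AB t; case: (t \in A) => [->//|_].
by case: ifP => // _; case: wtP.
Qed.

Lemma volC A : vol (~: A) = 1 - vol A.
Proof.
case: wtP => _ <-; rewrite [in RHS](bigID (mem A))/= addrAC subrr add0r.
by apply: eq_bigl => t; rewrite inE.
Qed.

Definition nbhd (S : {set T}) : {set T} := [set v | [exists u in S, e u v]].

Definition grow (S : {set T}) (t : option T) : {set T} :=
  if t is Some v then if v \in nbhd S then v |: S else S else S.

(** An exploration that starts from the explored set [S] and is fed with the
    samples in [l]: a sample next to an explored vertex becomes explored. The
    last sample is the target, which is missed if it is a genuine vertex without
    explored neighbour. *)
Fixpoint missed (S : {set T}) (l : seq (option T)) : bool :=
  if l is t :: l' then
    if l' is [::] then (if t is Some w then w \notin nbhd S else false)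
    else missed (grow S t) l'
  else false.

Lemma nbhd_sub (S S' : {set T}) : S \subset S' -> nbhd S \subset nbhd S'.
Proof.
move=> /fintype.subsetP SS'; apply/fintype.subsetP => v; rewrite !inE.
by move=> /exists_inP[u /SS' uS' uv]; apply/exists_inP; exists u.
Qed.

Lemma sub_grow (S : {set T}) t : S \subset grow S t.
Proof.
by case: t => [v|] //=; case: ifP => // _; rewrite finset.subsetU1.
Qed.

Let y (S : {set T}) := vol (~: nbhd S).

Lemma y_grow (S : {set T}) t : y (grow S t) <= y S.
Proof. by apply: vol_sub; rewrite finset.setCS; apply: nbhd_sub; apply: sub_grow. Qed.

Lemma y_grow_nbr (S : {set T}) v : v \in nbhd S ->
  y (grow S (Some v)) <= y S - \sum_(w | (w \notin nbhd S) && e v w) wt w.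
Proof.
move=> vS; rewrite lerBrDr /y /vol /= vS big_mkcond [X in _ + X]big_mkcond -big_split.
rewrite [leRHS]big_mkcond; apply: ler_sum => w _ /=; rewrite !finset.in_setC.
have [wS|wS] := boolP (w \in nbhd S) => /=.
  rewrite (fintype.subsetP (nbhd_sub (finset.subsetU1 v S)) _ wS).
  by rewrite addr0.
have [vw|_] := boolP (e v w); last by rewrite addr0; case: ifP => // _; case: wtP.
suff -> : w \in nbhd (v |: S) by rewrite add0r.
by rewrite inE; apply/exists_inP; exists v => //; rewrite !inE eqxx.
Qed.

Context (a kappa eta : R).
Hypotheses (a01 : 0 <= a <= 1) (kappa0 : 0 <= kappa) (eta01 : 0 <= eta <= 1).
Hypothesis exp_ke : expands kappa eta.

Let tw := thin_wt a wt.
Let twP : prob_weight tw. Proof. exact: thin_prob_weight. Qed.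
Let miss s (S : {set T}) := itavg tw s.+1 (fun l => (missed S l)%:R).

Let missS s (S : {set T}) : miss s.+1 S = \sum_t tw t * miss s (grow S t).
Proof. by []. Qed.

Lemma miss_le s (S : {set T}) : miss s S <= y S.
Proof.
elim: s S => [|s IHs] S.
  rewrite /miss /= sum_option /= mulr0 add0r /y /vol.
  rewrite [leRHS]big_mkcond; apply: ler_sum => t _; rewrite finset.in_setC.
  case: (t \in nbhd S); rewrite /= ?mulr0// mulr1; case/andP: a01 => a0 a1.
  by case: wtP => w0 _; rewrite -[leRHS]mul1r ler_wpM2r.
rewrite missS -[leRHS]mul1r; case: (twP) => tw0 <-; rewrite big_distrl/=.
apply: ler_sum => t _; apply: ler_wpM2l => //.
by apply: le_trans (IHs _) (y_grow _ _).
Qed.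

(** By expansion, the neighbourhood of the explored set has edges of mass [eta]
    to the outside. A fresh sample follows them in proportion, so on average the
    unreached volume shrinks by the factor [1 - a * eta] until it is below
    [kappa]. *)
Lemma miss_geometric s (S : {set T}) : kappa <= vol (nbhd S) ->
  miss s S <= kappa + (1 - a * eta) ^+ s * y S.
Proof.
case/andP: (a01) => a0 a1; case/andP: (eta01) => e0 e1.
have ae : 0 <= 1 - a * eta by rewrite subr_ge0 mulr_ile1.
have y0 (S' : {set T}) : 0 <= y S' by apply: vol_ge0.
elim: s S => [|s IHs] S kS.
  by rewrite expr0 mul1r; apply: le_trans (miss_le _ _) _; rewrite lerDr.
have [yk|ky] := leP (y S) kappa.
  apply: le_trans (miss_le _ _) _; apply: le_trans yk _.
  by rewrite lerDl mulr_ge0 ?exprn_ge0.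
have yS : \sum_v wt v * y (grow S (Some v)) <= y S - eta * y S.
  have cut : eta <= cut_weight (nbhd S) by apply: exp_ke => //; apply: ltW.
  have ycut : \sum_v wt v * y (grow S (Some v)) <= y S - cut_weight (nbhd S).
    rewrite -[X in X - _]mul1r; case: (wtP) => w0 <-.
    rewrite big_distrl/= lerBrDr /cut_weight [X in _ + X]big_mkcond -big_split/=.
    apply: ler_sum => v _; case: ifPn => vS; last by rewrite addr0.
    by rewrite -mulrDr ler_wpM2l// -lerBrDr; have := y_grow_nbr vS; rewrite /= vS.
  apply: le_trans ycut _; rewrite lerD2l lerN2; apply: le_trans cut.
  rewrite -[leRHS]mulr1 ler_wpM2l// /y volC lerBlDl lerDr; exact: vol_ge0.
rewrite missS; have -> : kappa + (1 - a * eta) ^+ s.+1 * y S =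
    kappa + (1 - a * eta) ^+ s * ((1 - a) * y S + a * (y S - eta * y S)).
  by rewrite exprS; ring.
apply: (@le_trans _ _ (\sum_t tw t * (kappa + (1 - a * eta) ^+ s * y (grow S t)))).
  apply: ler_sum => t _; apply: ler_wpM2l; first by case: (twP).
  apply: IHs; apply: le_trans kS _; apply: vol_sub; apply: nbhd_sub.
  exact: sub_grow.
under eq_bigr do rewrite mulrDr (mulrCA _ (_ ^+ s)).
rewrite big_split/= -big_distrl/= -big_distrr/=; case: (twP) => _ ->.
rewrite mul1r lerD2l ler_wpM2l ?exprn_ge0// sum_option /= lerD2l.
under eq_bigr do rewrite -mulrA.
by rewrite -big_distrr/= ler_wpM2l.
Qed.

Definition degree v : R := \sum_(u | e v u) wt u.

Section Pair.
Context (I : finType).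

(** Explored vertices are sampled and linked to [x], so a target next to one of
    them is linked to [x] too. *)
Lemma not_missed (h : {ffun I -> option T}) (x z : I) (l : seq I) (S : {set T}) w :
  (forall u, u \in S -> exists2 i, h i = Some u & linked (pat (thin_edge e) h) x i) ->
  ~~ missed S (map h (rcons l z)) -> h z = Some w ->
  linked (pat (thin_edge e) h) x z.
Proof.
move=> + + hz.
have step (S' : {set T}) i v : (forall u, u \in S' ->
      exists2 i, h i = Some u & linked (pat (thin_edge e) h) x i) ->
    h i = Some v -> v \in nbhd S' -> linked (pat (thin_edge e) h) x i.
  move=> S'P hi; rewrite inE => /exists_inP[u /S'P[j hj xj] uv].
  by apply: connect_trans xj (connect1 _); rewrite /= !inE /= hi hj /= uv.
elim: l S => [|i l IHl] S SP.
  by rewrite /= hz negbK => zS; apply: (step S _ w).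
have -> : missed S (map h (rcons (i :: l) z)) = missed (grow S (h i)) (map h (rcons l z)).
  by case: l {IHl}.
apply: IHl => u; case hi: (h i) => [v|] /=; last exact: SP.
case: ifP => [vS|_]; last exact: SP.
rewrite !inE => /predU1P[->|]; last exact: SP.
by exists i => //; apply: (step S _ v).
Qed.

Definition split_pair (x z : I) (h : {ffun I -> option T}) : bool :=
  [&& isSome (h x), isSome (h z) & ~~ linked (pat (thin_edge e) h) x z].

(** The three error terms: [x] may have too few neighbours for the exploration
    to start, the exploration stalls at unreached volume [kappa], and it has only
    [s] steps. *)
Lemma mean_split_pair (x z : I) s : x != z -> #|I| = s.+2 ->
  mean tw (fun h => (split_pair x z h)%:R) <=
  vol [set v | degree v < kappa] + kappa + (1 - a * eta) ^+ s.
Proof.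
move=> xz cI; case/andP: (a01) => a0 a1; case/andP: (eta01) => e0 e1.
pose l := enum [predC [:: x; z]].
have sl : size l = s.
  rewrite /l -cardE; have := cardC (mem [:: x; z]); rewrite cI.
  by rewrite (card_uniqP _) /= ?inE ?xz// add2n => -[].
have ul : uniq (x :: rcons l z).
  rewrite /= rcons_uniq mem_rcons inE (negPf xz) !mem_enum !inE !eqxx /= orbT enum_uniq.
  by [].
pose f (q : seq (option T)) : R :=
  if q is Some v :: q' then (missed [set v]%SET q')%:R else 0.
have fle : mean tw (fun h => (split_pair x z h)%:R) <=
    mean tw (fun h : {ffun I -> option T} => f (map h (x :: rcons l z))).
  apply: le_mean => // h; rewrite /f /split_pair /=.
  case hx: (h x) => [v|] //=; case hz: (h z) => [w|] //=.
  case: (boolP (missed _ _)) => [_|nm]; first by case: (linked _ _ _).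
  rewrite (not_missed _ nm hz)// => u; rewrite inE => /eqP ->.
  by exists x => //; apply: connect0.
apply: le_trans fle _; rewrite (mean_itavg twP)//= size_rcons sl sum_option.
have -> : itavg tw s.+1 (fun q => f (None :: q)) = 0.
    have -> : s.+1 = size (rcons l z) by rewrite size_rcons sl.
  by rewrite -(mean_itavg twP) ?mean_cst//; case/andP: ul.
rewrite mulr0 add0r.
have -> : vol [set v | degree v < kappa] + kappa + (1 - a * eta) ^+ s =
    \sum_v wt v * ((degree v < kappa)%R%:R + kappa + (1 - a * eta) ^+ s).
  under eq_bigr do rewrite -addrA mulrDr.
  rewrite big_split/= -big_distrl/=; case: (wtP) => _ ->; rewrite mul1r addrA.
  congr (_ + _ + _); rewrite /vol big_mkcond; apply: eq_bigr => v _.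
  by rewrite inE; case: ifP => _; rewrite ?mulr1 ?mulr0.
apply: ler_sum => v _; rewrite -mulrA.
have I0 : 0 <= miss s [set v]%SET.
  have sz : s.+1 = size (rcons l z) by rewrite size_rcons sl.
  by rewrite /miss sz -(mean_itavg twP) ?mean_ge0//; case/andP: ul.
apply: (@le_trans _ _ (wt v * miss s [set v]%SET)).
  by rewrite -[leRHS]mul1r ler_wpM2r// mulr_ge0//; case: wtP.
apply: ler_wpM2l; first by case: wtP.
have nv : nbhd [set v]%SET = [set u | e v u]%SET.
  apply/setP => u; rewrite !inE; apply/exists_inP/idP => [[w]|vu].
    by rewrite inE => /eqP ->.
  by exists v; rewrite ?inE.
have dv : vol (nbhd [set v]%SET) = degree v.
  by rewrite nv; apply: eq_bigl => u; rewrite inE.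
have yle1 : y [set v]%SET <= 1 by rewrite /y volC lerBlDl lerDr vol_ge0.
have ae : 0 <= 1 - a * eta by rewrite subr_ge0 mulr_ile1.
have [kv|kv] := ltP (degree v) kappa.
  apply: le_trans (miss_le _ _) _; apply: le_trans yle1 _.
  by rewrite -addrA lerDl addr_ge0 ?exprn_ge0.
rewrite add0r; apply: le_trans (miss_geometric _ _) _; first by rewrite dv.
by rewrite lerD2l -[leRHS]mulr1 ler_wpM2l ?exprn_ge0.
Qed.

Lemma mean_some (K : {set I}) :
  mean tw (fun h : {ffun I -> option T} => [forall k in K, isSome (h k)]%:R) = a ^+ #|K|.
Proof.
pose D k := [pred t : option T | (k \in K) ==> isSome t].
rewrite (eq_mean tw (g := fun h : {ffun I -> option T} => (h \in family D)%:R)); last first.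
  by [].
rewrite mean_family//= -prodr_const [RHS]big_mkcond; apply: eq_bigr => k _ /=.
case: ifP => _ /=; last by case: twP.
rewrite big_mkcond sum_option /= add0r -big_distrr/=.
by case: wtP => _ ->; rewrite mulr1.
Qed.

(** Dummies are isolated, so at least two vertices are joined only if all of
    them are genuine. *)
Lemma mean_joins_le (K : {set I}) : (1 < #|K|)%N ->
  mean tw (fun h => (joins K (pat (thin_edge e) h))%:R) <= a ^+ #|K|.
Proof.
move=> K1; rewrite -mean_some; apply: le_mean => // h.
case: (boolP (joins _ _)) => // /joinsP Kh.
suff -> : [forall k in K, isSome (h k)] by [].
apply/forall_inP => k kK.
have [k' k'K kk'] : exists2 k', k' \in K & k' != k.
  apply/exists_inP; apply: contraLR K1; rewrite negb_exists_in => /forall_inP Kx.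
  rewrite -leqNgt -(cards1 k) subset_leq_card//.
  by apply/fintype.subsetP => j /Kx; rewrite negbK inE.
have /connectP[[|j s] /=] := Kh _ _ kK k'K; first by move=> _ kE; rewrite kE eqxx in kk'.
by move=> /andP[/orP[]]; rewrite !inE /=; case: (h k) => //; case: (h j).
Qed.

(** If all of [K] is genuine but not joined, a fixed element of [K] is split
    from another one. *)
Lemma mean_joins_ge (K : {set I}) s : (0 < #|K|)%N -> #|I| = s.+2 ->
  a ^+ #|K| - #|K|%:R *
    (vol [set v | degree v < kappa] + kappa + (1 - a * eta) ^+ s) <=
  mean tw (fun h => (joins K (pat (thin_edge e) h))%:R).
Proof.
move=> /card_gt0P[k0 k0K] cI; rewrite -mean_some lerBlDr.
apply: (@le_trans _ _ (mean tw (fun h => (joins K (pat (thin_edge e) h))%:R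
    + \sum_(k in K | k0 != k) (split_pair k0 k h)%:R))).
  apply: le_mean => // h; case: (boolP [forall k in K, _]) => [/forall_inP Ks|_]; last first.
    by rewrite addr_ge0 ?sumr_ge0.
  have [KJ|nK] := boolP (joins _ _); first by rewrite lerDl sumr_ge0.
  rewrite add0r; have [k kK nk] : exists2 k, k \in K & ~~ linked (pat (thin_edge e) h) k0 k.
    apply/exists_inP; apply: contraR nK; rewrite negb_exists_in => /forall_inP Kx.
    apply/joinsP => x z xK zK; have := Kx _ xK; have := Kx _ zK; rewrite !negbK => kz kx.
    by apply: connect_trans kz; rewrite -/(linked _ _ _) linked_sym.
  have kk : k0 != k by apply: contraNneq nk => <-; apply: connect0.
  rewrite (bigD1 k) ?kK//= /split_pair !Ks// nk /= lerDl sumr_ge0//.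
rewrite meanD lerD2l mean_sum big_mkcondr/= mulr_natl -sumr_const.
apply: ler_sum => k kK; case: ifP => [kk|_]; first exact: mean_split_pair.
case/andP: (a01) => a0 a1; case/andP: (eta01) => e0 e1.
by rewrite !addr_ge0 ?vol_ge0 ?exprn_ge0// subr_ge0 mulr_ile1.
Qed.

End Pair.
End Reach.

(** * Ultralimits of graphs and sparse cuts *)

Section Ultralimit.
Context (R : realType) (U : set_system nat).
Hypotheses (UU : UltraFilter U) (oU : \oo `<=` U).

Lemma ultralimit (a b : R) (u : nat -> R) : (forall n, a <= u n <= b) ->
  exists l : R, u n @[n --> U] --> l.
Proof.
move=> uab; have UF : ProperFilter U := ultra_proper.
have [] := @segment_compact R a b (u @ U) _.
  by apply: (@filterE _ U) => n; rewrite /= in_itv /=; exact: uab.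
move=> l [_ cl]; exists l => B Bl.
have [//|UnB] := in_ultra_setVsetC (u @^-1` B) UU.
by have [x [nBx Bx]] := cl (~` B) B UnB Bl.
Qed.

Lemma ultra_frequently (B : set nat) N : U B -> exists2 n, (N <= n)%N & B n.
Proof.
move=> UB; have UF : ProperFilter U := ultra_proper.
have /filter_ex[n [Bn Nn]] : U (B `&` [set n | (N <= n)%N]).
  by apply: filterI => //; apply: oU; exists N.
by exists n.
Qed.

Definition sgraph_code (F : sgraph) : {n : nat & {ffun 'I_n * 'I_n -> bool}} :=
  Tagged (fun n => {ffun 'I_n * 'I_n -> bool}) [ffun p => @edge F p.1 p.2].

Lemma sgraph_code_inj : injective sgraph_code.
Proof.
case=> n e n0 es ei [m f m0 fs fi] /= c.
have nm := congr1 tag c; rewrite /= in nm; case: m / nm f m0 fs fi c => f m0 fs fi c.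
have {c}ef : e = f.
  apply/funext => x; apply/funext => y.
  have := eq_from_Tagged c.
  by move/ffunP/(_ (x, y)); rewrite !ffunE.
case: f / ef fs fi => fs fi.
by congr SGraph; exact: Prop_irrelevance.
Qed.

Lemma sgraph_enum : exists en : nat -> sgraph, forall F, exists i, en i = F.
Proof.
pose G0 := @sgraph_of unit (eq_leq (esym card_unit)) finset.set0.
pose dec i := if unpickle i is Some c then
    if pselect (exists F, sgraph_code F = c) is left ex then projT1 (cid ex) else G0
  else G0.
exists dec => F; exists (pickle (sgraph_code F)); rewrite /dec pickleK.
case: pselect => [ex|[]]; last by exists F.
by apply: sgraph_code_inj; exact: (projT2 (cid ex)).
Qed.

Lemma hom_density_itv F G : 0 <= hom_density R F G <= 1.
Proof.
rewrite hom_densityE mean_ge0//=; last exact: unif_prob_weight.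
rewrite -[leRHS](mean_cst (@unif_prob_weight R G) 'I_(nverts F) 1) le_mean//; first exact: unif_prob_weight.
by move=> h; rewrite lern1 leq_b1.
Qed.

(** All densities converge along the ultrafilter. As there are countably many
    graphs, a diagonal sequence has the same limits in the ordinary sense. *)
Lemma ultralimit_graph (H : nat -> sgraph) : nverts (H n) @[n --> \oo] --> \oo ->
  exists Gamma : graph_limit R, forall F,
    hom_density R F (H n) @[n --> U] --> lim_density Gamma F.
Proof.
move=> Hoo; have UF : ProperFilter U := ultra_proper.
have /choice[l lP] : forall F, exists l : R, hom_density R F (H n) @[n --> U] --> l.
  by move=> F; apply: (ultralimit (a := 0) (b := 1)) => n; apply: hom_density_itv.
have [en enP] := sgraph_enum.
have /choice[j jP] : forall N, exists j, (N <= j)%N /\ forall i, (i <= N)%N ->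
    `|l (en i) - hom_density R (en i) (H j)| < N.+1%:R^-1.
  move=> N; suff : U [set j | forall i, (i <= N)%N ->
      `|l (en i) - hom_density R (en i) (H j)| < N.+1%:R^-1].
    by move=> /ultra_frequently -/(_ N)[j Nj jP]; exists j.
  have near1 i : U [set j | `|l (en i) - hom_density R (en i) (H j)| < N.+1%:R^-1].
    by have /cvgrPdist_lt h := lP (en i); apply: h; rewrite invr_gt0.
  elim: {1}N => [|m IHm].
    by apply: filterS (near1 0%N) => j /= j0 i; rewrite leqn0 => /eqP ->.
  apply: filterS (filterI IHm (near1 m.+1)) => j [/= jm jm1] i.
  by rewrite leq_eqVlt => /predU1P[->//|]; apply: jm.
suff lH : exists G : nat -> sgraph, nverts (G n) @[n --> \oo] --> \oo /\
    forall F, hom_density R F (G n) @[n --> \oo] --> l F.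
  by exists (GraphLimit lH).
exists (fun N => H (j N)); split.
  have jo : j N @[N --> \oo] --> \oo.
    move=> A [N _ NA]; exists N => // m /= Nm; apply: NA => /=.
    by apply: leq_trans Nm _; have [] := jP m.
  exact: (cvg_comp _ _ jo Hoo).
move=> F; have [i <-] := enP F; apply/cvgrPdist_lt => eps eps0.
have [N0 N0P] : exists N0, forall m, (N0 <= m)%N -> m.+1%:R^-1 < eps.
  have := near_infty_natSinv_lt (PosNum eps0) => -[N0 _ N0P].
  by exists N0 => m; apply: N0P.
exists (maxn i N0) => // m /=; rewrite geq_max => /andP[im N0m].
apply: lt_trans (N0P _ N0m); have [_] := jP m; exact.
Qed.

End Ultralimit.

Section Split.
Context (R : realType).

Lemma connect_cross (T : finType) (e : rel T) (Q : pred T) x y :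
  connect e x y -> Q x -> ~~ Q y -> exists u v, [/\ e u v, Q u & ~~ Q v].
Proof.
move=> /connectP[s]; elim: s x => [|z s IHs] x /=; first by move=> _ -> ->.
move=> /andP[xz zs] yE Qx nQy.
have [Qz|nQz] := boolP (Q z); first exact: IHs zs yE Qz nQy.
by exists x, z.
Qed.

(** A sample conditioned to fall inside [A] is a sample of the subgraph induced
    by [A]. *)
Lemma induced_sgraph (G : sgraph) (A : {set 'I_(nverts G)}) :
  0 < vol (@unif R G) A ->
  exists H, [/\ (nverts H)%:R = vol (@unif R G) A * (nverts G)%:R &
    forall F, mean (@unif R G)
      (fun h => (is_hom (F := F) h && [forall x, h x \in A])%:R) =
      vol (@unif R G) A ^+ nverts F * hom_density R F H].
Proof.
have volE : vol (@unif R G) A = #|A|%:R / (nverts G)%:R.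
  by rewrite /vol /unif sumr_const mulr_natl.
have n0 : (nverts G)%:R != 0 :> R by rewrite pnatr_eq0 -lt0n nverts_gt0.
move=> A0; have {A0}cA : (0 < #|A|)%N.
  by rewrite lt0n; apply: contraTneq A0; rewrite volE => ->; rewrite mul0r ltxx.
pose f : rel 'I_#|A| := fun i j => edge (enum_val i) (enum_val j).
have fs : symmetric f by move=> i j; rewrite /f edge_sym.
have fi : irreflexive f by move=> i; rewrite /f edge_irr.
exists (SGraph cA fs fi); split => [|F] /=; first by rewrite volE divfK.
rewrite hom_densityE.
rewrite (mean_restrict (wt' := @unif R (SGraph cA fs fi)) (iota := enum_val)
  (c := vol (@unif R G) A)).
- rewrite card_ord; congr (_ * _); apply: eq_mean => h; congr (_%:R); congr nat_of_bool.
  have -> : [forall x, [ffun i => enum_val (h i)] x \in A].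
    by apply/forallP => x; rewrite ffunE; apply: enum_valP.
  rewrite andbT /is_hom; apply: eq_forallb => x; apply: eq_forallb => y.
  by rewrite !ffunE.
- exact: enum_val_inj.
- move=> t; rewrite /unif /= volE mulrAC divff ?mul1r//.
  by rewrite pnatr_eq0 -lt0n.
- move=> h i hi; rewrite (_ : [forall x, h x \in A] = false) ?andbF//.
  apply/negbTE/forallPn; exists i; apply/negP => hA.
  by have := hi (enum_rank_in hA (h i)); rewrite enum_rankK_in ?eqxx.
Qed.

(** A copy of a connected graph lies on one side of the cut or has an edge
    across it, so a graph with a sparse cut is nearly a direct sum. *)
Lemma split_sgraph (G : sgraph) (A : {set 'I_(nverts G)}) :
  let v := vol (@unif R G) in
  0 < v A -> 0 < v (~: A) ->
  exists H1 H2, [/\ (nverts H1)%:R = v A * (nverts G)%:R,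
    (nverts H2)%:R = v (~: A) * (nverts G)%:R &
    forall F, connected_graph F ->
      `|hom_density R F G - (v A ^+ nverts F * hom_density R F H1 +
          v (~: A) ^+ nverts F * hom_density R F H2)| <=
      (nverts F)%:R ^+ 2 * cut_weight (@unif R G) (@edge G) A].
Proof.
move=> v vA vC; have [H1 [nH1 H1P]] := induced_sgraph vA.
have [H2 [nH2 H2P]] := induced_sgraph vC.
exists H1, H2; split=> // F Fc.
rewrite -H1P -H2P -meanD -meanN hom_densityE -meanD.
have Gp := @unif_prob_weight R G.
pose cross (x y : 'I_(nverts F)) (h : {ffun 'I_(nverts F) -> 'I_(nverts G)}) :=
  [&& h x \in A, h y \notin A & edge (h x) (h y)].
pose D h : R := (is_hom (F := F) h)%:R - ((is_hom (F := F) h && [forall x, h x \in A])%:R +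
  (is_hom (F := F) h && [forall x, h x \in ~: A])%:R).
have D0 h : 0 <= D h <= \sum_x \sum_(y | edge x y) (cross x y h)%:R.
  pose x0 := Ordinal (nverts_gt0 F); rewrite /D.
  have [hom|] := boolP (is_hom (F := F) h); last first.
    by rewrite /= addr0 subr0 lexx sumr_ge0// => x _; rewrite sumr_ge0.
  have crossP : (exists u w, [/\ edge u w, h u \in A & h w \notin A]) ->
      1 <= \sum_x \sum_(y | edge x y) ((cross x y h)%:R : R).
    move=> [u [w [uw hu hw]]]; rewrite (bigD1 u)//= (bigD1 w)//=.
    rewrite /cross hu hw /= -addrA.
    have -> : edge (h u) (h w).
      by move: hom => /'forall_forallP/(_ u w)/implyP; apply.
    rewrite lerDl addr_ge0//; first by rewrite sumr_ge0.
    by rewrite sumr_ge0// => x _; rewrite sumr_ge0.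
  have S0 : 0 <= \sum_x \sum_(y | edge x y) ((cross x y h)%:R : R).
    by rewrite sumr_ge0// => x _; rewrite sumr_ge0.
  rewrite /=; case: (boolP [forall x, h x \in A]) => [/forallP hA|nA] /=.
    have -> : [forall x, h x \in ~: A] = false.
      by apply/negbTE/forallPn; exists x0; rewrite inE hA.
    by rewrite addr0 subrr lexx.
  case: (boolP [forall x, h x \in ~: A]) => [hA|nC] /=.
    by rewrite add0r subrr lexx.
  rewrite addr0 subr0 ler01/=; apply: crossP.
  have /forallPn[y hy] := nA; have /forallPn[z] := nC; rewrite inE negbK => hz.
  have [u [w [uw hu hw]]] := connect_cross (Q := fun x => h x \in A) (Fc z y) hz hy.
  by exists u, w.
have mD : mean (@unif R G) D <= (nverts F)%:R ^+ 2 * cut_weight (@unif R G) (@edge G) A.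
  apply: le_trans (le_mean Gp (g := fun h => \sum_x \sum_(y | edge x y) (cross x y h)%:R) _) _.
    by move=> h; have /andP[] := D0 h.
  have cut0 : 0 <= cut_weight (@unif R G) (@edge G) A.
    by apply: sumr_ge0 => u _; rewrite mulr_ge0 ?sumr_ge0//; case: Gp.
  rewrite mean_sum.
  have -> : (nverts F)%:R ^+ 2 * cut_weight (@unif R G) (@edge G) A =
     \sum_(x < nverts F) \sum_(y < nverts F) cut_weight (@unif R G) (@edge G) A.
    by rewrite !sumr_const !card_ord expr2 -mulrA !mulr_natl.
  apply: ler_sum => x _; rewrite mean_sum big_mkcond; apply: ler_sum => y _.
  case: ifP => // xy.
  pose f (s : seq 'I_(nverts G)) : R := if s is [:: u; w] then
    [&& u \in A, w \notin A & edge u w]%:R else 0.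
  have uxy : uniq [:: x; y].
    by rewrite /= inE andbT; apply: contraTneq xy => ->; rewrite edge_irr.
  rewrite -[X in X <= _]/(mean _ (fun h : {ffun _} => f (map h [:: x; y]))).
  rewrite mean_itavg// /cut_weight big_mkcond.
  rewrite le_eqVlt; apply/orP; left; apply/eqP; apply: eq_bigr => u _ /=.
  case: ifP => uA /=; last first.
    by rewrite big1 ?mulr0// => w _; rewrite mulr0.
  congr (_ * _); rewrite [RHS]big_mkcond; apply: eq_bigr => w _.
  by case: ifP => _; rewrite ?mulr1 ?mulr0.
have -> : mean (@unif R G) (fun h => (is_hom (F := F) h)%:R -
   ((is_hom (F := F) h && [forall x, h x \in A])%:R +
  (is_hom (F := F) h && [forall x, h x \in ~: A])%:R)) = mean (@unif R G) D by [].
rewrite ger0_norm//; apply: mean_ge0 => // h.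
by have /andP[] := D0 h.
Qed.

End Split.

(** * Connected limits expand *)

Lemma cvg_pow (R : realType) (T : Type) (F : set_system T) (FF : Filter F)
    (u : T -> R) (l : R) (v : nat) :
  u t @[t --> F] --> l -> u t ^+ v @[t --> F] --> l ^+ v.
Proof.
move=> ul; elim: v => [|v IHv]; first exact: cvg_cst.
by under eq_fun do rewrite exprS; rewrite exprS; apply: cvgM.
Qed.

Section Expansion.
Context (R : realType) (Gamma : graph_limit R) (Gn : nat -> sgraph).
Hypotheses (conn : connected_limit Gamma)
  (Gn_oo : nverts (Gn n) @[n --> \oo] --> \oo)
  (Gn_cvg : forall F, hom_density R F (Gn n) @[n --> \oo] --> lim_density Gamma F).

Lemma nneseries_below2 (u : nat -> \bar R) : (forall i, 0 <= u i)%E ->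
  (\sum_(0 <= i <oo | below (Some 2%N) i) u i = u 0%N + u 1%N)%E.
Proof.
move=> u0; rewrite (nneseries_split_cond 0 2)//=.
rewrite [X in (_ + X)%E]eseries0 ?adde0//; last by move=> i /= i2; rewrite ltnNge i2.
by rewrite big_mkcond/= big_nat_recr//= big_nat1/=.
Qed.

Lemma nverts_large (H : nat -> sgraph) (s : nat -> nat) (c : R) : 0 < c ->
  (forall j, (j <= s j)%N) ->
  (forall j, c * (nverts (Gn (s j)))%:R <= (nverts (H j))%:R) ->
  nverts (H j) @[j --> \oo] --> \oo.
Proof.
move=> c0 sj cH; apply/cvgnyPge => N.
have [M MN] : exists M : nat, N%:R <= c * M%:R.
  exists (Num.bound (N%:R / c)); rewrite -ler_pdivrMl// mulrC ltW//.
  by apply: archi_boundP; rewrite divr_ge0// ltW.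
have [j0 _ j0P] := (cvgnyPge _).1 Gn_oo M.
exists j0 => // j /= j0j; rewrite -(ler_nat R).
apply: le_trans MN _; apply: le_trans (cH j).
by rewrite ler_wpM2l ?(ltW c0)// ler_nat; apply: j0P; apply: leq_trans j0j (sj j).
Qed.

(** Sparse cuts of the approximating graphs would, along an ultrafilter,
    split the limit into two parts. *)
Lemma connected_expands (kappa : R) : 0 < kappa ->
  exists2 eta, 0 < eta <= 1 &
    \forall n \near \oo, expands (@unif R (Gn n)) (@edge (Gn n)) kappa eta.
Proof.
move=> k0; apply: contrapT => nex; apply: conn.
have /choice[s sP] : forall j : nat, exists n, (j <= n)%N /\
    ~ expands (@unif R (Gn n)) (@edge (Gn n)) kappa j.+1%:R^-1.
  move=> j; apply: contrapT => nn; apply: nex; exists j.+1%:R^-1.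
    by rewrite invr_gt0 ltr0Sn invf_le1 ?ltr0Sn// ler1n.
  exists j => // n /= jn; apply: contrapT => ne; apply: nn; by exists n.
have /choice[q qP] : forall j, exists q : sgraph * sgraph * R,
    [/\ kappa <= q.2 <= 1 - kappa,
      (nverts q.1.1)%:R = q.2 * (nverts (Gn (s j)))%:R,
      (nverts q.1.2)%:R = (1 - q.2) * (nverts (Gn (s j)))%:R &
      forall F, connected_graph F -> `|hom_density R F (Gn (s j)) -
          (q.2 ^+ nverts F * hom_density R F q.1.1 +
           (1 - q.2) ^+ nverts F * hom_density R F q.1.2)| <=
        (nverts F)%:R ^+ 2 * j.+1%:R^-1].
  move=> j; have [_] := sP j; rewrite /expands => /existsNP[A].
  move=> /not_implyP[kA /not_implyP[kC /negP]]; rewrite -ltNge => cut.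
  have vA := lt_le_trans k0 kA; have vC := lt_le_trans k0 kC.
  have [H1 [H2 [n1 n2 HP]]] := split_sgraph vA vC.
  exists (H1, H2, vol (@unif R (Gn (s j))) A); rewrite /= -volC; last exact: unif_prob_weight.
  split=> //; first by rewrite kA lerBrDl -lerBrDr -volC//; exact: unif_prob_weight.
  by move=> F /HP h; apply: le_trans h _; rewrite ler_wpM2l// ?exprn_ge0// ltW.
have [U [UU oU]] := @ultraFilterLemma nat \oo _.
have UF : ProperFilter U := ultra_proper.
pose H1 j := (q j).1.1; pose H2 j := (q j).1.2; pose a j := (q j).2.
have aP j : kappa <= a j <= 1 - kappa by have [] := qP j.
have [G1 G1P] : exists G1 : graph_limit R, forall F,
    hom_density R F (H1 n) @[n --> U] --> lim_density G1 F.
  apply: (@ultralimit_graph R U UU oU H1).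
  apply: (nverts_large (s := s) k0) => j; first by have [] := sP j.
  by rewrite /H1; have [_ -> _ _] := qP j; rewrite ler_wpM2r//; have /andP[] := aP j.
have [G2 G2P] : exists G2 : graph_limit R, forall F,
    hom_density R F (H2 n) @[n --> U] --> lim_density G2 F.
  apply: (@ultralimit_graph R U UU oU H2).
  apply: (nverts_large (s := s) k0) => j; first by have [] := sP j.
  rewrite /H2; have [_ _ -> _] := qP j; rewrite ler_wpM2r// lerBrDl -lerBrDr.
  by have /andP[] := aP j.
have [al alP] := ultralimit UU aP.
have al1 : kappa <= al <= 1 - kappa.
  by apply/andP; split; [apply: (cvgr_to_ge alP)|apply: (cvgr_to_le alP)];
    apply: filterE => j; have /andP[] := aP j.
exists G1, G2, al; split.
  case/andP: al1 => al0 al1; rewrite (lt_le_trans k0 al0)/=.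
  by apply: (le_lt_trans al1); rewrite ltrBlDr ltrDl.
have [al0 al_1] : 0 <= al /\ al <= 1.
  case/andP: al1 => l1 l2; split; first exact: le_trans (ltW k0) l1.
  by apply: le_trans l2 _; rewrite lerBlDr lerDl ltW.
split.
- by move=> i _; case: ifP => _ //; rewrite subr_ge0.
- rewrite nneseries_below2; last by move=> i; case: ifP => _; rewrite lee_fin// subr_ge0.
  by rewrite [X in (X <= _)%E](_ : _ = 1%E)// -EFinD /= addrC subrK.
move=> F Fc Fe; rewrite nneseries_below2; last first.
  move=> i; have lF (G : graph_limit R) : 0 <= lim_density G F.
    have [Hn [_ HnP]] := lim_densityP G; apply: (cvgr_to_ge (HnP F)).
    by apply: filterE => n; have /andP[] := @hom_density_itv R F (Hn n).
  by case: ifP => _; rewrite lee_fin mulr_ge0// exprn_ge0// subr_ge0.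
rewrite /= -EFinD; congr EFin.
have sU : s j @[j --> U] --> \oo.
  move=> A [N _ NA]; apply: oU; exists N => // j /= Nj; apply: NA => /=.
  by apply: leq_trans Nj _; have [] := sP j.
have c1 : hom_density R F (Gn (s j)) @[j --> U] --> lim_density Gamma F.
  exact: (cvg_comp _ _ sU (@Gn_cvg F)).
pose v := nverts F.
have c2 : (a j ^+ v * hom_density R F (H1 j) + (1 - a j) ^+ v * hom_density R F (H2 j))
    @[j --> U] --> al ^+ v * lim_density G1 F + (1 - al) ^+ v * lim_density G2 F.
  apply: cvgD; apply: cvgM => //.
    exact: cvg_pow.
  by apply: cvg_pow; apply: cvgB => //; exact: cvg_cst.
have c3 : (v%:R ^+ 2 * j.+1%:R^-1 : R) @[j --> U] --> (0 : R).
  have : (v%:R ^+ 2 * j.+1%:R^-1 : R) @[j --> \oo] --> (0 : R).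
    by rewrite -[X in _ --> X](mulr0 (v%:R ^+ 2)); apply: cvgMl_tmp; exact: cvg_harmonic.
  by move=> h; apply: cvg_trans h; move=> A /oU.
have c4 : `|lim_density Gamma F -
    (al ^+ v * lim_density G1 F + (1 - al) ^+ v * lim_density G2 F)| <= 0.
  apply: (ler_cvg_to _ c3); first by apply: cvg_norm; apply: cvgB; [exact: c1|exact: c2].
  by apply: filterE => j; have [_ _ _] := qP j; apply.
by apply/eqP; rewrite -subr_eq0 -normr_le0.
Qed.

Lemma cut_weight_low (n : nat) (A : {set 'I_(nverts (Gn n))}) (k' : R) : 0 <= k' ->
  (forall v, v \in A -> degree (@unif R (Gn n)) (@edge (Gn n)) v < k') ->
  cut_weight (@unif R (Gn n)) (@edge (Gn n)) A <= k'.
Proof.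
move=> k0 Ak; have Gp := @unif_prob_weight R (Gn n).
apply: (@le_trans _ _ (\sum_(u in A) unif R u * k')).
  apply: ler_sum => u uA; apply: ler_wpM2l; first by case: Gp.
  apply: le_trans (ltW (Ak u uA)); rewrite /degree big_mkcond [leRHS]big_mkcond.
  apply: ler_sum => w _; have w0 : 0 <= unif R w by case: Gp.
  by case: (edge u w); rewrite ?andbF// andbT; case: ifP.
rewrite -big_distrl/= -[leRHS]mul1r ler_wpM2r//.
by have := vol_ge0 Gp (~: A); rewrite volC// subr_ge0.
Qed.

(** Few edges leave a set of vertices of low degree, so a minimal such set of
    volume at least [kappa] would be a sparse cut. Minimality keeps its volume
    at most [3 / 4], so that the complement is large as well. *)
Lemma low_degree (kappa : R) : 0 < kappa -> kappa <= 4^-1 ->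
  exists2 k', 0 < k' <= kappa & \forall n \near \oo,
    vol (@unif R (Gn n)) [set v | degree (@unif R (Gn n)) (@edge (Gn n)) v < k']%SET
      <= kappa.
Proof.
move=> k0 k4; have [eta /andP[e0 e1] etaP] := connected_expands k0.
(* The cut found below has mass at most [k'], against the bound [eta] given by
   expansion. *)
pose k' := Num.min kappa (eta / 2); have k'0 : 0 < k' by rewrite lt_min k0 divr_gt0.
exists k'; first by rewrite k'0 ge_min lexx.
have n2 := (cvgnyPge _).1 Gn_oo 2%N.
near=> n.
have n2' : (2 <= nverts (Gn n))%N by near: n; exact: n2.
have exn : expands (@unif R (Gn n)) (@edge (Gn n)) kappa eta by near: n; exact: etaP.
rewrite leNgt; apply/negP => lown.
set G := Gn n; have Gp := @unif_prob_weight R G.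
set low := [set v | _]%SET in lown.
have nG : 0 < (nverts G)%:R :> R by rewrite ltr0n nverts_gt0.
have volE (B : {set 'I_(nverts G)}) : vol (@unif R G) B = #|B|%:R / (nverts G)%:R.
  by rewrite /vol /unif sumr_const mulr_natl.
pose Q := fun A : {set 'I_(nverts G)} => (A \subset low) && (kappa <= vol (@unif R G) A).
have Qlow : Q low by rewrite /Q subxx (ltW lown).
have [A /andP[Al kA] Amin] := arg_minnP (fun A : {set 'I_(nverts G)} => #|A|) Qlow.
have [x xA] : exists x, x \in A.
  apply/set0Pn; apply: contraTneq kA => ->.
  by rewrite /vol big_set0 -ltNge.
have Ax : vol (@unif R G) (A :\ x) < kappa.
  rewrite ltNge; apply/negP => kAx.
  have /Amin : Q (A :\ x).
    by rewrite /Q kAx andbT (fintype.subset_trans (finset.subD1set _ _)).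
  by rewrite /= (cardsD1 x A) xA add1n ltnn.
have A34 : vol (@unif R G) A <= 3 / 4.
  rewrite /vol (big_setD1 x)//= -/(vol _ _).
  have -> : 3 / 4 = 2^-1 + 4^-1 :> R by field.
  apply: lerD; last by apply: le_trans (ltW Ax) k4.
  by rewrite /unif lef_pV2 ?posrE// ler_nat.
have kC : kappa <= vol (@unif R G) (~: A).
  by rewrite volC//; apply: le_trans k4 _; lra.
have : eta <= k'.
  apply: le_trans (exn A kA kC) (cut_weight_low (ltW k'0) _) => v.
  by move=> /(fintype.subsetP Al); rewrite inE.
rewrite leNgt gt_min => /negP; apply; apply/orP; right; lra.
Unshelve. all: by end_near.
Qed.

(** Thinned samples of a connected limit: the genuine vertices among [K] end up
    in one component as the sample grows. *)
Lemma joins_lower (a eps : R) (k : nat) : 0 < a <= 1 -> 0 < eps ->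
  exists s0 : nat, forall s, (s0 <= s)%N ->
    forall (I : finType) (K : {set I}), #|I| = s.+2 -> #|K| = k -> (0 < k)%N ->
    \forall n \near \oo, a ^+ k - eps <=
      mean (thin_wt a (@unif R (Gn n)))
        (fun h => (joins K (pat (thin_edge (@edge (Gn n))) h))%:R).
Proof.
move=> /andP[a0 a1] e0.
(* Each of the three error terms in [mean_joins_ge] gets a share [delta / 4]
   for every element of [K]. *)
pose delta := eps / k.+1%:R; have d0 : 0 < delta by rewrite divr_gt0.
pose kappa := Num.min 4^-1 (delta / 4).
have k0 : 0 < kappa by rewrite lt_min invr_gt0 divr_gt0 ?ltr0n.
have k4 : kappa <= 4^-1 by rewrite ge_min lexx.
have kd : kappa <= delta / 4 by rewrite ge_min lexx orbT.
have [k' /andP[k'0 k'k] lowP] := low_degree k0 k4.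
have [eta /andP[eta0 eta1] exP] := connected_expands k'0.
have a01 : 0 <= a <= 1 by rewrite (ltW a0).
have eta01 : 0 <= eta <= 1 by rewrite (ltW eta0).
have ae : 0 < a * eta <= 1 by rewrite mulr_gt0// mulr_ile1// ltW.
have rho : `|1 - a * eta| < 1.
  by case/andP: ae => ae0 ae1; rewrite ger0_norm ?subr_ge0// ltrBlDr ltrDl.
have /cvgrPdist_lt/(_ _ (divr_gt0 d0 (ltr0Sn R 3))) [s0 _ s0P] := cvg_expr rho.
exists s0 => s s0s I K cI cK kgt0; near=> n.
have lown : vol (@unif R (Gn n))
    [set v | degree (@unif R (Gn n)) (@edge (Gn n)) v < k']%SET <= kappa.
  by near: n; exact: lowP.
have exn : expands (@unif R (Gn n)) (@edge (Gn n)) k' eta by near: n; exact: exP.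
have K0 : (0 < #|K|)%N by rewrite cK.
have := mean_joins_ge (@unif_prob_weight R (Gn n)) a01 (ltW k'0) eta01 exn K0 cI.
rewrite cK; apply: le_trans; rewrite lerD2l lerN2.
have rs : (1 - a * eta) ^+ s <= delta / 4.
  have := s0P s s0s; rewrite sub0r normrN normrX => /ltW; apply: le_trans.
  by rewrite -normrX ler_norm.
have -> : eps = k.+1%:R * delta by rewrite /delta mulrCA divff ?mulr1.
apply: ler_pM => //; last first.
- by move: lown kd k'k rs d0; lra.
- by rewrite ler_nat.
- rewrite !addr_ge0 ?(ltW k'0)//; first exact: vol_ge0 (unif_prob_weight _ _) _.
  by rewrite exprn_ge0// subr_ge0; case/andP: ae.
Unshelve. all: by end_near.
Qed.

End Expansion.

(** * Joined samples of a direct sum *)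

Lemma nneseries_cvg (R : realType) (D : pred nat) (x : nat -> R) (y : R) :
  (forall i, D i -> 0 <= x i) ->
  (\sum_(0 <= i <oo | D i) (x i)%:E)%E = y%:E ->
  \sum_(i < N) (if D i then x i else 0) @[N --> \oo] --> y.
Proof.
move=> x0 xy.
have h : (\sum_(0 <= i < n | D i) (x i)%:E)%E @[n --> \oo] --> y%:E.
  by rewrite -xy; apply: is_cvg_nneseries_cond => i _ Di; rewrite lee_fin x0.
have e n : (\sum_(0 <= i < n | D i) (x i)%:E)%E = (\sum_(i < n) (if D i then x i else 0))%:E.
  by rewrite sumEFin big_mkord big_mkcond.
have {}h : (\sum_(i < n) (if D i then x i else 0))%:E @[n --> \oo] --> y%:E.
  by under eq_fun do rewrite -e.
by case/fine_cvgP : h.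
Qed.

Lemma lim_density_ge0 (R : realType) (Gamma : graph_limit R) F : 0 <= lim_density Gamma F.
Proof.
have [Hn [_ HnP]] := lim_densityP Gamma; apply: (cvgr_to_ge (HnP F)).
by apply: filterE => n; have /andP[] := @hom_density_itv R F (Hn n).
Qed.

Section JoinLimit.
Context (R : realType) (Gamma : graph_limit R) (M : option nat) (alpha : nat -> R)
  (Gam : nat -> graph_limit R).
Hypotheses (alpha_gt0 : forall i, below M i -> 0 < alpha i)
  (alpha_sum : (\sum_(0 <= i <oo | below M i) (alpha i)%:E <= 1)%E)
  (Gam_connected : forall i, below M i -> connected_limit (Gam i))
  (Gamma_decomp : is_direct_sum M alpha Gam Gamma).

(** The weights extended by [0], so that sums range over all indices. *)
Definition weight i := if below M i then alpha i else 0.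

Lemma weight_ge0 i : 0 <= weight i.
Proof. by rewrite /weight; case: ifP => // /alpha_gt0/ltW. Qed.

Lemma sum_weight_le1 N : \sum_(i < N) weight i <= 1.
Proof.
rewrite -lee_fin; apply: le_trans alpha_sum.
have -> : (\sum_(i < N) weight i)%:E = (\sum_(0 <= i < N | below M i) (alpha i)%:E)%E.
  by rewrite sumEFin big_mkord [in RHS]big_mkcond.
by apply: nneseries_lim_ge => i _ /alpha_gt0 /ltW; rewrite lee_fin.
Qed.

Lemma weight_le1 i : weight i <= 1.
Proof.
apply: le_trans (sum_weight_le1 i.+1); rewrite big_ord_recr/= lerDr.
by apply: sumr_ge0 => j _; exact: weight_ge0.
Qed.

Lemma power_sum_cvg k : (0 < k)%N ->
  exists S : R, \sum_(i < N) weight i ^+ k @[N --> \oo] --> S.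
Proof.
move=> k0; apply/cvg_ex; apply: nondecreasing_is_cvgn.
  apply/nondecreasing_seqP => n; rewrite big_ord_recr/= lerDl.
  by rewrite exprn_ge0// weight_ge0.
exists 1 => _ [n _ <-]; apply: le_trans (sum_weight_le1 n).
apply: ler_sum => i _; case: k k0 => // k _; rewrite exprS -[leRHS]mulr1.
by rewrite ler_wpM2l ?weight_ge0// exprn_ile1 ?weight_ge0 ?weight_le1.
Qed.

Lemma direct_sum_cvg F : connected_graph F -> has_edge F ->
  \sum_(i < N) weight i ^+ nverts F * lim_density (Gam i) F @[N --> \oo] -->
  lim_density Gamma F.
Proof.
move=> Fc Fe; case: Gamma_decomp => _ _ /(_ F Fc Fe) /esym /nneseries_cvg h.
have {}h := h (fun i Di => mulr_ge0 (exprn_ge0 _ (ltW (alpha_gt0 Di))) (lim_density_ge0 _ _)).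
apply: cvg_trans h; apply: near_eq_cvg; apply: filterE => N; apply: eq_bigr => i _.
rewrite /weight; case: ifP => //; rewrite expr0n.
by case: (nverts F) (nverts_gt0 F) => // n _ /=; rewrite mul0r.
Qed.

Section Sample.
Context (I : finType) (K : {set I}) (k0 : I).
Hypotheses (k0K : k0 \in K) (K1 : (1 < #|K|)%N).

Let supp_density F (G : graph_limit R) := lim_pat_density (supp_gt0 F k0) (supp_edges F k0) G.

Lemma cvg_joins (c : {set I * I} -> R) (G : graph_limit R) (Gn : nat -> sgraph) :
  (forall H, (joins K H)%:R = \sum_(F : {set I * I} | (F \subset H) && spans K F) c F) ->
  (forall F, hom_density R F (Gn n) @[n --> \oo] --> lim_density G F) ->
  mean (@unif R (Gn n)) (fun h => (joins K (pat (@edge (Gn n)) h))%:R) @[n --> \oo] -->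
  \sum_(F : {set I * I} | spans K F) c F * supp_density F G.
Proof.
move=> cP GnP.
under eq_fun do rewrite (mean_pat_sum (@unif R _) _ cP).
apply: cvg_rsum => F FK; apply: cvgMl_tmp.
under eq_fun do rewrite (pat_density_supp k0K FK _ (unif_prob_weight R _)).
exact: cvg_pat_density.
Qed.

Lemma cvg_joins_thin (a : R) (c : {set I * I} -> R) (G : graph_limit R) (Gn : nat -> sgraph) :
  0 <= a <= 1 ->
  (forall H, (joins K H)%:R = \sum_(F : {set I * I} | (F \subset H) && spans K F) c F) ->
  (forall F, hom_density R F (Gn n) @[n --> \oo] --> lim_density G F) ->
  mean (thin_wt a (@unif R (Gn n)))
    (fun h => (joins K (pat (thin_edge (@edge (Gn n))) h))%:R) @[n --> \oo] -->
  \sum_(F : {set I * I} | spans K F) c F * (a ^+ #|{: supp F k0}| * supp_density F G).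
Proof.
move=> a01 cP GnP.
under eq_fun do rewrite (mean_pat_sum (thin_wt a (@unif R _)) _ cP).
apply: cvg_rsum => F FK; apply: cvgMl_tmp.
under eq_fun do rewrite (pat_density_thin k0K K1 FK _ a01 (unif_prob_weight R _)).
by apply: cvgMl_tmp; exact: cvg_pat_density.
Qed.

(** The patterns that span [K] have connected supports, whose densities add up
    over the components. *)
Lemma cvg_direct_sum_joins (c : {set I * I} -> R) :
  \sum_(i < N) (\sum_(F : {set I * I} | spans K F) c F *
     (weight i ^+ #|{: supp F k0}| * supp_density F (Gam i))) @[N --> \oo] -->
  \sum_(F : {set I * I} | spans K F) c F * supp_density F Gamma.
Proof.
under eq_fun do rewrite exchange_big/=.
apply: cvg_rsum => F FK; under eq_fun do rewrite -big_distrr/=.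
apply: cvgMl_tmp; rewrite /supp_density /lim_pat_density; case: ifP => _; last first.
  by under eq_fun do under eq_bigr do rewrite mulr0; under eq_fun do rewrite big1_eq; exact: cvg_cst.
by apply: direct_sum_cvg; [exact: supp_connected|exact: (supp_has_edge k0K K1 FK)].
Qed.

End Sample.

(** In the limit, the probability that [K] is joined is the sum over [i] of the
    probabilities that it is joined in the thinned [i]-th component. Each is at
    most [weight i ^+ k] and, by connectedness, close to it for large samples. *)
Lemma join_limit (Gn : nat -> sgraph) (k : nat) (S : R) : (1 < k)%N ->
  (forall F, hom_density R F (Gn n) @[n --> \oo] --> lim_density Gamma F) ->
  \sum_(i < N) weight i ^+ k @[N --> \oo] --> S ->
  forall eps, 0 < eps -> exists m0 : nat,
    forall (I : finType) (K : {set I}), (m0 <= #|I|)%N -> #|K| = k ->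
    exists J : R, [/\ S - eps <= J, J <= S &
      mean (@unif R (Gn n)) (fun h => (joins K (pat (@edge (Gn n)) h))%:R)
        @[n --> \oo] --> J].
Proof.
move=> k1 GnP cS eps eps0.
have w01 i : 0 <= weight i <= 1 by rewrite weight_ge0 weight_le1.
have [Gi GiP] : exists Gi : nat -> nat -> sgraph, forall i,
    nverts (Gi i n) @[n --> \oo] --> \oo /\
    forall F, hom_density R F (Gi i n) @[n --> \oo] --> lim_density (Gam i) F.
  have /choice[Gi GiP] : forall i, exists G : nat -> sgraph,
    nverts (G n) @[n --> \oo] --> \oo /\
    forall F, hom_density R F (G n) @[n --> \oo] --> lim_density (Gam i) F.
    by move=> i; exact: lim_densityP.
  by exists Gi.
have eps20 : 0 < eps / 2 by rewrite divr_gt0.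
have [N NP] : exists N, S - eps / 2 <= \sum_(i < N) weight i ^+ k.
  have /cvgrPdist_le/(_ _ eps20)[N _ NP] := cS; exists N.
  have := NP N (leqnn _); rewrite ler_norml => /andP[_].
  by rewrite lerBlDr lerBlDl addrC.
pose e := eps / 2 / N.+1%:R; have e0 : 0 < e by rewrite divr_gt0.
have /choice[s0 s0P] : forall i, exists s0 : nat, below M i -> forall s, (s0 <= s)%N ->
    forall (I : finType) (K : {set I}), #|I| = s.+2 -> #|K| = k -> (0 < k)%N ->
    \forall n \near \oo, weight i ^+ k - e <=
      mean (thin_wt (weight i) (@unif R (Gi i n)))
        (fun h => (joins K (pat (thin_edge (@edge (Gi i n))) h))%:R).
  move=> i; case Mi: (below M i); last by exists 0%N.
  have wi : 0 < weight i <= 1 by rewrite weight_le1 /weight Mi alpha_gt0.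
  have [oo cc] := GiP i.
  have [s0 s0P] := joins_lower (Gam_connected Mi) oo cc k wi e0.
  by exists s0.
exists (\max_(i < N) s0 i).+2 => I K Im Kk.
have k0 : (0 < k)%N by exact: ltnW.
have [s cI] : exists s, #|I| = s.+2 by case: #|I| Im => [|[|s]] //; exists s.
have ss0 i : (i < N)%N -> (s0 i <= s)%N.
  move=> iN; move: Im; rewrite cI !ltnS; apply: leq_trans.
  exact: (leq_bigmax (Ordinal iN)).
have /card_gt0P[x xK] : (0 < #|K|)%N by rewrite Kk.
have K1 : (1 < #|K|)%N by rewrite Kk.
have [c cP] := joins_mobius R (ltnW K1).
pose q i := \sum_(F : {set I * I} | spans K F) c F *
     (weight i ^+ #|{: supp F x}| * lim_pat_density (supp_gt0 F x) (supp_edges F x) (Gam i)).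
have qcvg i := cvg_joins_thin xK K1 (w01 i) cP (GiP i).2.
have q0 i : 0 <= q i.
  apply: (cvgr_to_ge (qcvg i)); apply: filterE => n; apply: mean_ge0 => //.
  by apply: thin_prob_weight => //; exact: unif_prob_weight.
have qk i : q i <= weight i ^+ k.
  apply: (cvgr_to_le (qcvg i)); apply: filterE => n; rewrite -Kk.
  by apply: mean_joins_le => //; exact: unif_prob_weight.
have qge i : (i < N)%N -> weight i ^+ k - e <= q i.
  move=> iN; case Mi: (below M i); last first.
    by rewrite {1}/weight Mi expr0n -(prednK k0)/= sub0r; apply: le_trans (q0 i); rewrite oppr_le0 ltW.
  apply: (cvgr_to_ge (qcvg i)); exact: (s0P i Mi s (ss0 i iN)).
have Jc : \sum_(i < n) q i @[n --> \oo] --> \sum_(F : {set I * I} | spans K F)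
    c F * lim_pat_density (supp_gt0 F x) (supp_edges F x) Gamma.
  exact: cvg_direct_sum_joins.
exists (\sum_(F : {set I * I} | spans K F) c F * lim_pat_density (supp_gt0 F x) (supp_edges F x) Gamma).
split; last exact: cvg_joins.
- apply: (cvgr_to_ge Jc); exists N => // n /= Nn.
  rewrite -/(q _); apply: (@le_trans _ _ (\sum_(i < N) q i)).
    apply: (@le_trans _ _ (\sum_(i < N) (weight i ^+ k - e))); last first.
      by apply: ler_sum => i _; apply: qge.
    rewrite big_split/= sumr_const card_ord mulNrn -mulr_natl.
    have : N%:R * e <= eps / 2.
      by rewrite /e mulrCA ler_piMr ?(ltW eps20)// ler_pdivrMr// mul1r ler_nat.
    by move: NP; lra.
  rewrite -(subnKC Nn) big_split_ord/= lerDl sumr_ge0// => i _; exact: q0.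
- apply: (ler_cvg_to Jc cS); apply: filterE => n; apply: ler_sum => i _; exact: qk.
Qed.

End JoinLimit.

(** * Windows of an i.i.d. sequence *)

Section TupleLaw.
Context d (S : measurableType d) (R : realType) (mu : probability S R).
Context d' (Omega : measurableType d') (P : probability Omega R).
Context (X : nat -> {RV P >-> S}) (Xiid : iid mu X).

Definition rects n : set (set (n.-tuple S)) :=
  [set C | exists B : 'I_n -> set S, (forall i, measurable (B i)) /\
     C = [set t | forall i, B i (tnth t i)]].

Lemma measurable_rect n (C : set (n.-tuple S)) : rects C -> measurable C.
Proof.
move=> [B [mB ->]].
have -> : [set t : n.-tuple S | forall i, B i (tnth t i)] =
    \bigcap_(i in [set: 'I_n]) ((@tnth n S)^~ i @^-1` B i).
  by rewrite eqEsubset; split => [t tB i _|t tB i]; apply: tB.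
apply: fin_bigcap_measurable => // i _.
by rewrite -[X in measurable X]setTI; exact: measurable_tnth.
Qed.

Lemma measurable_tupleE n : @measurable _ (n.-tuple S) = <<s @rects n >>.
Proof.
rewrite eqEsubset; split; last first.
  apply: smallest_sub; first exact: sigma_algebra_measurable.
  by move=> C; exact: measurable_rect.
apply: smallest_sub; first exact: smallest_sigma_algebra.
move=> C; rewrite -bigcup_seq => -[i _ [B mB <-]].
apply: sub_sigma_algebra; exists (fun j => if j == i then B else setT); split.
  by move=> j; case: ifP.
rewrite setTI eqEsubset; split => [t tB j|t /(_ i)]; last by rewrite eqxx.
by case: eqP => // ->.
Qed.

Lemma rects_setI n : setI_closed (@rects n).
Proof.
move=> _ _ [B [mB ->]] [B' [mB' ->]]; exists (fun i => B i `&` B' i); split.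
  by move=> i; exact: measurableI.
rewrite eqEsubset; split => [t [tB tB'] i|t tBB']; first by split.
by split => i; have [] := tBB' i.
Qed.

Definition window n s (w : Omega) : n.-tuple S := [tuple X (s + i)%N w | i < n].

Lemma measurable_window n s : measurable_fun setT (window n s).
Proof.
apply/measurable_fun_tnthP => i; apply: eq_measurable_fun (measurable_funP (X (s + i)%N)).
by move=> w _; rewrite /= tnth_mktuple.
Qed.

Lemma measurable_X i B : measurable B -> measurable (X i @^-1` B).
Proof. by move=> mB; rewrite -[Y in measurable Y]setTI; exact: measurable_funP. Qed.

Lemma iid_window n s (B : 'I_n -> set S) : (forall i, measurable (B i)) ->
  P (window n s @^-1` [set t | forall i, B i (tnth t i)]) =
  (\prod_(i < n) mu (B i))%E.
Proof.
move=> mB; case: Xiid => Xlaw Xind.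
pose B' k := if insub (k - s)%N is Some i then B i else setT.
have mB' k : measurable (B' k) by rewrite /B'; case: insub.
have -> : window n s @^-1` [set t | forall i, B i (tnth t i)] =
    \bigcap_(i in [set` iota s n]) (X i @^-1` B' i).
  rewrite eqEsubset; split => w /=.
    move=> wB k /=; rewrite mem_iota => /andP[sk kn]; rewrite /B'.
    case: insubP => [i _ ik|//] /=.
    by have := wB i; rewrite tnth_mktuple ik subnKC.
  move=> wB i; rewrite tnth_mktuple.
  have /= := wB (s + i)%N; rewrite mem_iota leq_addr ltn_add2l ltn_ord => /(_ isT).
  by rewrite /B' addKn valK.
rewrite Xind ?iota_uniq// -{1}[s]addn0 iotaDl big_map.
rewrite (_ : iota 0 n = index_iota 0 n); last by rewrite /index_iota subn0.
rewrite big_mkord.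
by apply: eq_bigr => i _; rewrite -(Xlaw (s + i)%N (B i))// /B' addKn valK.
Qed.

(** In [C], both sides are finite measures that agree on the rectangles. *)
Lemma indep_window n s (B : set S) (C : set (n.-tuple S)) :
  measurable B -> measurable C ->
  P (X s @^-1` B `&` window n s.+1 @^-1` C) = (mu B * P (window n s.+1 @^-1` C))%E.
Proof.
move=> mB; have mXB := measurable_X s mB.
have mW := @measurable_window n s.+1.
pose m1 : {measure set _ -> \bar R} := pushforward (mrestr P mXB) (window n s.+1).
have muB0 : 0 <= fine (mu B) by rewrite fine_ge0.
pose m2 : {measure set _ -> \bar R} := mscale (NngNum muB0) (pushforward P (window n s.+1)).
have m1E D : m1 mW D = P (window n s.+1 @^-1` D `&` X s @^-1` B) by [].
have m2E D : m2 mW D = (mu B * P (window n s.+1 @^-1` D))%E.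
  transitivity ((fine (mu B))%:E * P (window n s.+1 @^-1` D))%E => //.
  by rewrite fineK// fin_num_measure.
move=> mC; suff : m1 mW C = m2 mW C by rewrite m1E m2E setIC.
apply: (measure_unique (@rects n) (fun=> setT)) => //.
- exact: measurable_tupleE.
- exact: rects_setI.
- by move=> _; exists (fun=> setT); split=> //; rewrite eqEsubset; split.
- by rewrite bigcup_const.
- move=> _ [B' [mB' ->]]; rewrite m1E m2E (iid_window s.+1 mB').
  pose B'' (i : 'I_n.+1) := if unlift ord0 i is Some j then B' j else B.
  have mB'' i : measurable (B'' i) by rewrite /B''; case: unlift.
  have := iid_window s mB''; rewrite big_ord_recl /B'' unlift_none.
  under eq_bigr do rewrite liftK.
  move=> <-; congr (P _); rewrite eqEsubset; split => w /=.
    move=> [wB' wB] i; case: (unliftP ord0 i) => [j ->|->].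
      have := wB' j; rewrite !tnth_mktuple /=.
      by rewrite /bump /= add1n addSnnS.
    by rewrite tnth_mktuple /= addn0.
  move=> wB; split.
    move=> j; have := wB (lift ord0 j); rewrite liftK !tnth_mktuple /=.
    by rewrite /bump /= add1n addSnnS.
  by have := wB ord0; rewrite unlift_none tnth_mktuple /= addn0.
- move=> k; rewrite m1E preimage_setT setTI; apply: le_lt_trans (ltry 1).
  exact: probability_le1.
Qed.

(** The first variable is independent of the others, so that their joint law is
    a product and Tonelli's theorem splits off one integral. *)
Lemma integral_window (n s : nat) (f : n.-tuple S -> \bar R) :
  measurable_fun [set: n.-tuple S] f -> (forall t, 0 <= f t)%E ->
  (\int[P]_w f (window n s w) = integral_pow mu f)%E.
Proof.
elim: n s f => [|n IHn] s f mf f0.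
  transitivity (\int[P]_w (cst (f [tuple]) w))%E.
    by apply: eq_integral => w _; rewrite [window 0 s w]tuple0.
  by rewrite integral_cst//= probability_setT mule1.
pose W_mixin := isMeasurableFun.Build _ _ _ _ _ (@measurable_window n s.+1).
pose W : {mfun Omega >-> n.-tuple S} := HB.pack (window n s.+1) W_mixin.
pose nu : probability _ R := distribution P W.
pose g (p : S * n.-tuple S) : \bar R := f [tuple of p.1 :: p.2].
have mg : measurable_fun setT g.
  by apply: (measurableT_comp mf); apply: measurable_cons.
have mXW : measurable_fun setT (fun w => (X s w, window n s.+1 w)).
  by apply: measurable_fun_pair; [exact: measurable_funP|exact: measurable_window].
pose XW_mixin := isMeasurableFun.Build _ _ _ _ _ mXW.
pose XW : {mfun Omega >-> (S * n.-tuple S)%type} := HB.pack (fun w => (X s w, window n s.+1 w)) XW_mixin.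
pose m' := distribution P XW.
have m'E : forall Q, measurable Q -> (mu \x nu)%E Q = m' Q.
  apply: product_measure_unique => B C mB mC.
  by rewrite /m' /= /pushforward /= -(indep_window s mB mC).
transitivity (\int[m']_p g p)%E.
  rewrite ge0_integral_distribution//; last by move=> p; exact: f0.
  apply: eq_integral => w _; rewrite /g /=; congr f; apply: eq_from_tnth => i.
  rewrite tnth_mktuple; case: (unliftP ord0 i) => [j ->|->].
    by rewrite tnthS tnth_mktuple /= /bump /= add1n addSnnS.
  by rewrite tnth0 /= addn0.
transitivity (\int[mu \x nu]_p g p)%E.
  by apply: eq_measure_integral => Q mQ _; exact/esym/m'E.
rewrite fubini_tonelli1//; last by move=> p; exact: f0.
apply: eq_integral => x _; rewrite /fubini_F.
have mgx : measurable_fun setT (fun t : n.-tuple S => f [tuple of x :: t]).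
  by apply: (measurableT_comp mf); apply: measurable_cons.
rewrite /nu ge0_integral_distribution//; last by move=> t; exact: f0.
by apply: (IHn s.+1 (fun t : n.-tuple S => f [tuple of x :: t])) => // t; exact: f0.
Qed.

End TupleLaw.

(** * Expectations of bounded random variables *)

Section Expectation.
Context d (Omega : measurableType d) (R : realType) (P : probability Omega R).
Implicit Types f g : Omega -> R.

(** Bounded measurable functions, a class that is closed under the operations
    below and on which expectations are finite. *)
Definition bmf f := measurable_fun setT f /\ exists C : R, forall w, `|f w| <= C.

Definition Ex f : R := \int[P]_w f w.

Lemma bmf_integrable f : bmf f -> P.-integrable setT (EFin \o f).
Proof.
move=> [mf [C fC]]; apply: measurable_bounded_integrable => //.
  by apply: le_lt_trans (ltry 1); rewrite probability_le1.
exists C; split; first exact: num_real.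
by move=> x Cx w _; apply: le_trans (fC w) (ltW Cx).
Qed.

Lemma Ex_fin f : bmf f -> (Ex f)%:E = (\int[P]_w (f w)%:E)%E.
Proof. by move=> /bmf_integrable h; rewrite /Ex /Rintegral fineK// integrable_fin_num. Qed.

Lemma bmf_cst c : bmf (fun=> c).
Proof. by split; [exact: measurable_cst|exists `|c|]. Qed.

Lemma bmfD f g : bmf f -> bmf g -> bmf (fun w => f w + g w).
Proof.
move=> [mf [C fC]] [mg [D gD]]; split; first exact: measurable_funD.
by exists (C + D) => w; apply: le_trans (ler_normD _ _) (lerD _ _).
Qed.

Lemma bmfM f g : bmf f -> bmf g -> bmf (fun w => f w * g w).
Proof.
move=> [mf [C fC]] [mg [D gD]]; split; first exact: measurable_funM.
by exists (C * D) => w; rewrite normrM ler_pM.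
Qed.

Lemma bmfZ c f : bmf f -> bmf (fun w => c * f w).
Proof. by move=> bf; apply: bmfM => //; exact: bmf_cst. Qed.

Lemma bmfN f : bmf f -> bmf (fun w => - f w).
Proof.
move=> [mf [C fC]]; split; first exact: measurableT_comp.
by exists C => w; rewrite normrN.
Qed.

Lemma bmf_norm f : bmf f -> bmf (fun w => `|f w|).
Proof.
move=> [mf [C fC]]; split; first exact: measurableT_comp.
by exists C => w; rewrite normr_id.
Qed.

Lemma bmf_sum (I : Type) (r : seq I) (Q : pred I) (f : I -> Omega -> R) :
  (forall i, bmf (f i)) -> bmf (fun w => \sum_(i <- r | Q i) f i w).
Proof.
move=> bf; elim: r => [|i r IHr].
  by under eq_fun do rewrite big_nil; exact: bmf_cst.
under eq_fun do rewrite big_cons.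
by case: (Q i) => //; exact: bmfD.
Qed.

Lemma bmf_prod (I : Type) (r : seq I) (Q : pred I) (f : I -> Omega -> R) :
  (forall i, bmf (f i)) -> bmf (fun w => \prod_(i <- r | Q i) f i w).
Proof.
move=> bf; elim: r => [|i r IHr].
  by under eq_fun do rewrite big_nil; exact: bmf_cst.
under eq_fun do rewrite big_cons.
by case: (Q i) => //; exact: bmfM.
Qed.

Lemma bmfX n f : bmf f -> bmf (fun w => f w ^+ n).
Proof.
move=> bf; elim: n => [|n IHn]; first exact: bmf_cst.
by under eq_fun do rewrite exprS; exact: bmfM.
Qed.

Lemma Ex_cst c : Ex (fun=> c) = c.
Proof.
apply: EFin_inj; rewrite Ex_fin; last exact: bmf_cst.
by rewrite integral_cst//= probability_setT mule1.
Qed.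

Lemma ExD f g : bmf f -> bmf g -> Ex (fun w => f w + g w) = Ex f + Ex g.
Proof. by move=> /bmf_integrable bf /bmf_integrable bg; rewrite /Ex RintegralD. Qed.

Lemma ExZ c f : bmf f -> Ex (fun w => c * f w) = c * Ex f.
Proof. by move=> /bmf_integrable bf; rewrite /Ex RintegralZl. Qed.

Lemma ExN f : bmf f -> Ex (fun w => - f w) = - Ex f.
Proof.
by move=> bf; rewrite -[RHS]mulN1r -ExZ//; congr Ex; apply/funext => w; rewrite mulN1r.
Qed.

Lemma le_Ex f g : bmf f -> bmf g -> (forall w, f w <= g w) -> Ex f <= Ex g.
Proof. by move=> /bmf_integrable bf /bmf_integrable bg fg; rewrite le_Rintegral. Qed.

Lemma Ex_sum (I : Type) (r : seq I) (Q : pred I) (f : I -> Omega -> R) :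
  (forall i, bmf (f i)) ->
  Ex (fun w => \sum_(i <- r | Q i) f i w) = \sum_(i <- r | Q i) Ex (f i).
Proof.
move=> bf; elim: r => [|i r IHr].
  by under eq_fun do rewrite big_nil; rewrite big_nil Ex_cst.
under eq_fun do rewrite big_cons; rewrite big_cons.
by case: (Q i) => //; rewrite ExD ?IHr//; exact: bmf_sum.
Qed.

Definition event (B : Omega -> bool) := measurable [set w | B w].

Lemma indicE_event (B : Omega -> bool) : (fun w => (B w)%:R) = \1_[set w | B w] :> (Omega -> R).
Proof.
by apply/funext => w; rewrite indicE; congr (_%:R); rewrite mem_setE.
Qed.

Lemma bmf_event (B : Omega -> bool) : event B -> bmf (fun w => (B w)%:R).
Proof.
move=> mB; split; first by rewrite indicE_event; exact: measurable_indic.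
by exists 1 => w; rewrite normr_nat lern1 leq_b1.
Qed.

Lemma Ex_event (B : Omega -> bool) : event B ->
  (Ex (fun w => (B w)%:R))%:E = P [set w | B w].
Proof.
move=> mB; rewrite Ex_fin; last exact: bmf_event.
transitivity (\int[P]_w (\1_[set w | B w] w)%:E)%E.
  by apply: eq_integral => w _; rewrite indicE mem_setE.
by rewrite integral_indic// setIT.
Qed.

Lemma event_cst b : event (fun=> b).
Proof. by case: b; rewrite /event; [rewrite set_true|rewrite set_false]. Qed.

Lemma eventI (B C : Omega -> bool) : event B -> event C -> event (fun w => B w && C w).
Proof.
move=> mB mC; rewrite /event (_ : [set w | B w && C w] = [set w | B w] `&` [set w | C w]).
  exact: measurableI.
by rewrite eqEsubset; split => w /= => [/andP//|[-> ->]].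
Qed.

Lemma eventU (B C : Omega -> bool) : event B -> event C -> event (fun w => B w || C w).
Proof.
move=> mB mC; rewrite /event (_ : [set w | B w || C w] = [set w | B w] `|` [set w | C w]).
  exact: measurableU.
by rewrite eqEsubset; split => w /= => [/orP//|[->|->]]; rewrite ?orbT.
Qed.

Lemma eventN (B : Omega -> bool) : event B -> event (fun w => ~~ B w).
Proof.
move=> mB; rewrite /event (_ : [set w | ~~ B w] = ~` [set w | B w]).
  exact: measurableC.
by rewrite eqEsubset; split => w /= /negP.
Qed.

Lemma event_all (T : Type) (s : seq T) (B : T -> Omega -> bool) :
  (forall t, event (B t)) -> event (fun w => all (fun t => B t w) s).
Proof. by move=> mB; elim: s => [|t s IHs] /=; [exact: event_cst|exact: eventI]. Qed.

Lemma event_forall (T : finType) (B : T -> Omega -> bool) :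
  (forall t, event (B t)) -> event (fun w => [forall t, B t w]).
Proof.
move=> mB; rewrite (_ : (fun w => _) = fun w => all (fun t => B t w) (enum T)).
  exact: event_all.
apply/funext => w; apply/forallP/allP => h t //.
by apply: h; rewrite mem_enum.
Qed.

End Expectation.

(** * Finite patterns of the random graph *)

Section Law.
Context d (Omega : measurableType d) (R : realType) (P : probability Omega R).
Context (Gamma : graph_limit R) (A : Omega -> rel nat).

Definition contains_copy (F : sgraph) (w : Omega) : bool :=
  [forall x : 'I_(nverts F), forall y : 'I_(nverts F), edge x y ==> A w x y].

Section Kernel.
Hypotheses (Asym : forall w, symmetric (A w))
  (Ameas : forall i j, measurable [set w | A w i j]).
Context dS (S : measurableType dS) (mu : probability S R) (W : S -> S -> R)
  (X : nat -> {RV P >-> S}).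
Hypotheses (Wrep : represents mu W Gamma) (Xiid : iid mu X)
  (Aind : edges_cond_indep W X A).

Let W01 x y : 0 <= W x y <= 1. Proof. by have [[]] := Wrep. Qed.

Lemma bmf_W i j : bmf (fun w => W (X i w) (X j w)).
Proof.
have [[_ _ mW] _] := Wrep; split.
  have mX : measurable_fun setT (fun w => (X i w, X j w)).
    by apply: measurable_fun_pair; exact: measurable_funP.
  exact: measurableT_comp mW mX.
by exists 1 => w; have /andP[W0 W1] := W01 (X i w) (X j w); rewrite ger0_norm.
Qed.

Section Graph.
Variable F : sgraph.
Let n := nverts F.
Let pairs : finType := ('I_n * 'I_n)%type.

Let cyl (f : {ffun pairs -> bool}) w :=
  [forall p : pairs, (p.1 < p.2)%N ==> (A w p.1 p.2 == f p)].

Let GW (p : pairs) (b : bool) w : R := if (p.1 < p.2)%N then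
  (if b then W (X p.1 w) (X p.2 w) else 1 - W (X p.1 w) (X p.2 w)) else 1.

Lemma event_cyl f : event (cyl f).
Proof.
apply: event_forall => p; under eq_fun do rewrite implybE.
apply: eventU; first exact: event_cst.
case: (f p); first by under eq_fun do rewrite eqb_id; exact: Ameas.
by under eq_fun do rewrite eqbF_neg; apply: eventN; exact: Ameas.
Qed.

Lemma bmf_GW p b : bmf (GW p b).
Proof.
rewrite /GW; case: (p.1 < p.2)%N; last exact: bmf_cst.
case: b; first exact: bmf_W.
by apply: bmfD; [exact: bmf_cst|apply: bmfN; exact: bmf_W].
Qed.

Lemma prod_lt_pairs (g : nat -> nat -> R) :
  \prod_(j < n) \prod_(i < j) g i j = \prod_(p : pairs | (p.1 < p.2)%N) g p.1 p.2.
Proof.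
rewrite -(pair_big_dep xpredT (fun i j : 'I_n => (i < j)%N) (fun i j : 'I_n => g i j))/=.
rewrite (exchange_big_dep xpredT)//=; apply: eq_bigr => j _.
by rewrite (big_ord_widen n (fun i => g i j))// ltnW.
Qed.

(** The conditional law of the edges, used with the whole probability space as
    the conditioning event. *)
Lemma cyl_law f : Ex P (fun w => (cyl f w)%:R) = Ex P (fun w => \prod_p GW p (f p) w).
Proof.
pose e : rel nat := fun i j =>
  if (insub i : option 'I_n) is Some x then
    if (insub j : option 'I_n) is Some y then f (x, y) else false else false.
have ordK (z : 'I_n) : insub (z : nat) = Some z by exact: valK.
have eE (x y : 'I_n) : e x y = f (x, y) by rewrite /e !ordK.
have sT : sigma_seq X [set: Omega] by rewrite -setC0; apply: sigma_algebraC; exact: sigma_algebra0.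
have := Aind n e sT; rewrite setTI => h.
have bG : bmf (fun w => \prod_p GW p (f p) w).
  by apply: bmf_prod => p; exact: bmf_GW.
apply: EFin_inj; rewrite Ex_event; last exact: event_cyl.
rewrite Ex_fin//.
have -> : [set w | cyl f w] = [set w | forall i j, (i < j < n)%N -> A w i j = e i j].
  rewrite eqEsubset; split => w /=.
    move=> /forallP cw i j /andP[ij jn].
    have := cw (Ordinal (ltn_trans ij jn), Ordinal jn); rewrite /= ij /= => /eqP ->.
    by rewrite -eE.
  move=> cw; apply/forallP => p; apply/implyP => p12; apply/eqP.
  by rewrite cw ?p12/= ?ltn_ord// eE -surjective_pairing.
rewrite h; apply: eq_integral => w _; congr EFin.
rewrite (prod_lt_pairs (fun i j => if e i j then W (X i w) (X j w) else 1 - W (X i w) (X j w))).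
rewrite big_mkcond; apply: eq_bigr => p _; rewrite /GW.
by case: ifP => // _; rewrite eE -surjective_pairing.
Qed.

(** Summing the product law over the adjacency patterns that contain [F] leaves
    only the factors of the edges of [F], since the two weights of a free pair
    add up to one. *)
Lemma contains_copy_kernel : Ex P (fun w => (contains_copy F w)%:R) = lim_density Gamma F.
Proof.
pose D (p : pairs) : pred bool := fun b =>
  if (p.1 < p.2)%N then edge p.1 p.2 ==> b else ~~ b.
have contE w : (contains_copy F w)%:R = \sum_(f in family D) ((cyl f w)%:R : R).
  pose f0 : {ffun pairs -> bool} := [ffun p : pairs => (p.1 < p.2)%N && A w p.1 p.2].
  have cylE f : f \in family D -> cyl f w = (f == f0).
    move=> /familyP fD; apply/forallP/eqP => [cf|-> p]; last first.
      by apply/implyP => p12; rewrite ffunE p12.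
    apply/ffunP => p; rewrite ffunE; have := cf p; have : D p (f p) := fD p.
    by rewrite /D; case: (p.1 < p.2)%N => /= [_ /eqP ->//|/negPf -> _].
  rewrite (eq_bigr (fun f => (f == f0)%:R : R)); last by move=> f /cylE ->.
  have -> : contains_copy F w = (f0 \in family D).
    apply/'forall_forallP/familyP => [c p|fD x y].
      change (D p (f0 p)); rewrite ffunE /D; case: (p.1 < p.2)%N => //=; exact: c.
    apply/implyP => xy; have [xley|ylex|/val_inj xey] := ltngtP x y.
    - have : D (x, y) (f0 (x, y)) := fD (x, y); rewrite ffunE /D /= xley /=.
      by move=> /implyP; apply.
    - have : D (y, x) (f0 (y, x)) := fD (y, x); rewrite ffunE /D /= ylex /= Asym edge_sym.
      by move=> /implyP; apply.
    - by rewrite xey edge_irr in xy.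
  case: (boolP (f0 \in family D)) => f0D.
    by rewrite (bigD1 f0)//= eqxx big1 ?addr0// => f /andP[_ /negPf ->].
  by rewrite big1// => f fD; case: eqP => // ff0; rewrite -ff0 fD in f0D.
under eq_fun do rewrite contE.
rewrite Ex_sum; last by move=> f; apply: bmf_event; exact: event_cyl.
under eq_bigr do rewrite cyl_law.
rewrite -Ex_sum; last by move=> f; apply: bmf_prod => p; exact: bmf_GW.
have prodE w : \sum_(f in family D) \prod_p GW p (f p) w =
    \prod_(p : pairs | (p.1 < p.2)%N && edge p.1 p.2) W (X p.1 w) (X p.2 w).
  rewrite -(bigA_distr_big_dep D (fun p b => GW p b w)) [RHS]big_mkcond.
  apply: eq_bigr => p _; rewrite big_mkcond big_bool /D /GW /=.
  case: (p.1 < p.2)%N => /=; last by rewrite add0r.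
  by case: (edge p.1 p.2); rewrite /= ?addr0// addrC subrK.
under eq_fun do rewrite prodE.
have [_ /(_ F) kd] := Wrep; apply: EFin_inj; rewrite kd Ex_fin; last first.
  by apply: bmf_prod => p; exact: bmf_W.
rewrite /kernel_density -(integral_window Xiid 0).
- by apply: eq_integral => w _; congr EFin; apply: eq_bigr => p _; rewrite !tnth_mktuple !add0n.
- have [[_ _ mW] _] := Wrep.
  apply/measurable_EFinP; under eq_fun do rewrite big_mkcond/=.
  apply: measurable_prod => p _; case: (_ && _) => //.
  have mt : measurable_fun setT (fun x : (nverts F).-tuple S => (tnth x p.1, tnth x p.2)).
    by apply: measurable_fun_pair; exact: measurable_tnth.
  exact: measurableT_comp mW mt.
- by move=> t; rewrite lee_fin; apply: prodr_ge0 => p _; case/andP: (W01 (tnth t p.1) (tnth t p.2)).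
Qed.

End Graph.
End Kernel.

Hypothesis A_G_infty : is_G_infty P Gamma A.

Lemma event_edge i j : event (fun w => A w i j).
Proof. by case: A_G_infty => _ _ + _; apply. Qed.

Lemma contains_copy_law F : Ex P (fun w => (contains_copy F w)%:R) = lim_density Gamma F.
Proof.
case: A_G_infty => As _ Am [dS [S [mu [W [X [WG Xi Ae]]]]]].
exact: (contains_copy_kernel As Am WG Xi Ae).
Qed.

Section Sample.
Context (Gn : nat -> sgraph).
Hypothesis GnP : forall F, hom_density R F (Gn n) @[n --> \oo] --> lim_density Gamma F.

Section Placed.
Context (I : finType) (iota : I -> nat) (iotaI : injective iota) (F : {set I * I}).
Hypothesis Fl : loopless F.

Let N := (\max_(x : I) iota x).+1.
Let place x : 'I_N := Ordinal (leq_bigmax x : (iota x < N)%N).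

Let placed_edge : rel 'I_N := fun i j => [exists p in F,
  ((place p.1 == i) && (place p.2 == j)) || ((place p.1 == j) && (place p.2 == i))].

Let placed_sym : symmetric placed_edge.
Proof. by move=> i j; apply: eq_existsb => p; rewrite orbC. Qed.

Let placeI : injective place.
Proof. by move=> x y /(congr1 val)/iotaI. Qed.

Let placed_irr : irreflexive placed_edge.
Proof.
move=> i; apply/negbTE/exists_inP => -[p pF]; rewrite orbb => /andP[/eqP <- /eqP].
move=> /placeI p21; move/forallP: Fl => /(_ p.1)/negP; apply.
by rewrite -{2}p21 -surjective_pairing.
Qed.

(** The pattern [F] drawn on the labels [iota]; the labels that are not used
    become isolated vertices, which do not change densities. *)
Definition placed : sgraph := SGraph (ltn0Sn _) placed_sym placed_irr.

Lemma placed_hom (G : sgraph) : hom_density R placed G = pat_density (@unif R G) (@edge G) F.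
Proof.
rewrite hom_densityE /pat_density -(mean_marginal (unif_prob_weight R G) _ placeI).
apply: eq_mean => h; congr (_%:R); congr nat_of_bool; rewrite /is_hom.
apply/'forall_forallP/patP => /= [hom p pF|hF x y].
  rewrite !ffunE; have /implyP := hom (place p.1) (place p.2); apply.
  by apply/exists_inP; exists p => //; rewrite !eqxx.
apply/implyP => /exists_inP[p pF] /orP[] /andP[/eqP <- /eqP <-].
  by have := hF p pF; rewrite !ffunE.
by have := hF p pF; rewrite !ffunE edge_sym.
Qed.

Lemma placed_copy (e : rel nat) : symmetric e ->
  [forall x : 'I_(nverts placed), forall y : 'I_(nverts placed), edge x y ==> e x y] =
  (F \subset [set p | e (iota p.1) (iota p.2)]%SET).
Proof.
move=> es; apply/'forall_forallP/fintype.subsetP => /= [hom p pF|hF x y].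
  rewrite inE; have /implyP := hom (place p.1) (place p.2); apply.
  by apply/exists_inP; exists p => //; rewrite !eqxx.
apply/implyP => /exists_inP[p pF] /orP[] /andP[/eqP <- /eqP <-].
  by have := hF p pF; rewrite inE.
by have := hF p pF; rewrite inE es.
Qed.

End Placed.

Section Pattern.
Context (I : finType) (I0 : (0 < #|I|)%N) (iota : I -> nat) (iotaI : injective iota).

Definition sample_pat (w : Omega) : {set I * I} :=
  [set p | A w (iota p.1) (iota p.2)]%SET.

Lemma event_sub_pat (F : {set I * I}) : event (fun w => F \subset sample_pat w).
Proof.
have eE w : (F \subset sample_pat w) = [forall p, (p \in F) ==> A w (iota p.1) (iota p.2)].
  apply/fintype.subsetP/forallP => FA p.
    by apply/implyP => /FA; rewrite inE.
  by move=> pF; rewrite inE; have := FA p; rewrite pF.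
under eq_fun do rewrite eE.
apply: event_forall => p; under eq_fun do rewrite implybE.
by apply: eventU; [exact: event_cst|exact: event_edge].
Qed.

Lemma sub_pat_law (F : {set I * I}) :
  Ex P (fun w => (F \subset sample_pat w)%:R) = lim_pat_density I0 F Gamma.
Proof.
case: A_G_infty => As Ai _ _; rewrite /lim_pat_density; case: (boolP (loopless F)) => Fl; last first.
  move/forallPn: Fl => [x]; rewrite negbK => xF.
  rewrite -[RHS](Ex_cst P 0); congr Ex; apply/funext => w.
  suff /negPf -> : ~~ (F \subset sample_pat w) by [].
  by apply/negP => /fintype.subsetP/(_ _ xF); rewrite inE Ai.
have c2 := @GnP (sgraph_of I0 F).
have e12 n : hom_density R (placed iotaI Fl) (Gn n) = hom_density R (sgraph_of I0 F) (Gn n).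
  by rewrite placed_hom sgraph_ofE.
have c1 : hom_density R (sgraph_of I0 F) (Gn n) @[n --> \oo] -->
    lim_density Gamma (placed iotaI Fl).
  by under eq_fun do rewrite -e12; exact: GnP.
rewrite -(cvg_unique _ c1 c2)// -contains_copy_law; congr Ex; apply/funext => w.
by rewrite /contains_copy placed_copy.
Qed.

(** Finite patterns of the random graph, read along any list of distinct
    vertices, are distributed as in large random samples of [Gn]. *)
Lemma pattern_law (phi : {set I * I} -> R) :
  mean (@unif R (Gn n)) (fun h => phi (pat (@edge (Gn n)) h)) @[n --> \oo] -->
  Ex P (fun w => phi (sample_pat w)).
Proof.
have [c cP] := mobius phi.
have cP' H : phi H = \sum_(F : {set I * I} | (F \subset H) && xpredT F) c F.
  by rewrite cP; apply: eq_bigl => F; rewrite andbT.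
have -> : Ex P (fun w => phi (sample_pat w)) = \sum_(F : {set I * I}) c F * lim_pat_density I0 F Gamma.
  have bF (F : {set I * I}) : bmf (fun w => (F \subset sample_pat w)%:R : R).
    by apply: bmf_event; exact: event_sub_pat.
  under eq_bigr => F _ do rewrite -sub_pat_law -(ExZ _ _ (bF F)).
  rewrite -Ex_sum; last by move=> F; exact: bmfZ.
  congr Ex; apply/funext => w; rewrite cP big_mkcond; apply: eq_bigr => F _.
  by case: ifP => _; rewrite ?mulr1 ?mulr0.
exact: (cvg_mean_pat (@GnP) cP').
Qed.

Lemma bmf_pattern (phi : {set I * I} -> R) : bmf (fun w => phi (sample_pat w)).
Proof.
have [c cP] := mobius phi; under eq_fun do rewrite cP big_mkcond.
apply: bmf_sum => F.
rewrite (_ : (fun w => _) = fun w => c F * (F \subset sample_pat w)%:R).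
  by apply: bmfZ; apply: bmf_event; exact: event_sub_pat.
by apply/funext => w; case: ifP => _; rewrite ?mulr1 ?mulr0.
Qed.

End Pattern.

(** Disjoint coordinates of a sample of [Gn] are independent, and this passes to
    the limit. *)
Lemma pattern_indep (I : finType) (I0 : (0 < #|I|)%N) (i1 i2 : I -> nat)
    (phi1 phi2 : {set I * I} -> R) :
  injective i1 -> injective i2 -> (forall x y, i1 x != i2 y) ->
  Ex P (fun w => phi1 (sample_pat i1 w) * phi2 (sample_pat i2 w)) =
  Ex P (fun w => phi1 (sample_pat i1 w)) * Ex P (fun w => phi2 (sample_pat i2 w)).
Proof.
move=> i1I i2I i12.
pose iota (j : I + I) := match j with inl x => i1 x | inr x => i2 x end.
have iotaI : injective iota.
  case=> [a|a] [b|b] /= ab; [by rewrite (i1I _ _ ab)| | |by rewrite (i2I _ _ ab)].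
    by have := i12 a b; rewrite ab eqxx.
  by have := i12 b a; rewrite ab eqxx.
have II0 : (0 < #|{: I + I}|)%N by rewrite card_sum addn_gt0 I0.
pose sub (k : I -> I + I) (H : {set (I + I) * (I + I)}) : {set I * I} :=
  [set p | (k p.1, k p.2) \in H]%SET.
have sub1 w : sub inl (sample_pat iota w) = sample_pat i1 w.
  by apply/setP => p; rewrite !inE.
have sub2 w : sub inr (sample_pat iota w) = sample_pat i2 w.
  by apply/setP => p; rewrite !inE.
have c1 := @pattern_law I I0 i1 i1I phi1.
have c2 := @pattern_law I I0 i2 i2I phi2.
have c := @pattern_law _ II0 iota iotaI (fun H => phi1 (sub inl H) * phi2 (sub inr H)).
have -> : Ex P (fun w => phi1 (sample_pat i1 w) * phi2 (sample_pat i2 w)) =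
    Ex P (fun w => phi1 (sub inl (sample_pat iota w)) * phi2 (sub inr (sample_pat iota w))).
  by congr Ex; apply/funext => w; rewrite sub1 sub2.
apply: (cvg_unique _ c _) => //.
have e n : mean (@unif R (Gn n)) (fun h : {ffun I + I -> _} =>
    phi1 (sub inl (pat (@edge (Gn n)) h)) * phi2 (sub inr (pat (@edge (Gn n)) h))) =
  mean (@unif R (Gn n)) (fun h : {ffun I -> _} => phi1 (pat (@edge (Gn n)) h)) *
  mean (@unif R (Gn n)) (fun h : {ffun I -> _} => phi2 (pat (@edge (Gn n)) h)).
  rewrite -(mean_indep (unif_prob_weight R (Gn n)) (i1 := inl) (i2 := inr)
    (fun h => phi1 (pat (@edge (Gn n)) h)) (fun h => phi2 (pat (@edge (Gn n)) h)))//.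
    apply: eq_mean => h; congr (phi1 _ * phi2 _);
      by apply/setP => p; rewrite !inE /= !ffunE.
  - by move=> ? ? [].
  - by move=> ? ? [].
apply: cvg_trans (cvgM c1 c2); apply: near_eq_cvg; apply: filterE => n.
exact/esym/e.
Qed.

End Sample.
End Law.

(** * Ties in the random graph *)

Section DominatedConvergence.
Context d (Omega : measurableType d) (R : realType) (P : probability Omega R).

Lemma Ex_cvg (f : nat -> Omega -> R) (g : Omega -> R) (C : R) :
  (forall n, bmf (f n)) -> bmf g -> (forall n w, `|f n w| <= C) ->
  (forall w, f n w @[n --> \oo] --> g w) ->
  Ex P (f n) @[n --> \oo] --> Ex P g.
Proof.
move=> bf bg fC fg.
have mf n : measurable_fun setT (EFin \o f n) by apply/measurable_EFinP; have [] := bf n.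
have mg : measurable_fun setT (EFin \o g) by apply/measurable_EFinP; have [] := bg.
have fg' : {ae P, forall w, setT w -> (EFin \o f n) w @[n --> \oo] --> (EFin \o g) w}.
  by apply: aeW => w _; apply: cvg_EFin (fg w); exact: filterE.
have fC' : {ae P, forall w n, setT w -> (`|(EFin \o f n) w| <= (EFin \o cst C) w)%E}.
  by apply: aeW => w n _; rewrite /= lee_fin.
have [_ _] := dominated_convergence measurableT mf mg fg' (bmf_integrable P (bmf_cst _ C)) fC'.
rewrite -(Ex_fin P bg) => h; suff : (Ex P (f n))%:E @[n --> \oo] --> (Ex P g)%:E.
  by move=> /fine_cvgP[].
by under eq_fun do rewrite Ex_fin//.
Qed.

End DominatedConvergence.

Section Component.
Variable e : rel nat.
Hypothesis es : symmetric e.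

Lemma component_refl i : component e i i.
Proof. by exists [::]. Qed.

Lemma component_trans i j k : component e i j -> component e j k -> component e i k.
Proof.
move=> [s ps sj] [t pt tk]; exists (s ++ t); last by rewrite last_cat sj.
by rewrite cat_path ps sj.
Qed.

Lemma component_sym i j : component e i j -> component e j i.
Proof.
move=> [s]; elim: s i => [i _ /= ->|k s IHs i /=]; first exact: component_refl.
move=> /andP[ik ps] sj; apply: component_trans (IHs k ps sj) _.
by exists [:: i] => //=; rewrite es ik.
Qed.

Lemma component_eq i j : component e i j -> component e i = component e j.
Proof.
move=> ij; rewrite eqEsubset; split => k; first exact/component_trans/component_sym.
exact: component_trans.
Qed.

Definition tie i j : bool := `[< component e i j >].

Lemma tieP i j : reflect (component e i j) (tie i j).
Proof. exact: asboolP. Qed.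

Lemma tie_refl i : tie i i. Proof. by apply/tieP; exact: component_refl. Qed.

Lemma tie_sym i j : tie i j = tie j i.
Proof. by apply/tieP/tieP; exact: component_sym. Qed.

Lemma tie_trans i j k : tie i j -> tie j k -> tie i k.
Proof. by move=> /tieP ij /tieP jk; apply/tieP; exact: component_trans jk. Qed.

Definition tied (K : seq nat) : bool := all (fun x => all (tie x) K) K.

Lemma tiedP K : reflect {in K &, forall x y, tie x y} (tied K).
Proof.
apply: (iffP allP) => [h x y xK yK|h x xK]; first by have /allP := h x xK; apply.
by apply/allP => y yK; exact: h.
Qed.

Lemma linked_tie (I : finType) (iota : I -> nat) x y :
  linked [set p | e (iota p.1) (iota p.2)]%SET x y -> tie (iota x) (iota y).
Proof.
move=> /connectP[s ps ->]; apply/tieP; exists (map iota s); last by rewrite last_map.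
elim: s x ps => //= z s IHs x /andP[xz zs]; rewrite IHs// andbT.
by move: xz; rewrite !inE /= es orbb es.
Qed.

(** A path has finitely many vertices, so every large enough window shows it. *)
Lemma tie_linked x y : tie x y -> exists m0 : nat, forall m (lx : (x < m)%N) (ly : (y < m)%N),
  (m0 <= m)%N -> linked [set p : 'I_m * 'I_m | e p.1 p.2]%SET (Ordinal lx) (Ordinal ly).
Proof.
move=> /tieP[s ps sy]; exists (\max_(z <- s) z).+1 => m lx ly sm.
elim: s x lx ps sy sm => [|z s IHs] x lx /=.
  move=> _ xy _; rewrite (_ : Ordinal lx = Ordinal ly); first exact: connect0.
  exact: val_inj.
move=> /andP[xz zs] sy; rewrite big_cons => sm.
have lz : (z < m)%N by apply: leq_trans sm; rewrite ltnS leq_maxl.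
apply: (connect_trans (y := Ordinal lz)); first by apply: connect1; rewrite /= !inE /= xz.
by apply: IHs => //; apply: leq_trans sm; rewrite ltnS leq_maxr.
Qed.

Lemma near_all (K : seq nat) (Q : nat -> nat -> Prop) :
  (forall x, x \in K -> exists m0, forall m, (m0 <= m)%N -> Q x m) ->
  exists m0, forall m, (m0 <= m)%N -> forall x, x \in K -> Q x m.
Proof.
elim: K => [|y K IHK] h; first by exists 0%N.
have [m1 m1P] := h y (mem_head _ _).
have [|m2 m2P] := IHK; first by move=> x xK; apply: h; rewrite inE xK orbT.
exists (maxn m1 m2) => m; rewrite geq_max => /andP[m1m m2m] x.
by rewrite inE => /predU1P[->|xK]; [exact: m1P|exact: m2P].
Qed.

Definition below_set (K : seq nat) m : {set 'I_m} := [set x : 'I_m | (x : nat) \in K]%SET.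

Lemma tied_joins K : tied K -> exists m0 : nat, forall m, (m0 <= m)%N ->
  joins (below_set K m) [set p : 'I_m * 'I_m | e p.1 p.2]%SET.
Proof.
move=> /tiedP KT.
have [|m0 m0P] := @near_all K (fun x m => forall y, y \in K ->
    forall (lx : (x < m)%N) (ly : (y < m)%N),
    linked [set p : 'I_m * 'I_m | e p.1 p.2]%SET (Ordinal lx) (Ordinal ly)).
  move=> x xK; apply: (@near_all K (fun y m => forall (lx : (x < m)%N) (ly : (y < m)%N),
    linked [set p : 'I_m * 'I_m | e p.1 p.2]%SET (Ordinal lx) (Ordinal ly))) => y yK.
  have [m0 m0P] := tie_linked (KT x y xK yK).
  by exists m0 => m mm lx ly; exact: m0P.
exists m0 => m mm; apply/joinsP => -[x lx] [y ly]; rewrite !inE /= => xK yK.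
exact: m0P.
Qed.

Lemma joins_tied (I : finType) (iota : I -> nat) (K : {set I}) (L : seq nat) :
  (forall x, x \in L -> exists2 i, i \in K & iota i = x) ->
  joins K [set p | e (iota p.1) (iota p.2)]%SET -> tied L.
Proof.
move=> LK /joinsP KJ; apply/tiedP => x y /LK[i iK <-] /LK[j jK <-].
by apply: linked_tie; exact: KJ.
Qed.

End Component.

Section Ties.
Context d (Omega : measurableType d) (R : realType) (P : probability Omega R).
Context (Gamma : graph_limit R) (M : option nat) (alpha : nat -> R)
  (Gam : nat -> graph_limit R) (A : Omega -> rel nat).
Hypotheses (alpha_gt0 : forall i, below M i -> 0 < alpha i)
  (alpha_sum : (\sum_(0 <= i <oo | below M i) (alpha i)%:E <= 1)%E)
  (Gam_connected : forall i, below M i -> connected_limit (Gam i))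
  (Gamma_decomp : is_direct_sum M alpha Gam Gamma)
  (A_G_infty : is_G_infty P Gamma A).

Let As w : symmetric (A w). Proof. by case: A_G_infty. Qed.

Lemma event_path (s : seq nat) i : event (fun w => path (A w) i s).
Proof.
elim: s i => [|j s IHs] i /=; first exact: event_cst.
by apply: eventI => //; exact: (event_edge A_G_infty).
Qed.

(** Two vertices are tied by one of countably many paths. *)
Lemma event_tie i j : event (fun w => tie (A w) i j).
Proof.
have [dec decP] : exists dec : nat -> seq nat, forall s, dec (pickle s) = s.
  by exists (fun n => odflt [::] (unpickle n)) => s; rewrite pickleK.
rewrite /event; have -> : [set w | tie (A w) i j] =
    \bigcup_(n in [set: nat]) [set w | path (A w) i (dec n) && (last i (dec n) == j)].
  rewrite eqEsubset; split => w.
    move=> /tieP[s ps sj]; exists (pickle s) => //.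
    by rewrite /mkset decP ps sj eqxx.
  by move=> [n _ /andP[ps /eqP sj]]; apply/tieP; exists (dec n).
apply: bigcup_measurable => n _.
by apply: (eventI (event_path (dec n) i)); exact: event_cst.
Qed.

Lemma event_tied K : event (fun w => tied (A w) K).
Proof. by apply: event_all => x; apply: event_all => y; exact: event_tie. Qed.

Context (k : nat) (S : R).
Hypotheses (k1 : (1 < k)%N)
  (Slim : \sum_(i < N) weight M alpha i ^+ k @[N --> \oo] --> S).

Let Jn (I : finType) (iota : I -> nat) (K : {set I}) w : R :=
  (joins K (sample_pat A iota w))%:R.

Lemma bmf_joins (I : finType) (iota : I -> nat) (K : {set I}) : bmf (Jn iota K).
Proof. exact: (bmf_pattern A_G_infty iota (fun H => (joins K H)%:R : R)). Qed.

Lemma joins_prob eps : 0 < eps -> exists m0 : nat,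
  forall (I : finType) (iota : I -> nat) (K : {set I}), injective iota ->
    (m0 <= #|I|)%N -> #|K| = k -> S - eps <= Ex P (Jn iota K) <= S.
Proof.
move=> e0; have [Gn [_ GnP]] := lim_densityP Gamma.
have [m0 m0P] := join_limit alpha_gt0 alpha_sum Gam_connected Gamma_decomp k1 GnP Slim e0.
exists m0 => I iota K iotaI mI Kk; have [J [J1 J2 cJ]] := m0P I K mI Kk.
have I0 : (0 < #|I|)%N by apply: leq_trans (max_card (mem K)); rewrite Kk ltnW.
have cE := @pattern_law _ _ _ _ _ _ A_G_infty Gn GnP I I0 iota iotaI (fun H => (joins K H)%:R).
have -> : Ex P (Jn iota K) = J by exact: (cvg_unique _ cE cJ).
by rewrite J1.
Qed.

(** Growing windows detect more and more ties, so the probability of being tied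
    is the limit of the probabilities of being joined within a window. *)
Lemma tied_prob (K : seq nat) : uniq K -> size K = k ->
  Ex P (fun w => (tied (A w) K)%:R) = S.
Proof.
move=> uK sK.
have bT : bmf (fun w => (tied (A w) K)%:R : R) by apply: bmf_event; exact: event_tied.
pose J m := Jn (@nat_of_ord m) (below_set K m).
pose m1 := (\max_(x <- K) x).+1.
have Km x m : (m1 <= m)%N -> x \in K -> (x < m)%N.
  by move=> mm xK; apply: leq_trans mm; rewrite ltnS; apply: leq_bigmax_seq.
have cK m : (m1 <= m)%N -> #|below_set K m| = k.
  move=> mm; rewrite -sK cardE -(size_map val); apply/perm_size/uniq_perm => //.
    by rewrite (map_inj_uniq val_inj) enum_uniq.
  move=> x; apply/mapP/idP => [[y]|xK]; first by rewrite mem_enum inE => yK ->.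
  by exists (Ordinal (Km x m mm xK)); rewrite ?mem_enum ?inE.
have Jle m w : (m1 <= m)%N -> J m w <= (tied (A w) K)%:R.
  move=> mm; rewrite /J /Jn ler_nat.
  case: (boolP (joins _ _)) => // /(joins_tied (As w) (L := K)) -> // x xK.
  by exists (Ordinal (Km x m mm xK)); rewrite ?inE.
have cJ : Ex P (fun w => J (m + m1)%N w) @[m --> \oo] --> Ex P (fun w => (tied (A w) K)%:R).
  apply: (@Ex_cvg _ _ _ P (fun m => J (m + m1)%N) _ 1) => //.
  - by move=> m; exact: bmf_joins.
  - by move=> m w; rewrite /J /Jn normr_nat lern1 leq_b1.
  move=> w; case: (boolP (tied (A w) K)) => TK.
    have [m0 m0P] := tied_joins TK.
    apply: cvg_near_cst; exists m0 => // m /= mm; rewrite /J /Jn.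
    by rewrite (m0P (m + m1)%N (leq_trans mm (leq_addr _ _))).
  apply: cvg_near_cst; exists 0%N => // m _; apply/eqP; rewrite eq_le.
  by have := Jle (m + m1)%N w (leq_addl _ _); rewrite (negPf TK) => ->; rewrite /J /Jn ler0n.
have bound eps : 0 < eps -> S - eps <= Ex P (fun w => (tied (A w) K)%:R) <= S.
  move=> e0; have [m0 m0P] := joins_prob e0.
  have JP m : (m0 <= m)%N -> S - eps <= Ex P (fun w => J (m + m1)%N w) <= S.
    move=> mm; apply: m0P; [exact: val_inj| |by rewrite cK ?leq_addl].
    by rewrite card_ord (leq_trans mm)// leq_addr.
  apply/andP; split; [apply: (cvgr_to_ge cJ)|apply: (cvgr_to_le cJ)];
    by exists m0 => // m /= /JP/andP[].
apply/eqP; rewrite eq_le; have /andP[_ ->] /= := bound 1 ltr01.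
by apply/ler_addgt0Pr => eps e0; have /andP[+ _] := bound eps e0; rewrite lerBlDr.
Qed.

Lemma bool_mul_le (b c : bool) (x y : R) :
  0 <= x -> x <= 1 -> 0 <= y -> y <= 1 -> x <= b%:R -> y <= c%:R ->
  b%:R * c%:R <= x * y + (b%:R + - x + (c%:R + - y)).
Proof.
move=> x0 x1 y0 y1 xb yc.
have xy0 : 0 <= x * y by rewrite mulr_ge0.
have : 0 <= (1 - x) * (1 - y) by rewrite mulr_ge0// subr_ge0.
rewrite mulrBl mul1r mulrBr mulr1; move: (x * y) xy0 => z z0 h.
by case: b xb; case: c yc => /= yc xb; lra.
Qed.

Lemma close_products (x y z eps : R) : S - eps / 2 <= x -> S - eps / 2 <= y ->
  z <= S ^+ 2 -> z + (S - x + (S - y)) <= S ^+ 2 + eps.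
Proof. by move: (S ^+ 2) => q *; lra. Qed.

(** Each of two disjoint groups is joined within its own private supply of extra
    vertices with probability close to that of being tied, and the two supplies
    are independent. *)
Lemma tied_prob2 (K L : seq nat) : uniq (K ++ L) -> size K = k -> size L = k ->
  Ex P (fun w => (tied (A w) K)%:R * (tied (A w) L)%:R) <= S ^+ 2.
Proof.
rewrite cat_uniq => /and3P[uK KL uL] sK sL; apply/ler_addgt0Pr => eps e0.
have e20 : 0 < eps / 2 by rewrite divr_gt0.
have [m0 m0P] := joins_prob e20.
have bT Q : bmf (fun w => (tied (A w) Q)%:R : R) by apply: bmf_event; exact: event_tied.
pose m := (m0 + k)%N; pose B := (\max_(x <- K ++ L) x).+1.
have Bx x : x \in K ++ L -> (x < B)%N by move=> xK; rewrite ltnS; apply: leq_bigmax_seq.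
(* The first [k] indices go to the group itself, the others to labels beyond
   [B], even ones for [K] and odd ones for [L]. *)
pose io (Q : seq nat) (b : bool) (x : 'I_m) :=
  if (x < k)%N then nth 0%N Q x else ((B + x).*2 + b)%N.
have ioI Q b : uniq Q -> size Q = k -> {subset Q <= K ++ L} -> injective (io Q b).
  move=> uQ sQ QKL x y; rewrite /io; case: ltnP => xk; case: ltnP => yk.
  - by move/eqP; rewrite nth_uniq ?sQ// => /eqP /val_inj.
  - have := Bx _ (QKL _ (mem_nth 0%N (s := Q) (n := x) _)); rewrite sQ => /(_ xk).
    by move=> + E; rewrite E; move=> h; exfalso; lia.
  - have := Bx _ (QKL _ (mem_nth 0%N (s := Q) (n := y) _)); rewrite sQ => /(_ yk).
    by move=> + E; rewrite -E; move=> h; exfalso; lia.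
  - by move=> E; apply: val_inj => /=; lia.
pose Km : {set 'I_m} := [set x : 'I_m | (x < k)%N]%SET.
have cKm : #|Km| = k.
  have -> : Km = widen_ord (leq_addl m0 k) @: predT.
    apply/setP => x; rewrite inE; apply/idP/imsetP => [xk|[y _ ->]]; last by rewrite /= ltn_ord.
    by exists (Ordinal xk) => //; apply: val_inj.
  by rewrite card_imset ?card_ord//; move=> x y /(congr1 val) /= /val_inj.
pose J1 := Jn (io K false) Km; pose J2 := Jn (io L true) Km.
have sKL : {subset K <= K ++ L} by move=> x; rewrite mem_cat => ->.
have sLL : {subset L <= K ++ L} by move=> x; rewrite mem_cat => ->; rewrite orbT.
have i1I := ioI K false uK sK sKL; have i2I := ioI L true uL sL sLL.
have i12 x y : io K false x != io L true y.
  apply/negP => /eqP; rewrite /io; case: ltnP => xk; case: ltnP => yk.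
  - move=> E; move/hasPn: KL => /(_ (nth 0%N L y)).
    by rewrite -{2}E !mem_nth ?sK ?sL// => /(_ isT).
  - have := Bx _ (sKL _ (mem_nth 0%N (s := K) (n := x) _)); rewrite sK => /(_ xk).
    by move=> + E; rewrite E; move=> h; exfalso; lia.
  - have := Bx _ (sLL _ (mem_nth 0%N (s := L) (n := y) _)); rewrite sL => /(_ yk).
    by move=> + E; rewrite -E; move=> h; exfalso; lia.
  - by move=> E; lia.
have JT Q b w : size Q = k -> Jn (io Q b) Km w <= (tied (A w) Q)%:R.
  move=> sQ; rewrite /Jn ler_nat.
  case: (boolP (joins _ _)) => // /(joins_tied (As w) (L := Q)) -> // x xQ.
  have xk : (index x Q < k)%N by rewrite -sQ index_mem.
  exists (widen_ord (leq_addl m0 k) (Ordinal xk)); first by rewrite inE.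
  by rewrite /io /= xk nth_index.
have mI : (m0 <= #|'I_m|)%N by rewrite card_ord leq_addr.
have /andP[l1 u1] : S - eps / 2 <= Ex P J1 <= S by exact: m0P.
have /andP[l2 u2] : S - eps / 2 <= Ex P J2 <= S by exact: m0P.
have bJ1 : bmf J1 by exact: bmf_joins.
have bJ2 : bmf J2 by exact: bmf_joins.
have [Gn [_ GnP]] := lim_densityP Gamma.
have m0' : (0 < #|'I_m|)%N by rewrite card_ord addn_gt0 (ltnW k1) orbT.
have ind : Ex P (fun w => J1 w * J2 w) = Ex P J1 * Ex P J2.
  exact: (@pattern_indep _ _ _ _ _ _ A_G_infty Gn GnP _ m0' _ _
    (fun H => (joins Km H)%:R) (fun H => (joins Km H)%:R) i1I i2I i12).
have J0 (io' : 'I_m -> nat) w : 0 <= Jn io' Km w <= 1 by rewrite /Jn ler0n lern1 leq_b1.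
have Ex0 : 0 <= Ex P J1.
  rewrite -(Ex_cst P 0); apply: le_Ex => //; exact: bmf_cst.
have Ex0' : 0 <= Ex P J2.
  rewrite -(Ex_cst P 0); apply: le_Ex => //; exact: bmf_cst.
have le : Ex P (fun w => (tied (A w) K)%:R * (tied (A w) L)%:R) <=
    Ex P (fun w => J1 w * J2 w + (((tied (A w) K)%:R + - J1 w) + ((tied (A w) L)%:R + - J2 w))).
  apply: le_Ex; first exact: bmfM.
    by apply: bmfD; [exact: bmfM|apply: bmfD; apply: bmfD => //; exact: bmfN].
  move=> w; have /andP[a0 a1] := J0 (io K false) w; have /andP[b0 b1] := J0 (io L true) w.
  have := JT K false w sK; have := JT L true w sL; rewrite -/(J1 w) -/(J2 w).
  rewrite -/(J1 w) in a0 a1; rewrite -/(J2 w) in b0 b1.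
  by move=> h2 h1; exact: bool_mul_le.
apply: le_trans le _; rewrite ExD; first last.
- by apply: bmfD; apply: bmfD => //; exact: bmfN.
- exact: bmfM.
rewrite ExD; [|by apply: bmfD => //; exact: bmfN|by apply: bmfD => //; exact: bmfN].
rewrite !ExD//; try exact: bmfN.
rewrite !ExN// ind !tied_prob//.
have h : Ex P J1 * Ex P J2 <= S ^+ 2 by rewrite expr2; exact: ler_pM Ex0 Ex0' u1 u2.
exact: close_products l1 l2 h.
Qed.

End Ties.

(** * Almost sure summability *)

Section AlmostSure.
Context d (Omega : measurableType d) (R : realType) (P : probability Omega R).

Lemma sum_inv_sqr n : \sum_(j < n) (j.+1%:R ^- 2 : R) <= 2.
Proof.
suff h m : \sum_(j < m.+1) (j.+1%:R ^- 2 : R) <= 2 - m.+1%:R^-1.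
  case: n => [|n]; first by rewrite big_ord0.
  by apply: le_trans (h n) _; rewrite gerBl invr_ge0.
elim: m => [|m IHm]; first by rewrite big_ord1 /= expr1n invr1; lra.
rewrite big_ord_recr /=; apply: (@le_trans _ _ (2 - m.+1%:R^-1 + m.+2%:R ^- 2)).
  by rewrite lerD2r.
have m1 : (0 : R) < m.+1%:R by [].
have m2 : (m.+2%:R : R) = m.+1%:R + 1 by rewrite -natr1.
rewrite m2; set x : R := m.+1%:R in m1 *.
have -> : 2 - (x + 1)^-1 = 2 - x^-1 + (x * (x + 1))^-1.
  by field; apply/andP; split; rewrite gt_eqF// addr_gt0.
rewrite lerD2l lef_pV2 ?posrE ?exprn_gt0 ?mulr_gt0 ?addr_gt0//.
by rewrite expr2 ler_wpM2r ?lerDl// addr_ge0// ltW.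
Qed.

(** The integral of the sum is finite by monotone convergence, and then the sum
    is finite almost everywhere. *)
Lemma ae_summable (h : nat -> Omega -> \bar R) (C : R) :
  (forall j, measurable_fun [set: Omega] (h j)) -> (forall j w, 0 <= h j w)%E ->
  (forall j, \int[P]_w h j w <= (C * j.+1%:R ^- 2)%:E)%E ->
  {ae P, forall w, (\sum_(j <oo) h j w < +oo)%E}.
Proof.
move=> mh h0 hC.
have ms : measurable_fun [set: Omega] (fun w => (\sum_(j <oo) h j w)%E).
  by apply: ge0_emeasurable_sum => // j w _ _; exact: h0.
have sP : P.-integrable setT (fun w => (\sum_(j <oo) h j w)%E).
  apply/integrableP; split => //.
  under eq_integral do rewrite gee0_abs ?nneseries_ge0//.
  rewrite integral_nneseries//.
  apply: (@le_lt_trans _ _ (`|C| * 2)%:E); last by rewrite ltry.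
  apply: lime_le; first by apply: is_cvg_nneseries => n _ _; exact: integral_ge0.
  apply: nearW => n; rewrite big_mkord.
  apply: (@le_trans _ _ (\sum_(j < n) (C * j.+1%:R ^- 2)%:E)%E); first exact: lee_sum.
  rewrite sumEFin lee_fin -big_distrr/=.
  apply: (@le_trans _ _ (`|C| * \sum_(j < n) j.+1%:R ^- 2)).
    by apply: ler_wpM2r; [apply: sumr_ge0 => j _; rewrite invr_ge0 exprn_ge0|exact: ler_norm].
  by rewrite ler_wpM2l// sum_inv_sqr.
have [N [mN PN NP]] := integrable_ae measurableT sP.
exists N; split => // w nw; apply: NP => /= /(_ Logic.I) fw; apply: nw.
by rewrite /= ltey; move: fw; rewrite fin_numE => /andP[].
Qed.

Lemma summable_series (f : nat -> R) : (forall j, 0 <= f j) ->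
  (\sum_(j <oo) (f j)%:E < +oo)%E -> cvgn (series f).
Proof.
move=> f0 sf; apply: nondecreasing_is_cvgn.
  by apply/nondecreasing_seqP => n; rewrite !seriesEnat/= big_nat_recr//= lerDl.
exists (fine (\sum_(j <oo) (f j)%:E)%E) => _ [n _ <-].
rewrite -lee_fin fineK; last first.
  by rewrite ge0_fin_numE// nneseries_ge0// => j _ _; rewrite lee_fin.
rewrite seriesEnat /= -sumEFin; apply: nneseries_lim_ge => j _ _.
by rewrite lee_fin.
Qed.

Lemma ae_summable_real (f : nat -> Omega -> R) (C : R) :
  (forall j, bmf (f j)) -> (forall j w, 0 <= f j w) ->
  (forall j, Ex P (f j) <= C * j.+1%:R ^- 2) ->
  {ae P, forall w, cvgn (series (fun j => f j w))}.
Proof.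
move=> bf f0 fC.
have [||| N [mN PN NP]] := @ae_summable (fun j w => (f j w)%:E) C.
- by move=> j; apply/measurable_EFinP; have [] := bf j.
- by move=> j w; rewrite lee_fin.
- by move=> j; rewrite -Ex_fin// lee_fin.
exists N; split => // w nw; apply: NP => /= sw; apply: nw.
exact: summable_series.
Qed.

End AlmostSure.

(** * Moments of tie frequencies *)

Section SecondMoments.
Context d (Omega : measurableType d) (R : realType) (P : probability Omega R).
Context (Gamma : graph_limit R) (M : option nat) (alpha : nat -> R)
  (Gam : nat -> graph_limit R) (A : Omega -> rel nat).
Hypotheses (alpha_gt0 : forall i, below M i -> 0 < alpha i)
  (alpha_sum : (\sum_(0 <= i <oo | below M i) (alpha i)%:E <= 1)%E)
  (Gam_connected : forall i, below M i -> connected_limit (Gam i))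
  (Gamma_decomp : is_direct_sum M alpha Gam Gamma)
  (A_G_infty : is_G_infty P Gamma A).
Context (S : nat -> R).
Hypothesis SP : forall k, (1 < k)%N ->
  \sum_(i < N) weight M alpha i ^+ k @[N --> \oo] --> S k.

Let As w : symmetric (A w). Proof. by case: A_G_infty. Qed.

Lemma tied_probS (K : seq nat) : uniq K -> (1 < size K)%N ->
  Ex P (fun w => (tied (A w) K)%:R) = S (size K).
Proof.
move=> uK K1.
exact: (tied_prob alpha_gt0 alpha_sum Gam_connected Gamma_decomp A_G_infty K1 (SP K1)).
Qed.

Definition tie_ind i j w : R := (tie (A w) i j)%:R.

Lemma bmf_tie_ind i j : bmf (tie_ind i j).
Proof. by apply: bmf_event; exact: (event_tie A_G_infty). Qed.

Lemma tie_ind01 i j w : 0 <= tie_ind i j w <= 1.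
Proof. by rewrite /tie_ind ler0n lern1 leq_b1. Qed.

Lemma Ex01 f : bmf f -> (forall w, 0 <= f w <= 1) -> 0 <= Ex P f <= 1.
Proof.
move=> bf f01; apply/andP; split.
  rewrite -[leLHS](Ex_cst P 0); apply: le_Ex => //; first exact: bmf_cst.
  by move=> w; have /andP[] := f01 w.
rewrite -[leRHS](Ex_cst P 1); apply: le_Ex => //; first exact: bmf_cst.
by move=> w; have /andP[] := f01 w.
Qed.

Lemma Ex_tie_ind2 i j l : uniq [:: i; j; l] ->
  Ex P (fun w => tie_ind i j w * tie_ind i l w) = S 3.
Proof.
move=> u; rewrite -(tied_probS u)//; congr Ex; apply/funext => w.
rewrite /tie_ind -natrM mulnb; congr (_%:R); congr nat_of_bool.
apply/andP/tiedP => [[ij il]|h]; last first.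
  by split; apply: h; rewrite !in_cons eqxx ?orbT.
have ii := tie_refl (A w) i.
have ti x : x \in [:: i; j; l] -> tie (A w) i x.
  by move: x; apply/allP; rewrite /= ii ij il.
by move=> x y /ti ix /ti iy; apply: tie_trans iy; rewrite tie_sym.
Qed.

Lemma S3_itv : 0 <= S 3 <= 1.
Proof.
rewrite -(@Ex_tie_ind2 0 1 2)//; apply: Ex01; first by apply: bmfM; exact: bmf_tie_ind.
move=> w; have /andP[a0 a1] := tie_ind01 0 1 w; have /andP[b0 b1] := tie_ind01 0 2 w.
by rewrite mulr_ge0//= mulr_ile1.
Qed.

(** Two ties at [i] have the joint probability [S 3] for any distinct indices;
    coefficients with sum zero cancel this common value, and only coinciding
    indices contribute. *)
Lemma second_moment (b : nat -> R) m i (beta : R) :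
  (forall j, (j < m)%N -> `|b j| <= beta) -> \sum_(j < m) b j = 0 ->
  \sum_(j < m) `|b j| <= 2 -> 0 <= beta ->
  Ex P (fun w => (\sum_(j < m) b j * tie_ind i j w) ^+ 2) <= 6 * beta.
Proof.
move=> bb b0 b2 beta0.
pose c j l := Ex P (fun w => tie_ind i j w * tie_ind i l w).
have -> : Ex P (fun w => (\sum_(j < m) b j * tie_ind i j w) ^+ 2) =
    \sum_(j < m) \sum_(l < m) b j * b l * c j l.
  transitivity (Ex P (fun w => \sum_(j < m) \sum_(l < m)
      (b j * b l) * (tie_ind i j w * tie_ind i l w))).
    congr Ex; apply/funext => w; rewrite expr2 big_distrlr; apply: eq_bigr => j _.
    by apply: eq_bigr => l _; rewrite mulrACA.
  have bt j l : bmf (fun w => tie_ind i j w * tie_ind i l w) by apply: bmfM; exact: bmf_tie_ind.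
  rewrite Ex_sum; last by move=> j; apply: bmf_sum => l; exact: bmfZ.
  apply: eq_bigr => j _; rewrite Ex_sum; last by move=> l; exact: bmfZ.
  by apply: eq_bigr => l _; rewrite ExZ.
have -> : \sum_(j < m) \sum_(l < m) b j * b l * c j l =
    \sum_(j < m) \sum_(l < m) b j * b l * (c j l - S 3).
  apply/eqP; rewrite -subr_eq0 -sumrB; apply/eqP.
  transitivity (\sum_(j < m) b j * (\sum_(l < m) b l * S 3)).
    apply: eq_bigr => j _; rewrite -sumrB big_distrr; apply: eq_bigr => l _ /=.
    by rewrite -mulrBr opprB addrC subrK mulrA.
  by rewrite big1// => j _; rewrite -big_distrl/= b0 mul0r mulr0.
(* Counts the coincidences among [i], [j], [l]. *)
pose D (j l : nat) : R := (j == l)%:R + (j == i)%:R + (l == i)%:R.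
have cD j l : `|c j l - S 3| <= D j l.
  have D0 : 0 <= D j l by rewrite !addr_ge0.
  case: (boolP (uniq [:: i; j; l])) => [u|].
    by rewrite /c Ex_tie_ind2// subrr normr0.
  move=> nu; apply: (@le_trans _ _ 1).
    have /andP[c0 c1] : 0 <= c j l <= 1.
      apply: Ex01; first by apply: bmfM; exact: bmf_tie_ind.
      move=> w; have /andP[a0 a1] := tie_ind01 i j w; have /andP[e0 e1] := tie_ind01 i l w.
      by rewrite mulr_ge0//= mulr_ile1.
    have /andP[s0 s1] := S3_itv; rewrite ler_norml; apply/andP; split.
      by rewrite lerBrDr (le_trans _ c0)// addrC subr_le0.
    by rewrite lerBlDr (le_trans c1)// lerDl.
  rewrite /D; move: nu; rewrite /= !in_cons !in_nil !orbF !andbT (eq_sym i j) (eq_sym i l).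
  by case: (j == i); case: (l == i); case: (j == l) => //= _; lra.
have S1 : \sum_(j < m) \sum_(l < m) `|b j| * `|b l| * (j == l :> nat)%:R <= 2 * beta.
  apply: (@le_trans _ _ (\sum_(j < m) `|b j| * beta)).
    apply: ler_sum => j _; rewrite (bigD1 j)//= eqxx mulr1 big1 ?addr0.
      by rewrite ler_wpM2l// bb.
    by move=> l lj; rewrite eq_sym (negPf (lj : (l : nat) != j)) mulr0.
  by rewrite -big_distrl/= ler_wpM2r.
have one : \sum_(j < m) `|b j| * (j == i :> nat)%:R <= beta.
  have [im|mi] := ltnP i m; last first.
    by rewrite big1// => j _; rewrite ltn_eqF ?mulr0// (leq_trans _ mi).
  rewrite (bigD1 (Ordinal im))//= eqxx mulr1 big1 ?addr0 ?bb// => j ji.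
  by rewrite (negPf (ji : (j : nat) != i)) mulr0.
have S2 : \sum_(j < m) \sum_(l < m) `|b j| * `|b l| * (j == i :> nat)%:R <= 2 * beta.
  have -> : \sum_(j < m) \sum_(l < m) `|b j| * `|b l| * (j == i :> nat)%:R =
      (\sum_(l < m) `|b l|) * (\sum_(j < m) `|b j| * (j == i :> nat)%:R).
    rewrite mulrC big_distrlr; apply: eq_bigr => j _; apply: eq_bigr => l _.
    by rewrite /= mulrAC.
  by apply: ler_pM => //; apply: sumr_ge0 => j _; rewrite // mulr_ge0.
have S3 : \sum_(j < m) \sum_(l < m) `|b j| * `|b l| * (l == i :> nat)%:R <= 2 * beta.
  have -> : \sum_(j < m) \sum_(l < m) `|b j| * `|b l| * (l == i :> nat)%:R =
      (\sum_(j < m) `|b j|) * (\sum_(l < m) `|b l| * (l == i :> nat)%:R).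
    rewrite big_distrlr; apply: eq_bigr => j _; apply: eq_bigr => l _.
    by rewrite /= mulrA.
  by apply: ler_pM => //; apply: sumr_ge0 => j _; rewrite // mulr_ge0.
apply: (@le_trans _ _ (\sum_(j < m) \sum_(l < m) `|b j| * `|b l| * D j l)).
  apply: ler_sum => j _; apply: ler_sum => l _; apply: le_trans (ler_norm _) _.
  by rewrite !normrM ler_wpM2l// mulr_ge0.
have -> : \sum_(j < m) \sum_(l < m) `|b j| * `|b l| * D j l =
   \sum_(j < m) \sum_(l < m) `|b j| * `|b l| * (j == l :> nat)%:R +
   \sum_(j < m) \sum_(l < m) `|b j| * `|b l| * (j == i :> nat)%:R +
   \sum_(j < m) \sum_(l < m) `|b j| * `|b l| * (l == i :> nat)%:R.
  rewrite -!big_split; apply: eq_bigr => j _; rewrite -!big_split; apply: eq_bigr => l _.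
  by rewrite /= /D !mulrDr.
by apply: le_trans (lerD (lerD S1 S2) S3) _; lra.
Qed.

Definition tie_freq i n w : R := (\sum_(j < n) tie_ind i j w) / n%:R.

Lemma bmf_tie_freq i n : bmf (tie_freq i n).
Proof.
have := bmfZ n%:R^-1 (bmf_sum (index_enum 'I_n) xpredT (fun j => bmf_tie_ind i j)).
congr bmf; apply/funext => w; exact: mulrC.
Qed.

Lemma tie_freq_second_moment i n m : (0 < n)%N -> (n <= m)%N ->
  Ex P (fun w => (tie_freq i n w - tie_freq i m w) ^+ 2) <= 6 * n%:R^-1.
Proof.
move=> n0 nm.
have nR : (0 : R) < n%:R by rewrite ltr0n.
have mR : (0 : R) < m%:R by rewrite ltr0n (leq_trans n0).
have mn : (m%:R^-1 : R) <= n%:R^-1 by rewrite lef_pV2 ?posrE// ler_nat.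
pose b j : R := (j < n)%:R * n%:R^-1 - m%:R^-1.
have sn (g : nat -> R) : \sum_(j < m) (j < n)%:R * g j = \sum_(j < n) g j.
  rewrite (big_ord_widen m g nm) [RHS]big_mkcond; apply: eq_bigr => j _.
  by case: ifP; rewrite ?mul1r ?mul0r.
have frE w : tie_freq i n w - tie_freq i m w = \sum_(j < m) b j * tie_ind i j w.
  rewrite /b; under eq_bigr do rewrite mulrBl.
  rewrite sumrB -big_distrr/= /tie_freq [X in _ - X]mulrC; congr (_ - _).
  under eq_bigr do rewrite -mulrA.
  by rewrite (sn (fun j => n%:R^-1 * tie_ind i j w)) -big_distrr/= mulrC.
under [X in Ex P X]eq_fun do rewrite frE.
apply: second_moment; last by rewrite invr_ge0.
- move=> j _; rewrite /b; case: (j < n)%N.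
    by rewrite mul1r ger0_norm ?subr_ge0// gerBl invr_ge0.
  by rewrite mul0r sub0r normrN ger0_norm ?invr_ge0.
- rewrite /b sumrB (sn (fun=> n%:R^-1)) !sumr_const !card_ord.
  by rewrite -[n%:R^-1 *+ n]mulr_natl -[m%:R^-1 *+ m]mulr_natl !divff ?gt_eqF// subrr.
- apply: (@le_trans _ _ (\sum_(j < m) ((j < n)%:R * n%:R^-1 + m%:R^-1))).
    apply: ler_sum => j _; apply: le_trans (ler_normB _ _) _.
    by rewrite !ger0_norm ?mulr_ge0 ?invr_ge0.
  rewrite big_split/= (sn (fun=> n%:R^-1)) !sumr_const !card_ord.
  by rewrite -[n%:R^-1 *+ n]mulr_natl -[m%:R^-1 *+ m]mulr_natl !divff ?gt_eqF//; lra.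
Qed.

(** The inequality [2 * |x| <= c * x ^ 2 + c ^ -1] plays the role of
    Cauchy-Schwarz. *)
Lemma tie_freq_first_moment i n m c : (0 < n)%N -> (n <= m)%N -> 0 < c -> c ^+ 2 <= n%:R ->
  Ex P (fun w => `|tie_freq i n w - tie_freq i m w|) <= 4 * c^-1.
Proof.
move=> n0 nm c0 cn.
have bd : bmf (fun w => tie_freq i n w - tie_freq i m w).
  by apply: bmfD; [exact: bmf_tie_freq|apply: bmfN; exact: bmf_tie_freq].
apply: (@le_trans _ _ (Ex P (fun w => c / 2 * (tie_freq i n w - tie_freq i m w) ^+ 2 + c^-1 / 2))).
  apply: le_Ex; first exact: bmf_norm.
    by apply: bmfD; [apply: bmfZ; exact: bmfX|exact: bmf_cst].
  move=> w; set x := tie_freq i n w - tie_freq i m w; rewrite -[x ^+ 2](real_normK (num_real x)).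
  move: `|x| => y.
  have : 0 <= (c * y - 1) ^+ 2 * c^-1 by rewrite mulr_ge0 ?sqr_ge0// invr_ge0 ltW.
  have -> : (c * y - 1) ^+ 2 * c^-1 = c * y ^+ 2 - 2 * y + c^-1.
    by field; rewrite gt_eqF.
  have -> : c / 2 * y ^+ 2 = c * y ^+ 2 / 2 by rewrite mulrAC.
  by move: (c^-1) (c * y ^+ 2) => u v h; lra.
rewrite ExD; [|by apply: bmfZ; exact: bmfX|exact: bmf_cst].
rewrite Ex_cst ExZ; last exact: bmfX.
have h := tie_freq_second_moment i n0 nm.
have ci : n%:R^-1 <= c^-1 ^+ 2.
  by rewrite exprVn lef_pV2 ?posrE ?exprn_gt0// ltr0n.
have : c / 2 * Ex P (fun w => (tie_freq i n w - tie_freq i m w) ^+ 2) <= c / 2 * (6 * c^-1 ^+ 2).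
  rewrite ler_wpM2l ?divr_ge0 ?(ltW c0)//; apply: le_trans h _.
  by rewrite ler_wpM2l.
have -> : c / 2 * (6 * c^-1 ^+ 2) = 3 * c^-1 by field; rewrite gt_eqF.
have c1 : 0 < c^-1 by rewrite invr_gt0.
by move: (c / 2 * _) (c^-1) c1 => x y y0 *; lra.
Qed.


Section PowerMeans.
Context (r : nat) (r0 : (0 < r)%N).

Definition power_mean n w : R := (\sum_(i < n) tie_freq i n w ^+ r) / n%:R.

Lemma bmf_power_mean n : bmf (power_mean n).
Proof.
have h (i : 'I_n) : bmf (fun w => tie_freq i n w ^+ r) by apply: bmfX; exact: bmf_tie_freq.
have := bmfZ n%:R^-1 (bmf_sum (index_enum 'I_n) xpredT h).
by congr bmf; apply/funext => w; exact: mulrC.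
Qed.

Let I : finType := option 'I_r.

Section FixedSize.
Context (n : nat) (n0 : (0 < n)%N).

Let wt : 'I_n -> R := fun=> n%:R^-1.

Let wtP : prob_weight wt.
Proof.
split=> [t|]; first by rewrite invr_ge0.
by rewrite sumr_const card_ord -[_ *+ n]mulr_natl divff// pnatr_eq0 -lt0n.
Qed.

Definition vertex_list (h : {ffun I -> 'I_n}) : seq nat := [seq (h x : nat) | x <- enum I].

Let star (h : {ffun I -> 'I_n}) w : R := \prod_(x < r) tie_ind (h None) (h (Some x)) w.

Lemma size_vlist h : size (vertex_list h) = r.+1.
Proof. by rewrite size_map -cardE card_option card_ord. Qed.

Lemma starE h w : star h w = (tied (A w) (vertex_list h))%:R.
Proof.
have -> : star h w = [forall x, tie (A w) (h None) (h (Some x))]%:R.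
  case: (boolP [forall x, _]) => [/forallP hx|/forallPn[x hx]].
    by rewrite /star big1// => x _; rewrite /tie_ind hx.
  by rewrite /star (bigD1 x)//= /tie_ind (negPf hx) mul0r.
congr (_%:R); congr nat_of_bool; apply/forallP/tiedP => [hx|h' x].
  have h0 (y : I) : tie (A w) (h None) (h y) by case: y => [y|]; [exact: hx|exact: tie_refl].
  move=> _ _ /mapP[x _ ->] /mapP[y _ ->].
  by apply: tie_trans (h0 y); rewrite tie_sym.
by apply: h'; apply: map_f; rewrite mem_enum.
Qed.

Lemma bmf_star h : bmf (star h).
Proof. by apply: bmf_prod => x; exact: bmf_tie_ind. Qed.

Lemma star01 h w : 0 <= star h w <= 1.
Proof. by rewrite starE ler0n lern1 leq_b1. Qed.

(** The [r]-th power of a frequency is the probability that [r] random vertices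
    are tied to the centre of a star; averaging over the centre [None] gives a
    mean over [r.+1] random vertices. *)
Lemma power_meanE w : power_mean n w = mean wt (fun h : {ffun I -> 'I_n} => star h w).
Proof.
pose F (t : 'I_n) (h : {ffun I -> 'I_n}) := \prod_(x < r) tie_ind t (h (Some x)) w.
rewrite -[RHS]/(mean wt (fun h : {ffun I -> 'I_n} => F (h None) h)).
rewrite (mean_coord wtP); last first.
  by move=> s h h' hh'; apply: eq_bigr => x _; rewrite hh'.
rewrite -big_distrr/= mulrC; congr (_ * _); apply: eq_bigr => i _.
have -> : mean wt (F i) = mean wt (fun g : {ffun 'I_r -> 'I_n} => \prod_(x < r) tie_ind i (g x) w).
  rewrite -(mean_marginal wtP (iota := @Some 'I_r)); last by move=> ? ? [].
  by apply: eq_mean => h; apply: eq_bigr => x _; rewrite ffunE.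
transitivity (\sum_(g : {ffun 'I_r -> 'I_n}) \prod_(x < r) (wt (g x) * tie_ind i (g x) w)).
  rewrite -(bigA_distr_bigA (fun (x : 'I_r) (t : 'I_n) => wt t * tie_ind i t w))/=.
  rewrite prodr_const card_ord; congr (_ ^+ _).
  by rewrite -big_distrr/= mulrC.
by apply: eq_bigr => g _; rewrite big_split.
Qed.

Lemma Ex_star h : uniq (vertex_list h) -> Ex P (star h) = S r.+1.
Proof.
move=> u; rewrite -(size_vlist h) -tied_probS ?size_vlist//.
by congr Ex; apply/funext => w; rewrite starE.
Qed.

Lemma Ex_star2 h h' : uniq (vertex_list h ++ vertex_list h') ->
  Ex P (fun w => star h w * star h' w) <= S r.+1 ^+ 2.
Proof.
move=> u; have r1 : (1 < r.+1)%N by [].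
have := tied_prob2 alpha_gt0 alpha_sum Gam_connected Gamma_decomp A_G_infty r1
  (SP r1) u (size_vlist h) (size_vlist h').
by under eq_fun do rewrite -!starE.
Qed.

Lemma S_itv : 0 <= S r.+1 <= 1.
Proof.
have u : uniq (iota 0 r.+1) by exact: iota_uniq.
have := tied_probS u; rewrite size_iota => <- //.
apply: Ex01; first by apply: bmf_event; exact: (event_tied A_G_infty).
by move=> w; rewrite ler0n lern1 leq_b1.
Qed.

Lemma collision (J : finType) (x y : J) : x != y ->
  mean wt (fun h : {ffun J -> 'I_n} => (h x == h y)%:R) = n%:R^-1.
Proof.
move=> xy; pose f (s : seq 'I_n) : R := if s is [:: u; v] then (u == v)%:R else 0.
rewrite -[LHS]/(mean wt (fun h : {ffun J -> 'I_n} => f (map h [:: x; y]))).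
rewrite mean_itavg//=; last by rewrite inE xy.
transitivity (\sum_u wt u * n%:R^-1); last first.
  by case: wtP => _ w1; rewrite -big_distrl/= w1 mul1r.
apply: eq_bigr => u _.
congr (_ * _); rewrite (bigD1 u)//= eqxx mulr1 big1 ?addr0// => v vu.
by rewrite eq_sym (negPf vu) mulr0.
Qed.

Lemma collisions (J : finType) :
  mean wt (fun h : {ffun J -> 'I_n} => (~~ injectiveb h)%:R) <= #|J|%:R ^+ 2 / n%:R.
Proof.
apply: (@le_trans _ _ (mean wt (fun h : {ffun J -> 'I_n} =>
    \sum_(x : J) \sum_(y : J | x != y) (h x == h y)%:R))).
  apply: le_mean => // h; case: (boolP (injectiveb h)) => [_|/injectivePn[x [y xy hxy]]].
    by apply: sumr_ge0 => x _; apply: sumr_ge0.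
  rewrite (bigD1 x)//= (bigD1 y)//= hxy eqxx -addrA lerDl addr_ge0 ?sumr_ge0//.
  by move=> z _; apply: sumr_ge0.
rewrite mean_sum expr2 -mulrA mulr_natl -sumr_const; apply: ler_sum => x _.
rewrite mean_sum mulr_natl -sumr_const big_mkcond; apply: ler_sum => y _.
by case: ifP => xy; rewrite ?collision// invr_ge0.
Qed.

Lemma vlist_uniq (H : {ffun I + I -> 'I_n}) : injectiveb H ->
  uniq (vertex_list [ffun x => H (inl x)] ++ vertex_list [ffun x => H (inr x)]).
Proof.
move=> /injectiveP HI; rewrite cat_uniq; apply/and3P; split.
- by rewrite map_inj_uniq ?enum_uniq// => x y /val_inj; rewrite !ffunE => /HI [].
- apply/hasPn => _ /mapP[y _ ->]; apply/negP => /mapP[x _] /val_inj.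
  by rewrite !ffunE => /HI.
- by rewrite map_inj_uniq ?enum_uniq// => x y /val_inj; rewrite !ffunE => /HI [].
Qed.

(** Stars on distinct vertices have nonpositive covariance. *)
Lemma centred_pair (H : {ffun I + I -> 'I_n}) :
  Ex P (fun w => (star [ffun x => H (inl x)] w - S r.+1) *
    (star [ffun x => H (inr x)] w - S r.+1)) <=
  (~~ injectiveb H)%:R.
Proof.
set s := S r.+1; set h := [ffun x => H (inl x)]; set h' := [ffun x => H (inr x)].
have bs g : bmf (fun w => star g w - s) by apply: bmfD; [exact: bmf_star|exact: bmf_cst].
have [HI|_] := boolP (injectiveb H); last first.
  rewrite /= -[leRHS](Ex_cst P 1); apply: le_Ex; [exact: bmfM|exact: bmf_cst|].
  have /andP[s0 s1] : 0 <= s <= 1 := S_itv.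
  have a1 g w : `|star g w - s| <= 1.
    have /andP[g0 g1] := star01 g w; rewrite ler_norml; apply/andP; split.
      by rewrite lerBrDr (le_trans _ g0)// addrC subr_le0.
    by rewrite lerBlDr (le_trans g1)// lerDl.
  by move=> w; apply: le_trans (ler_norm _) _; rewrite normrM mulr_ile1.
have u := vlist_uniq HI; have := u; rewrite cat_uniq => /and3P[u1 _ u2].
have e1 := Ex_star u1; have e2 := Ex_star u2; have e12 := Ex_star2 u.
rewrite -/h -/h' in e1 e2 e12.
have -> : Ex P (fun w => (star h w - s) * (star h' w - s)) =
    Ex P (fun w => star h w * star h' w) - s ^+ 2.
  transitivity (Ex P (fun w => star h w * star h' w + (- s * (star h w + star h' w) + s ^+ 2))).
    by congr Ex; apply/funext => w; ring.
  have bh := bmf_star h; have bh' := bmf_star h'.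
  rewrite ExD; [|exact: bmfM|by apply: bmfD; [apply: bmfZ; exact: bmfD|exact: bmf_cst]].
  rewrite ExD; [|by apply: bmfZ; exact: bmfD|exact: bmf_cst].
  rewrite ExZ ?ExD//; last exact: bmfD.
  by rewrite Ex_cst e1 e2 -/s; move: (Ex _ _) => z; ring.
by rewrite subr_le0.
Qed.

(** The square is a mean over two independent stars, which share or repeat a
    vertex with probability of order [1 / n]. *)
Lemma power_mean_second_moment :
  Ex P (fun w => (power_mean n w - S r.+1) ^+ 2) <= (2 * r.+1%:R) ^+ 2 / n%:R.
Proof.
set s := S r.+1.
pose D (H : {ffun I + I -> 'I_n}) w :=
  (star [ffun x => H (inl x)] w - s) * (star [ffun x => H (inr x)] w - s).
have bD H : bmf (D H).
  by apply: bmfM; (apply: bmfD; [exact: bmf_star|exact: bmf_cst]).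
have -> : Ex P (fun w => (power_mean n w - s) ^+ 2) = Ex P (fun w => mean wt (fun H => D H w)).
  congr Ex; apply/funext => w; rewrite expr2 power_meanE.
  have -> : mean wt (fun h => star h w) - s = mean wt (fun h => star h w - s).
    by rewrite meanD (mean_cst wtP).
  rewrite -(mean_indep wtP (i1 := @inl I I) (i2 := @inr I I)
    (fun h => star h w - s) (fun h => star h w - s))//.
  - by move=> ? ? [].
  - by move=> ? ? [].
have -> : Ex P (fun w => mean wt (fun H => D H w)) = mean wt (fun H => Ex P (D H)).
  rewrite /mean Ex_sum; last by move=> H; exact: bmfZ.
  by apply: eq_bigr => H _; rewrite ExZ.
apply: le_trans (le_mean wtP (fun H => centred_pair H)) _.
apply: le_trans (collisions _) _.
by rewrite card_sum card_option card_ord addnn -mul2n natrM.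
Qed.

End FixedSize.
End PowerMeans.
End SecondMoments.

(** * Averages along fourth powers *)

Section Interpolation.
Context (R : realType).

(** Along fourth powers, errors of order [n ^ (- 1 / 2)] are summable, while the
    ratios of consecutive terms still tend to [1]. *)
Definition fourth (j : nat) : nat := (j.+1 ^ 4)%N.

Lemma fourth_gt0 j : (0 < fourth j)%N. Proof. by rewrite expn_gt0. Qed.

Lemma leq_fourth i j : (i <= j)%N -> (fourth i <= fourth j)%N.
Proof. by move=> ij; rewrite leq_exp2r. Qed.

Lemma fourthR j : (fourth j)%:R = (j.+1%:R ^+ 2) ^+ 2 :> R.
Proof. by rewrite /fourth natrX -exprM. Qed.

Lemma fourth_oo : fourth j @[j --> \oo] --> \oo.
Proof.
apply/cvgnyPge => N; exists N => // j /= Nj; apply: leq_trans Nj _.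
by apply: leq_trans (leqnSn j) _; rewrite -{1}(expn1 j.+1); exact: leq_pexp2l.
Qed.

Definition avg (t : nat -> R) n : R := (\sum_(j < n) t j) / n%:R.

Lemma avg_close (t : nat -> R) m n : (forall j, 0 <= t j <= 1) -> (0 < m)%N ->
  (m <= n)%N -> `|avg t n - avg t m| <= 2 * (n - m)%:R / m%:R.
Proof.
move=> t01 m0 mn.
have mR : (0 : R) < m%:R by rewrite ltr0n.
have nR : (0 : R) < n%:R by rewrite ltr0n (leq_trans m0).
have sum_le p : \sum_(j < p) t j <= p%:R.
  rewrite -[leRHS](_ : \sum_(j < p) 1 = p%:R); last by rewrite sumr_const card_ord.
  by apply: ler_sum => j _; have /andP[] := t01 j.
have sum_ge0 p : 0 <= \sum_(j < p) t j.
  by apply: sumr_ge0 => j _; have /andP[] := t01 j.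
pose a := \sum_(j < m) t j; pose b := \sum_(j < n - m) t (m + j)%N.
have b0 : 0 <= b by apply: sumr_ge0 => j _; have /andP[] := t01 (m + j)%N.
have bl : b <= (n - m)%:R.
  rewrite -[leRHS](_ : \sum_(j < n - m) 1 = (n - m)%:R); last by rewrite sumr_const card_ord.
  by apply: ler_sum => j _; have /andP[] := t01 (m + j)%N.
have nE : n%:R = m%:R + (n - m)%:R :> R by rewrite -natrD subnKC.
have sE : \sum_(j < m + (n - m)) t j = a + b by rewrite big_split_ord.
rewrite subnKC// in sE.
have -> : avg t n - avg t m = b / n%:R - (a / m%:R) * ((n - m)%:R / n%:R).
  rewrite /avg sE -/a; move: nR mR; rewrite nE => nR mR.
  by field; rewrite !gt_eqF.
set dd : R := (n - m)%:R in nE bl *; have dd0 : 0 <= dd by [].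
have am : a / m%:R <= 1 by rewrite ler_pdivrMr// mul1r sum_le.
have am0 : 0 <= a / m%:R by apply: mulr_ge0; [exact: sum_ge0|rewrite invr_ge0 ltW].
have dn : dd / n%:R <= dd / m%:R.
  by rewrite ler_wpM2l// lef_pV2 ?posrE// ler_nat.
have dn0 : 0 <= dd / n%:R by rewrite mulr_ge0// invr_ge0 ltW.
have bn : b / n%:R <= dd / n%:R by rewrite ler_wpM2r// invr_ge0 ltW.
have bn0 : 0 <= b / n%:R by rewrite mulr_ge0// invr_ge0 ltW.
have p0 : 0 <= a / m%:R * (dd / n%:R) by rewrite mulr_ge0.
have p1 : a / m%:R * (dd / n%:R) <= dd / n%:R by rewrite ler_piMl.
rewrite -(mulrA 2).
move: (dd / n%:R) (dd / m%:R) (a / _ * _) (b / _) bn bn0 p0 p1 dn dn0 => z u y x *.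
by rewrite ler_norml; apply/andP; split; lra.
Qed.

Lemma fourth_between n : (0 < n)%N -> exists j, (fourth j <= n < fourth j.+1)%N.
Proof.
elim: n => // -[_ _|n IHn _]; first by exists 0%N.
have [//|j /andP[jn nj]] := IHn.
have [lt|ge] := ltnP n.+2 (fourth j.+1); first by exists j; rewrite lt (leq_trans jn).
exists j.+1; rewrite ge /=; apply: leq_ltn_trans nj _.
by rewrite ltn_exp2r.
Qed.

Lemma fourth_gap j : 2 * (fourth j.+1 - fourth j)%:R / (fourth j)%:R <= 30 * j.+1%:R^-1 :> R.
Proof.
have lef : (fourth j <= fourth j.+1)%N by exact: leq_fourth.
rewrite natrB// /fourth !natrX -[(j.+2)%:R]natr1.
have x1 : (1 : R) <= j.+1%:R by rewrite ler1n.
move: j.+1%:R x1 => x x1; have x0 : 0 < x by exact: lt_le_trans ltr01 x1.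
rewrite ler_pdivrMr ?exprn_gt0//.
have -> : 30 * x^-1 * x ^+ 4 = 30 * x ^+ 3 by field; rewrite gt_eqF.
have -> : 2 * ((x + 1) ^+ 4 - x ^+ 4) = 8 * x ^+ 3 + 12 * x ^+ 2 + 8 * x + 2 by ring.
have h1 : 1 <= x ^+ 3 by rewrite exprn_ege1.
have h2 : x <= x ^+ 3 by rewrite -{1}[x]expr1 ler_weXn2l.
have h3 : x ^+ 2 <= x ^+ 3 by rewrite ler_weXn2l.
by move: (x ^+ 3) (x ^+ 2) h1 h2 h3 => *; lra.
Qed.

(** The ratios of consecutive fourth powers tend to [1] and the terms are
    bounded, so averages between two fourth powers are close to the average at
    the smaller one. *)
Lemma avg_cvg (t : nat -> R) (l : R) : (forall j, 0 <= t j <= 1) ->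
  avg t (fourth j) @[j --> \oo] --> l -> avg t n @[n --> \oo] --> l.
Proof.
move=> t01 cl; apply/cvgrPdist_le => e e0.
have e20 : 0 < e / 2 by rewrite divr_gt0.
have /cvgrPdist_le/(_ _ e20) [J1 _ J1P] := cl.
have [J2 J2P] : exists J2, forall j, (J2 <= j)%N -> 30 * (j.+1%:R)^-1 <= e / 2 :> R.
  have e30 : 0 < e / 60 by rewrite divr_gt0.
  have [J2 _ J2P] := near_infty_natSinv_lt (PosNum e30).
  exists J2 => j /J2P /ltW /=; move: (j.+1%:R^-1) => x xe; lra.
pose J := maxn J1 J2; exists (fourth J) => // n /= Jn.
have n0 : (0 < n)%N by exact: leq_trans (fourth_gt0 _) Jn.
have [j /andP[jn nj]] := fourth_between n0.
have Jj : (J <= j)%N.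
  by rewrite -2!ltnS -(@ltn_exp2r _ _ 4)// (leq_ltn_trans Jn).
have [J1j J2j] : (J1 <= j)%N /\ (J2 <= j)%N.
  by split; apply: leq_trans Jj; rewrite /J ?leq_maxl ?leq_maxr.
have h1 := J1P j J1j; have h2 := avg_close t01 (fourth_gt0 j) jn.
have h3 : 2 * (n - fourth j)%:R / (fourth j)%:R <= e / 2 :> R.
  apply: le_trans (J2P j J2j); apply: le_trans (fourth_gap j).
  rewrite ler_wpM2r ?invr_ge0// ler_wpM2l// ler_nat leq_sub2r// ltnW//.
have -> : l - avg t n = (l - avg t (fourth j)) - (avg t n - avg t (fourth j)).
  by rewrite opprB addrA subrK.
have -> : e = e / 2 + e / 2 by rewrite -splitr.
by apply: le_trans (ler_normB _ _) (lerD h1 (le_trans h2 h3)).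
Qed.

End Interpolation.

(** * Almost sure limits of tie frequencies *)

Section AlmostSureLimits.
Context d (Omega : measurableType d) (R : realType) (P : probability Omega R).
Context (Gamma : graph_limit R) (M : option nat) (alpha : nat -> R)
  (Gam : nat -> graph_limit R) (A : Omega -> rel nat).
Hypotheses (alpha_gt0 : forall i, below M i -> 0 < alpha i)
  (alpha_sum : (\sum_(0 <= i <oo | below M i) (alpha i)%:E <= 1)%E)
  (Gam_connected : forall i, below M i -> connected_limit (Gam i))
  (Gamma_decomp : is_direct_sum M alpha Gam Gamma)
  (A_G_infty : is_G_infty P Gamma A).
Context (S : nat -> R).
Hypothesis SP : forall k, (1 < k)%N ->
  \sum_(i < N) weight M alpha i ^+ k @[N --> \oo] --> S k.

Local Notation tie_freq := (tie_freq R A).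

Lemma tie_freq_fourth i j n : (fourth j <= n)%N ->
  Ex P (fun w => `|tie_freq i (fourth j) w - tie_freq i n w|) <= 4 * j.+1%:R ^- 2.
Proof.
move=> jn; have := @tie_freq_first_moment _ _ _ _ _ _ _ _ _ alpha_gt0 alpha_sum Gam_connected
  Gamma_decomp A_G_infty S SP i (fourth j) n (j.+1%:R ^+ 2).
by apply; rewrite ?fourth_gt0 ?exprn_gt0 ?fourthR.
Qed.

(** Consecutive differences along fourth powers are almost surely summable. *)
Lemma ae_tie_freq_cvg : {ae P, forall w, forall i, cvgn (tie_freq i ^~ w)}.
Proof.
apply: ae_foralln => i.
have bd n m : bmf (fun w => `|tie_freq i n w - tie_freq i m w|).
  apply: bmf_norm; apply: bmfD; first exact: (bmf_tie_freq A_G_infty).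
  by apply: bmfN; exact: (bmf_tie_freq A_G_infty).
have := @ae_summable_real _ _ _ P (fun j w => `|tie_freq i (fourth j) w - tie_freq i (fourth j.+1) w|) 4.
move=> /(_ (fun j => bd _ _) (fun j w => normr_ge0 _)) h.
have {h} := h (fun j => tie_freq_fourth i (leq_fourth (leqnSn j))).
apply: filterS => w cw.
pose u j := tie_freq i (fourth j) w.
have cs : cvgn (series (telescope u)).
  apply: normed_cvg.
  suff <- : series (fun j => `|tie_freq i (fourth j) w - tie_freq i (fourth j.+1) w|) =
    [normed series (telescope u)] by exact: cw.
  by congr series; apply/funext => j; rewrite /= distrC.
have : cvgn u.
  have -> : u = (fun n => u 0%N + series (telescope u) n).
    by apply/funext => j; rewrite -eq_sum_telescope.
  by apply: is_cvgD; [exact: is_cvg_cst|exact: cs].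
move=> /cvg_ex[l cl]; apply/cvg_ex; exists l.
by apply: (@avg_cvg R (fun j => tie_ind R A i j w) l _ cl) => j; exact: tie_ind01.
Qed.

(** The squared errors along fourth powers are almost surely summable. *)
Lemma ae_power_mean : {ae P, forall w, forall r, (0 < r)%N ->
  power_mean R A r (fourth j) w @[j --> \oo] --> S r.+1}.
Proof.
apply: ae_foralln => r; have [->|r0] := posnP r; first exact: aeW.
have bd n : bmf (fun w => (power_mean R A r n w - S r.+1) ^+ 2).
  by apply: bmfX; apply: bmfD; [exact: (bmf_power_mean A_G_infty)|exact: bmf_cst].
have := @ae_summable_real _ _ _ P (fun j w => (power_mean R A r (fourth j) w - S r.+1) ^+ 2)
  ((2 * r.+1%:R) ^+ 2).
move=> /(_ (fun j => bd _) (fun j w => sqr_ge0 _)) h.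
suff /h : forall j, Ex P (fun w => (power_mean R A r (fourth j) w - S r.+1) ^+ 2) <=
    (2 * r.+1%:R) ^+ 2 / j.+1%:R ^+ 2.
  apply: filterS => w cw _; have {cw} cw := cvg_series_cvg_0 cw.
  apply/cvgrPdist_le => e e0; have e20 : 0 < e ^+ 2 by rewrite exprn_gt0.
  have /cvgrPdist_le/(_ _ e20) := cw; apply: filterS => j.
  rewrite sub0r normrN normrX distrC.
  by rewrite ler_pXn2r// ?nnegrE ?normr_ge0// ltW.
move=> j; apply: le_trans (power_mean_second_moment alpha_gt0 alpha_sum Gam_connected
  Gamma_decomp A_G_infty SP r0 (fourth_gt0 j)) _.
rewrite ler_wpM2l ?sqr_ge0// lef_pV2 ?posrE ?exprn_gt0 ?ltr0n ?fourth_gt0//.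
rewrite -natrX ler_nat /fourth; exact: leq_pexp2l.
Qed.

Definition tie_density i w : R := limn (tie_freq i ^~ w).

(** Controls how far the frequencies of the first [n] vertices at time [n] are
    from their limits, on average over these vertices; convergence at each vertex
    separately would not bound it. *)
Definition spread n w : R := (\sum_(i < n) `|tie_freq i n w - tie_density i w|) / n%:R.

Let gap n m w : R := (\sum_(i < n) `|tie_freq i n w - tie_freq i m w|) / n%:R.

Let bmf_gap n m : bmf (gap n m).
Proof.
have h (i : 'I_n) : bmf (fun w => `|tie_freq i n w - tie_freq i m w|).
  apply: bmf_norm; apply: bmfD; first exact: (bmf_tie_freq A_G_infty).
  by apply: bmfN; exact: (bmf_tie_freq A_G_infty).
have := bmfZ n%:R^-1 (bmf_sum (index_enum 'I_n) xpredT h).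
by congr bmf; apply/funext => w; exact: mulrC.
Qed.

Let Ex_gap j m : (fourth j <= m)%N -> Ex P (gap (fourth j) m) <= 4 * j.+1%:R ^- 2.
Proof.
move=> jm; rewrite /gap.
have h (i : 'I_(fourth j)) : bmf (fun w => `|tie_freq i (fourth j) w - tie_freq i m w|).
  apply: bmf_norm; apply: bmfD; first exact: (bmf_tie_freq A_G_infty).
  by apply: bmfN; exact: (bmf_tie_freq A_G_infty).
under eq_fun do rewrite mulrC.
have n0 : (0 : R) < (fourth j)%:R by rewrite ltr0n fourth_gt0.
rewrite ExZ ?Ex_sum//; last exact: bmf_sum.
rewrite mulrC ler_pdivrMr//.
apply: (@le_trans _ _ (\sum_(i < fourth j) 4 * j.+1%:R ^- 2)).
  by apply: ler_sum => i _; exact: tie_freq_fourth.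
by rewrite sumr_const card_ord -[leLHS]mulr_natr.
Qed.

(** By Fatou's lemma, the bound on the mean differences with later frequencies
    holds for the difference with the limit too. *)
Lemma ae_spread : {ae P, forall w, spread (fourth j) w @[j --> \oo] --> (0 : R)}.
Proof.
pose g j m w := (gap (fourth j) (fourth j + m) w)%:E.
pose h j w := limn_einf (fun m => g j m w).
have mg j m : measurable_fun [set: Omega] (g j m).
  by apply/measurable_EFinP; have [] := bmf_gap (fourth j) (fourth j + m).
have g0 j m w : (0 <= g j m w)%E.
  by rewrite lee_fin /gap mulr_ge0// sumr_ge0.
have mh j : measurable_fun [set: Omega] (h j).
  apply: measurableT_comp => //; apply: measurable_fun_limn_esup => m.
  exact: measurableT_comp.
have h0 j w : (0 <= h j w)%E.
  rewrite /h limn_einf_lim; apply: lime_ge; first exact: is_cvg_einfs.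
  by apply: nearW => m; apply: le_ereal_inf_tmp => _ [n _ <-].
have hi j : (\int[P]_w h j w <= (4 * j.+1%:R ^- 2)%:E)%E.
  apply: le_trans (fatou P measurableT (mg j) (fun m w _ => g0 j m w)) _.
  rewrite limn_einf_lim; apply: lime_le; first exact: is_cvg_einfs.
  apply: nearW => m; apply: ereal_inf_le; exists (\int[P]_w g j m w)%E.
    by exists m => /=.
  by rewrite -Ex_fin ?lee_fin ?Ex_gap ?leq_addr.
have := ae_summable mh h0 hi; have := ae_tie_freq_cvg.
apply: filterS2 => w cw sw.
have hE j : h j w = (spread (fourth j) w)%:E.
  have cg : g j m w @[m --> \oo] --> (spread (fourth j) w)%:E.
    apply: cvg_EFin; first exact: filterE.
    rewrite /gap /spread; apply: cvgMl; apply: cvg_rsum => i _.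
    apply: cvg_norm; apply: cvgB; first exact: cvg_cst.
    have := cw i; rewrite -(cvg_shiftn (fourth j)).
    by under eq_fun do rewrite addnC.
  by rewrite /h is_cvg_limn_einfE; [exact: cvg_lim|apply/cvg_ex; exists (spread (fourth j) w)%:E].
apply: cvg_series_cvg_0; apply: summable_series.
  by move=> j; rewrite -lee_fin -hE.
by move: sw; under eq_eseriesr do rewrite hE.
Qed.

End AlmostSureLimits.

(** * Decreasing arrangements *)

Section Arrangement.
Context (R : realType) (T : eqType) (D : set T) (x : T -> R).
Hypothesis mass : forall s, uniq s -> (forall t, t \in s -> D t /\ 0 < x t) ->
  \sum_(t <- s) x t <= 1.

Let avail (s : seq T) : set T := [set t | [/\ D t, 0 < x t & t \notin s]].

Lemma few_large eps : 0 < eps -> exists N, forall s, uniq s ->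
  (forall t, t \in s -> D t /\ eps <= x t) -> (size s <= N)%N.
Proof.
move=> e0; exists (Num.bound eps^-1) => s us sD.
have e1 : (0 : R) <= eps^-1 by rewrite invr_ge0 ltW.
rewrite -(ler_nat R); apply: le_trans (ltW (archi_boundP e1)).
rewrite -[leRHS]mul1r ler_pdivlMr//; apply: le_trans (mass us _); last first.
  by move=> t /sD[Dt et]; split=> //; exact: lt_le_trans et.
have -> : (size s)%:R * eps = \sum_(t <- s) eps :> R.
  by rewrite big_const_seq count_predT iter_addr addr0 mulr_natl.
by rewrite big_seq [leRHS]big_seq; apply: ler_sum => t /sD[].
Qed.

Lemma seq_max (s : seq T) t : t \in s ->
  exists2 u, u \in s & forall v, v \in s -> x v <= x u.
Proof.
elim: s t => // a s IHs t _; case: s IHs => [|b s] IHs.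
  by exists a; rewrite ?mem_head// => v; rewrite inE => /eqP ->.
have [u us um] := IHs b (mem_head _ _).
have [ua|/ltW au] := leP (x u) (x a).
  exists a; first exact: mem_head.
  by move=> v; rewrite in_cons => /predU1P[->//|/um vu]; exact: le_trans vu ua.
by exists u; [rewrite in_cons us orbT|move=> v; rewrite in_cons => /predU1P[->|/um]].
Qed.

Lemma avail_max s t1 : avail s t1 ->
  exists2 t, avail s t & forall u, avail s u -> x u <= x t.
Proof.
move=> a1; have [N NP] := few_large (let: And3 _ h _ := a1 in h).
pose Q n := `[< exists l, [/\ uniq l, size l = n &
  forall t, t \in l -> avail s t /\ x t1 <= x t] >].
have exQ : exists n, Q n.
  exists 1%N; apply/asboolP; exists [:: t1]; split => // t.
  by rewrite inE => /eqP ->.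
have ubQ n : Q n -> (n <= N)%N.
  move=> /asboolP[l [ul <- lP]]; apply: NP => // t /lP[[Dt _ _] t1t].
  by split.
have [n /asboolP[l [ul ln lP]] nmax] := ex_maxnP exQ ubQ.
have all_l u : avail s u -> x t1 <= x u -> u \in l.
  move=> au t1u; apply/negPn/negP => ul'; have : Q n.+1.
    apply/asboolP; exists (u :: l); rewrite /= ul' ul ln; split => // t.
    by rewrite inE => /predU1P[->|/lP].
  by move=> /nmax; rewrite ltnn.
have [t tl tmax] := seq_max (all_l t1 a1 (lexx _)).
have [at_ t1t] := lP t tl; exists t => // u au.
have [t1u|/ltW ut1] := leP (x t1) (x u); first exact: tmax (all_l u au t1u).
exact: le_trans ut1 t1t.
Qed.

Let next s : option T :=
  match pselect (exists t, avail s t) with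
  | left h => let: exist t a := cid h in Some (s2val (cid2 (avail_max a)))
  | right _ => None
  end.

Lemma nextP s : match next s with
  | Some t => avail s t /\ forall u, avail s u -> x u <= x t
  | None => forall t, ~ avail s t end.
Proof.
rewrite /next; case: pselect => [h|h]; last by move=> t a; apply: h; exists t.
case: (cid h) => t a; case: (cid2 _) => u /= au umax; by split.
Qed.

Let chosen n : seq T :=
  iter n (fun s => if next s is Some t then rcons s t else s) [::].

Let chosen_mono m n t : (m <= n)%N -> t \in chosen m -> t \in chosen n.
Proof.
move=> /subnKC <-; elim: (n - m)%N => [|k IHk] tm; first by rewrite addn0.
rewrite addnS /chosen iterS -/(chosen _); case: (next _) => [u|]; last exact: IHk.
by rewrite mem_rcons inE IHk ?orbT.
Qed.

Let val n : R := if next (chosen n) is Some t then x t else 0.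

(** Only finitely many values exceed a given positive bound. Hence there is a
    largest remaining value at each stage, and every positive value is chosen
    at some stage. *)
Lemma arrangement_exists (t0 : T) : exists p, decreasing_arrangement D x p.
Proof.
have val_ge0 n : 0 <= val n.
  by rewrite /val; have := nextP (chosen n); case: (next _) => // t [[_ /ltW]].
exists val; split => // [m n /subnKC <-|].
  elim: (n - m)%N => [|k IHk]; rewrite ?addn0// addnS.
  apply: le_trans IHk; rewrite /val /chosen iterS -/(chosen _).
  have := nextP (chosen (m + k)); case E: (next (chosen (m + k))) => [t|].
    move=> [at_ tmax]; have := nextP (rcons (chosen (m + k)) t).
    case: (next (rcons _ _)) => [u [[Du xu ul] _]|_]; last by case: at_ => _ /ltW.
    apply: tmax; split => //; apply: contra ul; rewrite mem_rcons inE => ->.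
    by rewrite orbT.
  by rewrite E lexx.
pose f n := if next (chosen n) is Some t then t else t0.
have fP n : 0 < val n -> [/\ avail (chosen n) (f n), val n = x (f n) & f n \in chosen n.+1].
  rewrite /val /f /chosen iterS -/(chosen _); have := nextP (chosen n).
  case: (next _) => [t [at_ _] _|]; last by rewrite ltxx.
  by split; rewrite ?mem_rcons ?mem_head.
exists f; split; last by move=> n /fP[].
split.
- by move=> n /fP[[Df xf _] _ _].
- have fI m n : 0 < val m -> 0 < val n -> (m < n)%N -> f m <> f n.
    move=> /fP[_ _ fm] /fP[[_ _ fn] _ _] mn E.
    by move: fn; rewrite -E (chosen_mono mn fm).
  move=> m n; rewrite !in_setE /= => m0 n0 E; case: (ltngtP m n) => // mn.
    by case: (fI m n m0 n0 mn).
  by case: (fI n m n0 m0 mn).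
move=> t [Dt xt]; apply: contrapT => nt.
have tn n : t \notin chosen n.
  elim: n => // n IHn; rewrite /chosen iterS -/(chosen _).
  have := nextP (chosen n); case E: (next _) => [u|//] [au _].
  rewrite mem_rcons inE negb_or IHn andbT; apply/negP => /eqP tu; apply: nt; exists n.
    by rewrite /= /val E; case: au.
  by rewrite /f E.
have [N NP] := few_large xt.
suff h n : [/\ uniq (chosen n), size (chosen n) = n &
    forall u, u \in chosen n -> D u /\ x t <= x u].
  by have [un sn nP] := h N.+1; have := NP _ un nP; rewrite sn ltnn.
elim: n => [|n [un sn nP]]; first by [].
rewrite /chosen iterS -/(chosen _).
have at_ : avail (chosen n) t by [].
have := nextP (chosen n); case: (next _) => [u [[Du xu ul] umax]|/(_ t)//].
split; rewrite ?rcons_uniq ?un ?ul ?size_rcons ?sn// => v.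
by rewrite mem_rcons inE => /predU1P[->|/nP//]; split => //; exact: umax.
Qed.

End Arrangement.

(** * Sequences determined by trapped power sums *)

Section Sandwich.
Context (R : realType).

Lemma arrangement_sandwich (T : eqType) (D : set T) (x : T -> R) p f t r L :
  (forall n, 0 <= p n) -> (forall m n, (m <= n)%N -> p n <= p m) ->
  set_bij [set n | 0 < p n] [set i | D i /\ 0 < x i] f ->
  (forall n, 0 < p n -> p n = x (f n)) -> D t -> 0 <= x t -> (0 < r)%N ->
  let c := \sum_(m < L) ((0 < p m) && (f m == t))%:R * p m ^+ r in
  c <= x t ^+ r <= c + p L ^+ r.
Proof.
move=> p0 pd [_ fI fS] pf Dt xt0 r0; have pL0 : 0 <= p L ^+ r by rewrite exprn_ge0.
have [xt|] := ltP 0 (x t); last first.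
  move=> xt1; have {xt1}xt0' : x t = 0 by apply/eqP; rewrite eq_le xt1.
  rewrite /= big1 ?add0r ?xt0' ?expr0n ?gtn_eqF ?lexx//= => m _.
  case: (boolP (_ && _)) => [/andP[pm /eqP fm]|_]; last by rewrite mul0r.
  by have := pm; rewrite (pf m pm) fm xt0' ltxx.
have [n /= pn fn] := fS t (conj Dt xt).
have same m : (0 < p m) && (f m == t) = (m == n).
  apply/andP/eqP => [[pm /eqP fm]|->]; last by rewrite pn fn eqxx.
  by apply: fI; rewrite ?in_setE//= fm fn.
have pnt : p n = x t by rewrite pf// fn.
have cE : \sum_(m < L) ((0 < p m) && (f m == t))%:R * p m ^+ r = (n < L)%:R * x t ^+ r.
  have [nL|Ln] := ltnP n L; last first.
    by rewrite mul0r big1// => m _; rewrite same ltn_eqF ?mul0r// (leq_trans _ Ln).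
  rewrite (bigD1 (Ordinal nL))//= same eqxx pnt big1 ?addr0// => m mn.
  by rewrite same (negPf (mn : (m : nat) != n)) mul0r.
rewrite /= cE; have [nL|Ln] := ltnP n L; first by rewrite mul1r lexx lerDl.
by rewrite mul0r exprn_ge0// add0r -pnt lerXn2r ?nnegrE// pd.
Qed.

(** In the limit the weights [w n] give mass [p m] to the index of the [m]-th
    largest value; the remaining indices have values at most [p L] and total
    weight at most one. *)
Lemma power_sum_sandwich (T : eqType) (D : set T) (x : T -> R) p f
    (N : nat -> nat) (w : nat -> nat -> R) (key : nat -> T) (S : R) r L :
  (forall n, 0 <= p n) -> (forall m n, (m <= n)%N -> p n <= p m) ->
  set_bij [set n | 0 < p n] [set i | D i /\ 0 < x i] f ->
  (forall n, 0 < p n -> p n = x (f n)) -> (0 < r)%N ->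
  (forall t, D t -> 0 <= x t) ->
  (forall n i, 0 <= w n i) -> (forall n i, 0 < w n i -> D (key i)) ->
  (forall n, \sum_(i < N n) w n i <= 1) ->
  (forall m, 0 < p m -> \sum_(i < N n) w n i * (f m == key i)%:R @[n --> \oo] --> p m) ->
  \sum_(i < N n) w n i * x (key i) ^+ r @[n --> \oo] --> S ->
  \sum_(m < L) p m ^+ r.+1 <= S <= \sum_(m < L) p m ^+ r.+1 + p L ^+ r.
Proof.
move=> p0 pd fb pf r0 x0 w0 wD w1 cw cS.
pose c i := \sum_(m < L) ((0 < p m) && (f m == key i))%:R * p m ^+ r.
have cA : \sum_(i < N n) w n i * c i @[n --> \oo] --> \sum_(m < L) p m ^+ r.+1.
  have -> : (fun n => \sum_(i < N n) w n i * c i) = (fun n =>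
      \sum_(m < L) (\sum_(i < N n) w n i * ((0 < p m) && (f m == key i))%:R) * p m ^+ r).
    apply/funext => n; under [RHS]eq_bigr do rewrite big_distrl/=.
    rewrite exchange_big; apply: eq_bigr => i _; rewrite big_distrr; apply: eq_bigr => m _.
    by rewrite /= mulrA.
  apply: cvg_rsum => m _; rewrite exprS; apply: cvgMl.
  have [pm|pm] := ltP 0 (p m); first exact: cw.
  have -> : p m = 0 by apply/eqP; rewrite eq_le pm p0.
  apply: cvg_near_cst; apply: nearW => n; rewrite big1// => i _.
  by rewrite mulr0.
have bound n i : w n i * c i <= w n i * x (key i) ^+ r <= w n i * c i + w n i * p L ^+ r.
  have [wi|] := ltP 0 (w n i); last first.
    move=> wi; have -> : w n i = 0 by apply/eqP; rewrite eq_le wi w0.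
    by rewrite !mul0r addr0 lexx.
  have Di := wD n i wi.
  have := arrangement_sandwich L p0 pd fb pf Di (x0 _ Di) r0; rewrite /= -/(c i).
  by rewrite -mulrDr !ler_pM2l.
apply/andP; split.
  apply: (ler_cvg_to cA cS); apply: nearW => n; apply: ler_sum => i _.
  by have /andP[] := bound n i.
apply: (ler_cvg_to cS (cvgD cA (cvg_cst (p L ^+ r)))); apply: nearW => n.
apply: (@le_trans _ _ (\sum_(i < N n) (w n i * c i + w n i * p L ^+ r))).
  by apply: ler_sum => i _; have /andP[] := bound n i.
rewrite big_split/= lerD2l -big_distrl/=.
by apply: ler_piMl; [exact: exprn_ge0|exact: w1].
Qed.

(** The terms left out are at most [p L], so [p L ^+ r] bounds the sum of their
    powers when the total mass is at most one. *)
Definition trapped (S : nat -> R) (p : nat -> R) := forall r L, (0 < r)%N ->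
  \sum_(m < L) p m ^+ r.+1 <= S r.+1 <= \sum_(m < L) p m ^+ r.+1 + p L ^+ r.

(** If [p L < q L], the two bounds give [q L ^+ r.+1 <= p L ^+ r] for all [r],
    which fails for large [r]. *)
Lemma trapped_step S p q L : (forall n, 0 <= p n) ->
  trapped S p -> trapped S q -> (forall m, (m < L)%N -> p m = q m) -> q L <= p L.
Proof.
move=> p0 Sp Sq pq; rewrite leNgt; apply/negP => pL.
have q0 : 0 < q L by exact: le_lt_trans (p0 L) pL.
have le r : (0 < r)%N -> q L ^+ r.+1 <= p L ^+ r.
  move=> r0; have /andP[h _] := Sq r L.+1 r0; have /andP[_ h'] := Sp r L r0.
  have := le_trans h h'; rewrite big_ord_recr /=.
  have -> : \sum_(m < L) p m ^+ r.+1 = \sum_(m < L) q m ^+ r.+1.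
    by apply: eq_bigr => m _; rewrite pq.
  by rewrite lerD2l.
have z1 : `|p L / q L| < 1 by rewrite ger0_norm ?divr_ge0 ?(ltW q0)// ltr_pdivrMr// mul1r.
have /cvgrPdist_lt/(_ _ q0) [n _ nP] := cvg_expr z1.
have := nP n.+1 (leqnSn n); rewrite sub0r normrN normrX ger0_norm ?divr_ge0 ?(ltW q0)//.
rewrite expr_div_n ltr_pdivrMr ?exprn_gt0// -exprS ltNge.
by rewrite le.
Qed.

Lemma trapped_unique S p q : (forall n, 0 <= p n) -> (forall n, 0 <= q n) ->
  trapped S p -> trapped S q -> p = q.
Proof.
move=> p0 q0 Sp Sq; apply/funext => n.
elim/ltn_ind: n => n IHn; apply/eqP; rewrite eq_le.
rewrite (trapped_step q0 Sq Sp)// ?(trapped_step p0 Sp Sq)// => m mn.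
by rewrite IHn.
Qed.

End Sandwich.

(** * Densities of the blocks of a graph *)

Section Blocks.
Context (R : realType) (e : rel nat).
Hypothesis es : symmetric e.

Let F i n : R := avg (fun j => (tie e i j)%:R) n.

Lemma tie_component i j : tie e i j = (component e i == component e j).
Proof.
apply/(tieP e)/eqP => [|->]; first exact: component_eq.
exact: component_refl.
Qed.

Lemma frequency_component i n : frequency R (component e i) n = F i n.
Proof.
rewrite /F /avg /frequency; congr (_ / _).
rewrite -sum1_card big_mkcond natr_sum; apply: eq_bigr => j _.
rewrite inE; have -> : ((j : nat) \in component e i) = tie e i j.
  by apply/idP/(tieP e); rewrite in_setE.
by case: (tie e i j).
Qed.

Lemma frequency_block B n : blocks e B ->
  frequency R B n = \sum_(k < n) n%:R^-1 * (B == component e k)%:R.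
Proof.
move=> [i _ <-]; rewrite frequency_component /F /avg mulrC big_distrr.
by apply: eq_bigr => k _; rewrite tie_component.
Qed.

Hypothesis Fcvg : forall i, cvgn (F i).

Lemma frequency_cvg B : blocks e B -> frequency R B n @[n --> \oo] --> density R B.
Proof.
move=> [i _ <-]; have := @Fcvg i; rewrite /density.
by have -> : F i = frequency R (component e i) by apply/funext => n; rewrite frequency_component.
Qed.

Lemma density_component i : density R (component e i) = limn (F i).
Proof.
by congr (limn _); apply/funext => n; rewrite frequency_component.
Qed.

Lemma density_ge0 B : blocks e B -> 0 <= density R B.
Proof.
move=> Bb; apply: (cvgr_to_ge (frequency_cvg Bb)); apply: nearW => n.
by rewrite /frequency mulr_ge0// invr_ge0.
Qed.

(** Distinct blocks are disjoint, so their frequencies add up to at most one. *)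
Lemma density_mass s : uniq s -> (forall B, B \in s -> blocks e B /\ 0 < density R B) ->
  \sum_(B <- s) density R B <= 1.
Proof.
move=> us sb.
have cs : \sum_(B <- s | B \in s) frequency R B n @[n --> \oo] -->
    \sum_(B <- s | B \in s) density R B.
  by apply: cvg_rsum => B /sb[Bb _]; exact: frequency_cvg.
rewrite big_seq; apply: (cvgr_to_le cs); apply: nearW => n.
under eq_bigr => B Bs do rewrite (frequency_block n (sb B Bs).1).
rewrite -big_seq exchange_big/=.
apply: (@le_trans _ _ (\sum_(k < n) n%:R^-1)).
  apply: ler_sum => k _; rewrite -big_distrr/= ler_piMr// ?invr_ge0//.
  rewrite -natr_sum (_ : (\sum_(B <- s) (B == component e k))%N = count_mem (component e k) s).
    by rewrite count_uniq_mem// lern1 leq_b1.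
  by rewrite -sum1_count [RHS]big_mkcond.
rewrite sumr_const card_ord -[_ *+ n]mulr_natl.
by case: n => [|n]; [rewrite mul0r|rewrite divff].
Qed.

Lemma expr_lipschitz (a b : R) r : 0 <= a <= 1 -> 0 <= b <= 1 ->
  `|a ^+ r - b ^+ r| <= r%:R * `|a - b|.
Proof.
move=> /andP[a0 a1] /andP[b0 b1]; rewrite subrXX normrM mulrC ler_wpM2r//.
apply: le_trans (ler_norm_sum _ _ _) _.
rewrite -[leRHS](_ : \sum_(i < r) 1 = r%:R); last by rewrite sumr_const card_ord.
apply: ler_sum => i _; rewrite ger0_norm ?mulr_ge0 ?exprn_ge0//.
by rewrite mulr_ile1 ?exprn_ge0 ?exprn_ile1.
Qed.

Hypothesis Fspread :
  (\sum_(i < fourth j) `|F i (fourth j) - limn (F i)|) / (fourth j)%:R @[j --> \oo] --> (0 : R).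
Context (S : nat -> R).
Hypothesis Fpower : forall r, (0 < r)%N ->
  (\sum_(i < fourth j) F i (fourth j) ^+ r) / (fourth j)%:R @[j --> \oo] --> S r.+1.

Let F01 i n : 0 <= F i n <= 1.
Proof.
rewrite -frequency_component /frequency mulr_ge0 ?invr_ge0//=.
case: n => [|n]; first by rewrite invr0 mulr0.
by rewrite ler_pdivrMr// mul1r ler_nat (leq_trans (max_card _))// card_ord.
Qed.

Let D01 i : 0 <= limn (F i) <= 1.
Proof.
apply/andP; split; [apply: (cvgr_to_ge (@Fcvg i))|apply: (cvgr_to_le (@Fcvg i))];
  by apply: nearW => n; have /andP[] := F01 i n.
Qed.

(** Replacing every frequency by its limit changes the power means by at most
    [r] times the spread. *)
Lemma power_density r : (0 < r)%N ->
  \sum_(i < fourth j) (fourth j)%:R^-1 * density R (component e i) ^+ r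
    @[j --> \oo] --> S r.+1.
Proof.
move=> r0; rewrite -[S r.+1]subr0.
pose Z j := \sum_(i < fourth j) (fourth j)%:R^-1 * density R (component e i) ^+ r.
pose U j := (\sum_(i < fourth j) F i (fourth j) ^+ r) / (fourth j)%:R.
have -> : (fun j => Z j) = (fun j => U j - (U j - Z j)).
  by apply/funext => j; rewrite opprB addrC subrK.
apply: cvgB; first exact: Fpower.
have c0 : r%:R * ((\sum_(i < fourth j) `|F i (fourth j) - limn (F i)|) / (fourth j)%:R)
    @[j --> \oo] --> (0 : R).
  by rewrite -[X in _ --> X](mulr0 r%:R); apply: cvgMr.
apply/cvgrPdist_le => eps e0; have /cvgrPdist_le/(_ _ e0) := c0.
apply: filterS => j; rewrite !sub0r !normrN => h; apply: le_trans h.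
apply: le_trans (ler_norm _).
rewrite /U /Z -big_distrr/= [X in _ - X]mulrC -mulrBl normrM.
rewrite (@ger0_norm _ (_^-1)) ?invr_ge0// mulrA ler_wpM2r ?invr_ge0//.
rewrite -sumrB big_distrr; apply: le_trans (ler_norm_sum _ _ _) _.
by apply: ler_sum => i _; rewrite density_component; exact: expr_lipschitz.
Qed.

(** A uniform vertex below [n] falls into a block with probability the frequency
    of the block, so in the limit a block is weighted by its own density. *)
Lemma block_densities_trapped : exists q, [/\ forall n, 0 <= q n,
  trapped S q & block_densities e q].
Proof.
have [q [q0 qd [f [fb fq]]]] := arrangement_exists density_mass set0.
exists q; split => //; last first.
  split; last by split => //; exists f.
  by move=> B /frequency_cvg h; apply/cvg_ex; exists (density R B).
move=> r L r0.
apply: (@power_sum_sandwich R (set nat) (blocks e) (@density R) q f fourth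
  (fun j _ => (fourth j)%:R^-1) (component e)) => //.
- exact: density_ge0.
- by move=> j i _; exists i.
- move=> j; rewrite sumr_const card_ord -[_ *+ _]mulr_natl divff//.
  by rewrite pnatr_eq0 -lt0n fourth_gt0.
- move=> m qm; have [Bb _] : blocks e (f m) /\ 0 < density R (f m) by case: fb => + _ _; apply.
  rewrite (fq m qm).
  have -> : (fun j => \sum_(i < fourth j) (fourth j)%:R^-1 * (f m == component e i)%:R) =
      frequency R (f m) \o fourth by apply/funext => j; rewrite /= frequency_block.
  exact: (cvg_comp fourth _ fourth_oo (frequency_cvg Bb)).
- exact: power_density.
Qed.

End Blocks.

(** * Power sums of the weights *)

Section Weights.
Context (R : realType) (M : option nat) (alpha : nat -> R).
Hypotheses (alpha_gt0 : forall i, below M i -> 0 < alpha i)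
  (alpha_sum : (\sum_(0 <= i <oo | below M i) (alpha i)%:E <= 1)%E).

Local Notation weight := (weight M alpha).

Lemma sum_alpha_uniq s : uniq s -> (forall t, t \in s -> below M t /\ 0 < alpha t) ->
  \sum_(t <- s) alpha t <= 1.
Proof.
move=> us sM; pose N := (\max_(t <- s) t).+1.
apply: le_trans (sum_weight_le1 alpha_gt0 alpha_sum N).
have -> : \sum_(t <- s) alpha t = \sum_(t <- s) \sum_(i < N) (t == i)%:R * weight i.
  rewrite big_seq [RHS]big_seq; apply: eq_bigr => t ts.
  have tN : (t < N)%N by rewrite ltnS; apply: leq_bigmax_seq.
  rewrite (bigD1 (Ordinal tN))//= eqxx mul1r /weight (sM t ts).1 big1 ?addr0// => i it.
  by rewrite eq_sym (negPf (it : (i : nat) != t)) mul0r.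
rewrite exchange_big; apply: ler_sum => i _.
rewrite -big_distrl/= ler_piMl// ?weight_ge0//.
rewrite -natr_sum (_ : (\sum_(t <- s) (t == i))%N = count_mem (i : nat) s).
  by rewrite count_uniq_mem// lern1 leq_b1.
by rewrite -sum1_count [RHS]big_mkcond.
Qed.

Context (S : nat -> R).
Hypothesis SP : forall k, (1 < k)%N ->
  \sum_(i < N) weight i ^+ k @[N --> \oo] --> S k.

(** Here the index [i] is weighted by [weight i], that is, by its own value. *)
Lemma weights_trapped : exists p, [/\ forall n, 0 <= p n,
  trapped S p & decreasing_arrangement [set i | below M i] alpha p].
Proof.
have [p pA] := @arrangement_exists R nat [set i | below M i] alpha sum_alpha_uniq 0%N.
have [p0 pd [f [fb fp]]] := pA; exists p; split => // r L r0.
have wE i : weight i != 0 -> below M i /\ weight i = alpha i.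
  by rewrite /weight; case: ifP => //; rewrite eqxx.
apply: (@power_sum_sandwich R nat [set i | below M i] alpha p f id
  (fun _ i => weight i) id) => //.
- by move=> i /= /alpha_gt0/ltW.
- by move=> n i; exact: weight_ge0.
- by move=> n i; rewrite lt0r => /andP[/wE[]].
- by move=> n; exact: sum_weight_le1.
- move=> m pm; have [/= Mf _] : below M (f m) /\ 0 < alpha (f m) by case: fb => + _ _; apply.
  apply: cvg_near_cst; exists (f m).+1 => // n /= fn.
  rewrite (bigD1 (Ordinal fn))//= eqxx mulr1 big1 ?addr0 => [|i im].
    by rewrite fp// /weight Mf.
  by rewrite eq_sym (negPf (im : (i : nat) != f m)) mulr0.
- have -> : (fun n => \sum_(i < n) weight i * alpha i ^+ r) =
      (fun n => \sum_(i < n) weight i ^+ r.+1); last exact: SP.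
  apply/funext => n; apply: eq_bigr => i _; have [->|/wE[_ <-]] := eqVneq (weight i) 0.
    by rewrite mul0r expr0n.
  by rewrite exprS.
Qed.

End Weights.

Theorem theorem1p23 (R : realType) (Gamma : graph_limit R)
    (M : option nat) (alpha : nat -> R) (Gam : nat -> graph_limit R)
    (alpha_gt0 : forall i, below M i -> 0 < alpha i)
    (alpha_sum : (\sum_(0 <= i <oo | below M i) (alpha i)%:E <= 1)%E)
    (Gam_connected : forall i, below M i -> connected_limit (Gam i))
    (Gamma_decomp : is_direct_sum M alpha Gam Gamma)
    (d : measure_display) (Omega : measurableType d) (P : probability Omega R)
    (A : Omega -> rel nat) (A_G_infty : is_G_infty P Gamma A) :
  exists p : nat -> R,
    decreasing_arrangement [set i | below M i] alpha p /\
    {ae P, forall w, block_densities (A w) p}.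
Proof.
have /choice[S SP0] : forall k, exists s : R, (0 < k)%N ->
    \sum_(i < N) weight M alpha i ^+ k @[N --> \oo] --> s.
  move=> k; have [->|k0] := posnP k; first by exists 0.
  by have [s sP] := power_sum_cvg alpha_gt0 alpha_sum k0; exists s.
have SP k : (1 < k)%N -> \sum_(i < N) weight M alpha i ^+ k @[N --> \oo] --> S k.
  by move=> /ltnW; exact: SP0.
have [p [p0 pS pA]] := weights_trapped alpha_gt0 alpha_sum SP.
exists p; split => //.
have := ae_tie_freq_cvg alpha_gt0 alpha_sum Gam_connected Gamma_decomp A_G_infty SP.
have := ae_power_mean alpha_gt0 alpha_sum Gam_connected Gamma_decomp A_G_infty SP.
have := ae_spread alpha_gt0 alpha_sum Gam_connected Gamma_decomp A_G_infty SP.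
apply: filterS3 => w spread_w power_w cvg_w.
have Aw : symmetric (A w) by case: A_G_infty.
have [q [q0 qS qB]] := block_densities_trapped Aw cvg_w spread_w power_w.
by rewrite (trapped_unique p0 q0 pS qS).
Qed.
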